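(* Let $s>0$, let $R$ be a subdomain of $\Omega$, and let $\mathcal{L}$ and $\mathcal{L}_s=\mathcal{L}+\mathrm{i}\,s\,\chi_R$ be the operators defined in the context. Let $(\mu,\phi)$ be an eigenpair of $\mathcal{L}_s$. Then $$s\,[\delta(\phi,R)]^2\le\mathrm{dist}(\mu,\mathrm{Spec}(\mathcal{L}+\mathrm{i}\,s))\le s\,\delta(\phi,R),$$ $$\mathrm{dist}(\operatorname{Re}\mu,\mathrm{Spec}(\mathcal{L}))\le s\,\delta(\phi,R)\,\tau(\phi,R).$$ Let $\lambda=\mathrm{arg\,min}\{|\sigma-\operatorname{Re}\mu|:\sigma\in\mathrm{Spec}(\mathcal{L})\}$. If $\Lambda\subset\mathrm{Spec}(\mathcal{L})$ contains $\lambda$, then $$\inf_{v\in E(\Lambda,\mathcal{L})}\frac{\|\phi-v\|_{L^2(\Omega)}}{\|\phi\|_{L^2(\Omega)}}\le\frac{s\,\delta(\phi,R)\,\tau(\phi,R)}{\mathrm{dist}(\operatorname{Re}\mu,\mathrm{Spec}(\mathcal{L})\setminus(\Lambda\cup\{\operatorname{Re}\mu\}))},$$ where $E(\Lambda,\mathcal{L})$ is the corresponding invariant subspace.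
   Context: Setting: $\Omega\subset\mathbb{R}^d$ is a bounded, connected open set; $V\in L^\infty(\Omega)$ is (real and) non-negative; $A:\Omega\to\mathbb{R}^{d\times d}$ is a symmetric matrix function for which there are constants $c,C>0$ with $c\,\mathbf{v}^t\mathbf{v}\le \mathbf{v}^tA(x)\mathbf{v}\le C\,\mathbf{v}^t\mathbf{v}$ for all $\mathbf{v}\in\mathbb{R}^d$ and a.e. $x\in\Omega$. When $d=2$, it is required that $A\in[L^\infty(\Omega)]^{d\times d}$; when $d>2$, it is required that each component of $A$ is uniformly Lipschitz. Operators: $\mathcal{L}v=-\nabla\cdot(A\nabla v)+Vv$ is viewed as an unbounded selfadjoint operator on the complex Hilbert space $L^2(\Omega)$ with domain $\mathrm{Dom}(\mathcal{L})=\{v\in H^1_0(\Omega):\mathcal{L}v\in L^2(\Omega)\}$ (homogeneous Dirichlet conditions). Its spectrum $\mathrm{Spec}(\mathcal{L})$ is a sequence of real eigenvalues $\lambda_1<\lambda_2\le\lambda_3\le\cdots$ with no finite accumulation points. A subdomain of $\Omega$ means a non-empty, open, proper subset $R$ of $\Omega$ (not necessarily connected), and $\chi_R$ is its characteristic function, acting by multiplication. For $s>0$, $\mathcal{L}_s=\mathcal{L}+\mathrm{i}\,s\,\chi_R$ and $\mathcal{L}+\mathrm{i}\,s$ (the shift of $\mathcal{L}$ by $\mathrm{i}s$ times the identity) both have domain $\mathrm{Dom}(\mathcal{L})$. An eigenpair of an operator consists of an eigenvalue and a corresponding nonzero eigenvector in its domain. The eigenspaces are $E(\sigma,\mathcal{L})=\{v\in\mathrm{Dom}(\mathcal{L}):\mathcal{L}v=\sigma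 v\}$, and for $\Lambda\subset\mathrm{Spec}(\mathcal{L})$, $E(\Lambda,\mathcal{L})=\bigoplus\{E(\sigma,\mathcal{L}):\sigma\in\Lambda\}$. Localization measures: for a nonzero $v\in L^2(\Omega)$, $\delta(v,R)=\|v\|_{L^2(\Omega\setminus R)}/\|v\|_{L^2(\Omega)}$ and $\tau(v,R)=\|v\|_{L^2(R)}/\|v\|_{L^2(\Omega)}$. The distance $\mathrm{dist}$ is the Euclidean distance in $\mathbb{C}$ from a point to a set. *)

(* Defs.v *)
From HB Require Import structures.
From mathcomp Require Import all_boot all_order all_algebra.
From mathcomp Require Import all_classical all_reals all_analysis.
From mathcomp Require Import complex.

Set Implicit Arguments.
Unset Strict Implicit.
Unset Printing Implicit Defensive.
Import Order.TTheory GRing.Theory Num.Theory.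
Import numFieldNormedType.Exports.

Local Open Scope classical_set_scope.
Local Open Scope ring_scope.

(* The sigma-algebra generated by the coordinates, i.e. the Borel one.  Working
   with Borel functions loses nothing: every Lebesgue measurable function is
   a.e. equal to a Borel one, and everything below is invariant under a.e.
   equality. *)
Definition rV_display : measure_display. Proof. exact: default_measure_display. Qed.

Section measurable_rV.
Variables (R : realType) (n : nat).

Let coors : 'I_n -> 'rV[R]_n -> R := fun i x => x ord0 i.

Let rV_set0 : g_sigma_preimage coors set0.
Proof. exact: sigma_algebra0. Qed.

Let rV_setC A : g_sigma_preimage coors A -> g_sigma_preimage coors (~` A).
Proof. exact: sigma_algebraC. Qed.

Let rV_bigcup (F : (set 'rV[R]_n)^nat) :
  (forall i, g_sigma_preimage coors (F i)) ->
  g_sigma_preimage coors (\bigcup_i (F i)).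
Proof. exact: sigma_algebra_bigcup. Qed.

HB.instance Definition _ := @isMeasurable.Build
  rV_display
  'rV[R]_n (g_sigma_preimage coors) rV_set0 rV_setC rV_bigcup.

End measurable_rV.

Section lebesgue_measure_rV.
Variable R : realType.

Definition cons_rV n (p : 'rV[R]_n * R) : 'rV[R]_n.+1 := row_mx p.2%:M p.1.

Lemma measurable_rV_coord n (i : 'I_n) :
  measurable_fun [set: 'rV[R]_n] (fun x : 'rV[R]_n => x ord0 i).
Proof.
move=> _ Y mY; rewrite setTI; apply: sub_sigma_algebra => /=.
rewrite -bigcup_seq/=; exists i => /=; first by rewrite mem_index_enum.
by exists Y => //; rewrite setTI.
Qed.

Lemma measurable_cons_rV n :
  measurable_fun [set: 'rV[R]_n * R] (@cons_rV n).
Proof.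
apply: measurability; first by [].
rewrite -bigcup_mkord_ord => _ [B [i ilt [C mC <-]] <-]; rewrite !setTI.
rewrite -comp_preimage -[X in measurable X]setTI.
suff : measurable_fun [set: 'rV[R]_n * R]
  ((fun x : 'rV[R]_n.+1 => x ord0 (inord i)) \o @cons_rV n) by exact.
have [j|j] := @fintype.splitP 1 n (inord i : 'I_(1 + n)) => ij.
  rewrite (_ : _ \o _ = snd) //; apply/funext => p /=.
  have -> : inord i = lshift n j by apply: val_inj; exact: ij.
  by rewrite /cons_rV (@row_mxEl _ 1 1 n) mxE (ord1 j) eqxx.
rewrite (_ : _ \o _ = (fun x : 'rV[R]_n => x ord0 j) \o fst).
  by apply: measurableT_comp => //; exact: measurable_rV_coord.
apply/funext => p /=.
have -> : inord i = rshift 1 j by apply: val_inj; exact: ij.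
by rewrite /cons_rV (@row_mxEr _ 1 1 n).
Qed.


(* Lebesgue measure on R^n as an n-fold product: the coordinate prepended at each
   step carries the one-dimensional Lebesgue measure. *)
Fixpoint lebesgue_rV n : {measure set 'rV[R]_n -> \bar R} :=
  if n isn't m.+1 then \d_(0 : 'rV[R]_0)
  else measure_function_pushforward__canonical__measure_function_Measure
         (lebesgue_rV m \x (@lebesgue_measure R))%E (@measurable_cons_rV m).

End lebesgue_measure_rV.

Local Open Scope complex_scope.

Section sobolev.
Variables (R : realType) (d : nat).
Local Notation E := 'rV[R]_d.
Local Notation C := R[i].
Local Notation mu := (lebesgue_rV R d).
Local Notation normc := Normc.normc.
Implicit Types (Omega D : set E) (u v w f g : E -> C).

Definition Linfty Omega (f : E -> R) : Prop :=
  measurable_fun Omega f /\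
  exists M : R, {ae mu, forall x, Omega x -> `|f x| <= M}.

Definition cmeasurable D u : Prop :=
  measurable_fun D (fun x => complex.Re (u x)) /\
  measurable_fun D (fun x => complex.Im (u x)).

Definition cintegral D u : C :=
  (\int[mu]_(x in D) complex.Re (u x)) +i* (\int[mu]_(x in D) complex.Im (u x)).

(* Elements of L^2(D) are represented by functions on R^d of which only the
   values on D matter. *)
Definition L2 D u : Prop :=
  cmeasurable D u /\ (\int[mu]_(x in D) (normc (u x) ^+ 2)%:E < +oo)%E.

Definition L2norm D u : R :=
  Num.sqrt (\int[mu]_(x in D) (normc (u x) ^+ 2)).

Definition pderiv (i : 'I_d) (f : E -> R) : E -> R :=
  fun x => 'D_(delta_mx ord0 i) f x.

Definition smooth (f : E -> R) : Prop :=
  forall (s : seq 'I_d) (x : E), differentiable (foldr pderiv f s) x.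

Definition cpderiv (i : 'I_d) u : E -> C :=
  fun x => pderiv i (fun y => complex.Re (u y)) x +i*
           pderiv i (fun y => complex.Im (u y)) x.

(* C_c^oo(Omega) *)
Definition test_function Omega u : Prop :=
  [/\ smooth (fun x => complex.Re (u x)), smooth (fun x => complex.Im (u x)),
      compact (closure [set x | u x != 0]) &
      closure [set x | u x != 0] `<=` Omega].

Definition weak_gradient Omega u (G : 'I_d -> E -> C) : Prop :=
  forall (i : 'I_d) (psi : E -> C), test_function Omega psi ->
    cintegral Omega (fun x => u x * cpderiv i psi x) =
    - cintegral Omega (fun x => G i x * psi x).

(* u is in H^1(Omega), with weak gradient G *)
Definition H1 Omega u (G : 'I_d -> E -> C) : Prop :=
  [/\ L2 Omega u, forall i, L2 Omega (G i) & weak_gradient Omega u G].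

(* u is in H^1_0(Omega), the closure of C_c^oo(Omega) in H^1(Omega) *)
Definition H10 Omega u (G : 'I_d -> E -> C) : Prop :=
  H1 Omega u G /\
  forall eps : R, 0 < eps -> exists2 psi, test_function Omega psi &
    L2norm Omega (fun x => u x - psi x) ^+ 2 +
    \sum_(i < d) L2norm Omega (fun x => G i x - cpderiv i psi x) ^+ 2
    < eps ^+ 2.

(* An unbounded operator on L^2(Omega) is given by its graph, which relates
   representatives: T v f means that v is in Dom(T) and T v = f. *)
Definition operator := (E -> C) -> (E -> C) -> Prop.
Implicit Types (T : operator).

(* v |-> - div (A grad v) + V v with domain {v in H^1_0 : L v in L^2}, where
   L v is taken in the sense of distributions. *)
Definition elliptic_op Omega (A : E -> 'M[R]_d) (V : E -> R) : operator :=
  fun v f => exists G : 'I_d -> E -> C,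
    [/\ H10 Omega v G, L2 Omega f &
        forall psi, test_function Omega psi ->
          cintegral Omega (fun x =>
            (\sum_(i < d) \sum_(j < d) (A x i j)%:C * G j x * cpderiv i psi x)
            + (V x)%:C * v x * psi x) =
          cintegral Omega (fun x => f x * psi x)].

(* T + m, where m acts by multiplication *)
Definition add_mul Omega T (m : E -> C) : operator :=
  fun v f => exists2 g, T v g & forall x, Omega x -> f x = g x + m x * v x.

Definition resolvent_set Omega T : set C := [set z |
  let Tz := add_mul Omega T (cst (- z)) in
  (forall f, L2 Omega f -> exists v, Tz v f) /\
  (* injectivity of T - z and boundedness of its inverse *)
  exists M : R, forall v f, Tz v f -> L2norm Omega v <= M * L2norm Omega f].

Definition spectrum Omega T : set C := ~` resolvent_set Omega T.

Definition eigenspace Omega T (sigma : C) : set (E -> C) :=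
  [set v | T v (fun x => sigma * v x)].

Definition eigenpair Omega T (sigma : C) v : Prop :=
  eigenspace Omega T sigma v /\ ~ ae_eq mu Omega v (cst 0).

(* Finite sums of eigenvectors.  For an infinite Lambda the closure of this
   space gives the same distances. *)
Definition eigenspaces Omega T (Lambda : set C) : set (E -> C) :=
  [set v | exists (s : seq C) (w : C -> E -> C),
    (forall sigma, sigma \in s ->
       Lambda sigma /\ eigenspace Omega T sigma (w sigma)) /\
    v = fun x => \sum_(sigma <- s) w sigma x].

Definition delta Omega v D : R := L2norm (Omega `\` D) v / L2norm Omega v.

Definition tau Omega v D : R := L2norm D v / L2norm Omega v.

End sobolev.

(* The distance to the empty set is +oo. *)
Definition cdist (R : realType) (z : R[i]) (S : set R[i]) : \bar R :=
  ereal_inf [set (Normc.normc (z - w))%:E | w in S].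

(* Main.v *)
Require Import Defs.
From HB Require Import structures.
From mathcomp Require Import all_boot all_order all_algebra.
From mathcomp Require Import all_classical all_reals all_analysis.
From mathcomp Require Import measurable_realfun.
From mathcomp Require Import complex.
From mathcomp Require Import ring lra.

(** In the usual language the proof is this. Put a = Re mu. Since chi_D is a
    projection, the equation L_s phi = mu phi reads
      (L - a) phi = i (Im mu - s chi_D) phi.
    The product of (L - a) phi with phi is real, hence Im mu = s tau^2, and then
    the right-hand side has norm s delta tau |phi|. Moreover tau^2 + delta^2 = 1.
    As Spec(L + i s) lies on the line Im z = s, the first estimates are plane
    geometry once there is a point of Spec L within s delta tau of a.

    That point, and the last estimate, come from two lower bounds for a
    selfadjoint operator with compact resolvent:
      |(L - a) u| >= dist(a, Spec L) |u|,
      |(L - a) u| >= dist(a, Spec L minus Lambda) dist(u, E(Lambda)).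
    They are obtained without a spectral decomposition. For a compact symmetric
    map T, the quotient |x - al T x| / |T x| attains its infimum on an invariant
    closed subspace at a combination of eigenvectors (compact_eigen); with
    T = (L + 1)^-1, x = (L + 1) u and al = 1 + a this is the first bound, and on
    the orthogonal complement of E(Lambda) it is the second one (spectral_gap).

    The analytic part is the construction of T: the weak Dirichlet problem for
    L + 1 is solved in the closure of the test functions by orthogonal projection
    (weak_solution_ex), T is symmetric (resolvent_sym), and it is compact by an
    inequality of Rellich type on boxes, proved by induction on the dimension from
    the fundamental theorem of calculus (rellich_box, resolvent_compact). The
    equation L u = g is then equivalent to u = T (g + u) (ellipticP).

    Two choices of representation run through the text. Vectors are functions,
    not classes of functions, so inner products are only semi-definite and
    equalities hold up to vectors of norm zero. And as A and V are real, T is built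
    on real functions and acts componentwise on complex functions, which are
    treated as pairs. *)

Set Implicit Arguments.
Unset Strict Implicit.
Unset Printing Implicit Defensive.
Import Order.TTheory GRing.Theory Num.Theory.
Import numFieldNormedType.Exports.

Local Open Scope classical_set_scope.
Local Open Scope ring_scope.

(** * Semi-inner products and orthogonal projection *)

Section scalars.
Variable R : realType.
Implicit Types a b c : R.

(** The value at t = - b / c is a c - b^2 up to the factor c; when c = 0, a
    nonzero b would make the polynomial an unbounded affine function. The
    degenerate case occurs, as semi-inner products vanish on nonzero vectors. *)
Lemma disc_le0 a b c : 0 <= c -> (forall t, 0 <= a + 2 * b * t + c * t ^+ 2) ->
  b ^+ 2 <= a * c.
Proof.
move=> c0 h; have [c00|cN0] := eqVneq c 0; last first.
  have cp : 0 < c by rewrite lt_neqAle eq_sym cN0.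
  have := h (- b / c).
  have -> : a + 2 * b * (- b / c) + c * (- b / c) ^+ 2 = (a * c - b ^+ 2) / c.
    by field.
  by rewrite pmulr_lge0 ?invr_gt0// subr_ge0.
have [->|b0] := eqVneq b 0; first by rewrite c00 mulr0 expr0n.
have := h (- (a + 1) / (2 * b)); rewrite c00.
have -> : a + 2 * b * (- (a + 1) / (2 * b)) + 0 * (- (a + 1) / (2 * b)) ^+ 2 = -1.
  by field; rewrite b0.
by rewrite oppr_ge0 ler10.
Qed.

Lemma invSn_lt (e : R) : 0 < e -> exists N, forall n, (N <= n)%N -> n.+1%:R^-1 <= e.
Proof.
move=> e0; exists (Num.truncn e^-1) => n Nn.
rewrite -[leRHS]invrK lef_pV2 ?posrE ?invr_gt0//.
apply: le_trans (_ : (Num.truncn e^-1).+1%:R <= _); last by rewrite ler_nat ltnS.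
by rewrite ltW// truncnS_gt.
Qed.

End scalars.

(** Elements of L^2 are represented by functions, so that a vector of norm zero
    need not vanish. Instead of taking quotients, all statements are made modulo
    such null vectors: an equation x = y becomes B (x - y) (x - y) = 0. *)
Record semi_inner (R : realType) (V : lmodType R) := SemiInner {
  sip :> V -> V -> R ;
  sipC : forall x y, sip x y = sip y x ;
  sipDl : forall x y z, sip (x + y) z = sip x z + sip y z ;
  sipZl : forall a x z, sip (a *: x) z = a * sip x z ;
  sip_ge0 : forall x, 0 <= sip x x }.

Section semi_inner_theory.
Variables (R : realType) (V : lmodType R) (B : semi_inner V).
Implicit Types (x y z : V) (a b : R) (u v : nat -> V) (M : set V).

Lemma sipDr x y z : B z (x + y) = B z x + B z y.
Proof. by rewrite sipC sipDl !(sipC B z). Qed.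
Lemma sipZr a x z : B z (a *: x) = a * B z x.
Proof. by rewrite sipC sipZl (sipC B z). Qed.
Lemma sipNl x z : B (- x) z = - B x z.
Proof. by rewrite -scaleN1r sipZl mulN1r. Qed.
Lemma sipNr x z : B z (- x) = - B z x.
Proof. by rewrite sipC sipNl sipC. Qed.
Lemma sip0l z : B 0 z = 0.
Proof. by rewrite -(scale0r (0 : V)) sipZl mul0r. Qed.
Definition sipE := (sipDl, sipDr, sipNl, sipNr, sipZl, sipZr).

Lemma sip_CS x y : B x y ^+ 2 <= B x x * B y y.
Proof.
apply: disc_le0 (sip_ge0 B y) _ => t.
have := sip_ge0 B (x + t *: y).
by rewrite !sipE (sipC B y x); congr (_ <= _); ring.
Qed.

(** By Cauchy-Schwarz; hence null vectors may be neglected inside any product. *)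
Lemma sip_null x y : B x x = 0 -> B x y = 0.
Proof.
move=> x0; have := sip_CS x y; rewrite x0 mul0r => h.
by apply/eqP; rewrite -sqrf_eq0 eq_le h sqr_ge0.
Qed.

Lemma sip_normD x y : B (x + y) (x + y) <= 2 * B x x + 2 * B y y.
Proof.
have := sip_ge0 B (x - y); rewrite !sipE (sipC B y x); lra.
Qed.

Lemma sip_normB x y : B (x - y) (x - y) <= 2 * B x x + 2 * B y y.
Proof. by apply: le_trans (sip_normD _ _) _; rewrite !sipE; lra. Qed.

Lemma sip_opp x y : B (x - y) (x - y) = B (y - x) (y - x).
Proof. by rewrite !sipE; ring. Qed.

Definition cauchy_for u := forall e : R, 0 < e -> exists N, forall m n,
  (N <= m)%N -> (N <= n)%N -> B (u m - u n) (u m - u n) <= e.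
Definition cvg_for u l := forall e : R, 0 < e -> exists N, forall n,
  (N <= n)%N -> B (u n - l) (u n - l) <= e.
Definition complete_for := forall u, cauchy_for u -> exists l, cvg_for u l.
Definition adherent M x := forall e : R, 0 < e ->
  exists2 m, M m & B (x - m) (x - m) <= e.
Definition subspace M := [/\ M 0, forall x y, M x -> M y -> M (x + y) &
  forall a x, M x -> M (a *: x)].

Lemma subspaceB M x y : subspace M -> M x -> M y -> M (x - y).
Proof. by case=> _ MD MZ Mx My; apply: MD => //; rewrite -scaleN1r; apply: MZ. Qed.

Lemma cauchyD u v : cauchy_for u -> cauchy_for v ->
  cauchy_for (fun n => u n + v n).
Proof.
move=> hu hv e e0; have e4 : 0 < e / 4 by rewrite divr_gt0.
have [N hN] := hu _ e4; have [N' hN'] := hv _ e4.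
exists (maxn N N') => m n; rewrite !geq_max => /andP[m1 m2] /andP[n1 n2].
rewrite opprD addrACA; apply: le_trans (sip_normD _ _) _.
have := hN _ _ m1 n1; have := hN' _ _ m2 n2; lra.
Qed.

Lemma cauchyZ a u : cauchy_for u -> cauchy_for (fun n => a *: u n).
Proof.
move=> hu e e0; have e4 : 0 < e / (a ^+ 2 + 1) by rewrite divr_gt0// ltr_wpDl// sqr_ge0.
have [N hN] := hu _ e4; exists N => m n mN nN.
rewrite -scalerBr sipZl sipZr.
have := hN _ _ mN nN; set b := B _ _ => hb.
have a0 : 0 < a ^+ 2 + 1 by rewrite ltr_wpDl// sqr_ge0.
move: hb; rewrite ler_pdivlMr// => hb.
have : 0 <= b by exact: sip_ge0.
nra.
Qed.

Lemma sip_lim0 (x c : R) : (forall e, 0 < e -> x ^+ 2 <= c * e) -> x = 0 :> R.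
Proof.
move=> h; apply/eqP; rewrite -sqrf_eq0 eq_le sqr_ge0 andbT.
apply/ler_addgt0Pr => e e0; rewrite add0r.
have := h (e / (`|c| + 1)) (divr_gt0 e0 (ltr_wpDl _ _)).
rewrite normr_ge0 ltr01 => /(_ isT isT) /le_trans; apply.
rewrite mulrCA ler_piMr ?(ltW e0)// ler_pdivrMr ?ltr_wpDl//.
by have := ler_norm c; lra.
Qed.

Lemma le_lim (x y c : R) : (forall e, 0 < e -> x <= y + c * e) -> x <= y.
Proof.
move=> h; apply/ler_addgt0Pr => e e0.
have := h (e / (`|c| + 1)) (divr_gt0 e0 (ltr_wpDl _ _)).
rewrite normr_ge0 ltr01 => /(_ isT isT) /le_trans; apply.
rewrite lerD2l mulrCA ler_piMr ?(ltW e0)// ler_pdivrMr ?ltr_wpDl//.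
by have := ler_norm c; lra.
Qed.

(** A minimising sequence for the distance from x to M is Cauchy, because by key
    a near-minimiser is nearly orthogonal to M. The limit lies in the closure of
    M only, since M is not assumed closed. *)
Lemma projection M : complete_for -> subspace M -> forall x,
  exists p, adherent M p /\ forall m, M m -> B (x - p) m = 0.
Proof.
move=> cpl sM x; have [M0 MD MZ] := sM.
pose S := [set B (x - m) (x - m) | m in M].
have Slb : has_inf S.
  split; first by exists (B (x - 0) (x - 0)), 0.
  by exists 0 => _ [m _ <-]; exact: sip_ge0.
have key e m y : M m -> M y -> B (x - m) (x - m) <= inf S + e ->
    B (x - m) y ^+ 2 <= e * B y y.
  move=> Mm My hm; apply: disc_le0 (sip_ge0 B y) _ => t.
  have : inf S <= B (x - (m - t *: y)) (x - (m - t *: y)).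
    apply: ge_inf; first by case: Slb.
    by exists (m - t *: y) => //; apply: subspaceB => //; apply: MZ.
  have -> : x - (m - t *: y) = (x - m) + t *: y by rewrite opprB addrA addrAC.
  move: hm; move: (inf S) (x - m) => i w hm; rewrite sipDl !sipDr !sipZl !sipZr (sipC B y w).
  by move=> ia; lra.
have /choice[u hu] : forall n : nat, exists m, M m /\
    B (x - m) (x - m) <= inf S + n.+1%:R^-1.
  move=> n; have [|_ [m Mm <-] hm] := @inf_adherent R S n.+1%:R^-1 _ Slb.
    by rewrite invr_gt0.
  by exists m; split => //; exact: ltW.
have cu : cauchy_for u.
  move=> e e0; have [|N hN] := @invSn_lt R (e / 4); first by rewrite divr_gt0.
  exists N => m n Nm Nn.
  have [Mm hm] := hu m; have [Mn hn] := hu n.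
  have My : M (u m - u n) by exact: subspaceB.
  have := key _ _ _ Mm My hm; have := key _ _ _ Mn My hn.
  have := hN _ Nm; have := hN _ Nn.
  have -> : B (u m - u n) (u m - u n) =
      B (x - u n) (u m - u n) - B (x - u m) (u m - u n).
    by rewrite !sipE; ring.
  set p := B (x - u n) _; set q := B (x - u m) _.
  have : 0 <= p - q.
    by rewrite /p /q; have := sip_ge0 B (u m - u n); rewrite !sipE; lra.
  set em := m.+1%:R^-1; set en := n.+1%:R^-1.
  move=> pq hen hem hp hq.
  have h1 : (p - q) ^+ 2 <= 2 * p ^+ 2 + 2 * q ^+ 2.
    by have := sqr_ge0 (p + q); nra.
  have h2 : (p - q) ^+ 2 <= 2 * (en + em) * (p - q) by lra.
  have h3 : (p - q) ^+ 2 <= e * (p - q) by nra.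
  by move: h3; rewrite expr2; nra.
have [p hp] := cpl _ cu; exists p; split.
  move=> e e0; have [N hN] := hp _ e0; exists (u N); first by case: (hu N).
  by rewrite sip_opp; exact: hN.
move=> y My; apply: (@sip_lim0 _ (4 * B y y)) => e e0.
have [N hN] := hp _ e0; have [N' hN'] := invSn_lt e0.
set n := maxn N N'.
have h1 := hN n (leq_maxl _ _); have h2 := hN' n (leq_maxr _ _).
have [Mn hn] := hu n; have h3 := key _ _ _ Mn My hn.
have h4 := sip_CS (u n - p) y.
have -> : B (x - p) y = B (x - u n) y + B (u n - p) y by rewrite !sipE; ring.
have := sip_ge0 B y; move: h1 h2 h3 h4.
set a := B (x - u n) y; set b := B (u n - p) y; set c := B y y.
set d := n.+1%:R^-1; set f := B _ _ => h1 h2 h3 h4 c0.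
have h5 : a ^+ 2 <= e * c by nra.
have h6 : b ^+ 2 <= e * c by nra.
have := sqr_ge0 (a - b); nra.
Qed.

End semi_inner_theory.

(** * Compact symmetric maps and their eigenvectors *)

Section compact_symmetric.
Variables (R : realType) (V : lmodType R) (B : semi_inner V).
Variable T : V -> V.

Definition symmetric_map := forall x y, B (T x) y = B x (T y).
(** Compactness in the form in which Rellich's inequality delivers it: up to an
    arbitrarily small multiple of the norm of x, the norm of T x is controlled by
    finitely many linear functionals of x. *)
Definition compact_map := forall e : R, 0 < e ->
  exists (k : nat) (f : 'I_k -> V), forall x,
    B (T x) (T x) <= e * B x x + \sum_(i < k) B (f i) x ^+ 2.

Hypothesis Tsym : symmetric_map.
Implicit Types (x y z : V) (a b : R) (u v : nat -> V) (M : set V).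

Lemma symD x y z : B (T (x + y)) z = B (T x) z + B (T y) z.
Proof. by rewrite !Tsym !sipE. Qed.
Lemma symZ a x z : B (T (a *: x)) z = a * B (T x) z.
Proof. by rewrite !Tsym !sipE. Qed.
Lemma symDr x y z : B z (T (x + y)) = B z (T x) + B z (T y).
Proof. by rewrite -!Tsym !sipE. Qed.
Lemma symZr a x z : B z (T (a *: x)) = a * B z (T x).
Proof. by rewrite -!Tsym !sipE. Qed.
Lemma symN x z : B (T (- x)) z = - B (T x) z.
Proof. by rewrite !Tsym !sipE. Qed.
Lemma symNr x z : B z (T (- x)) = - B z (T x).
Proof. by rewrite -!Tsym !sipE. Qed.
Definition symE := (symD, symDr, symN, symNr, symZ, symZr, sipE B).

Lemma symB_norm x y : B (T x - T y) (T x - T y) = B (T (x - y)) (T (x - y)).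
Proof. by rewrite !symE. Qed.

Hypothesis Tcpt : compact_map.

(** Along an ultrafilter U finer than the cofinite filter, every bounded sequence
    B (f i) (u n) converges, so for each tolerance the vectors T (u n) are close to
    each other on a set of U. One ultrafilter serves all tolerances, which replaces
    a diagonal extraction; s picks an index in the first n such sets. *)
Lemma compact_extraction u (c : R) : (forall n, B (u n) (u n) <= c) ->
  exists s : nat -> nat, (forall n, (n <= s n)%N) /\
    cauchy_for B (fun n => T (u (s n))).
Proof.
move=> uc; have [U [UU sU]] := ultraFilterLemma eventually_filter.
have UF : ProperFilter U by case: UU.
have c0 : 0 <= c by apply: le_trans (uc 0%N); exact: sip_ge0.
have ucvg (a : nat -> R) (b : R) : (forall n, `|a n| <= b) ->
    exists l : R, a @ U --> l.
  move=> ab; have [|l [_ hl]] := @segment_compact R (- b) b (a @ U).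
    rewrite /fmap/=; apply: filterS filterT => n _ /=.
    by rewrite in_itv/= -ler_norml.
  exists l => W Wl; have [//|h] := in_ultra_setVsetC (a @^-1` W) UU.
  by have [r []] := hl (~` W) W h Wl.
have small (e : R) : 0 < e -> exists A, U A /\ forall m n, A m -> A n ->
    B (T (u m) - T (u n)) (T (u m) - T (u n)) <= e.
  move=> e0; pose e' := e / (8 * (c + 1)).
  have e'0 : 0 < e' by rewrite divr_gt0// mulr_gt0// ltr_wpDl.
  have [k [f hf]] := Tcpt e'0.
  have /choice[l hl] : forall i, exists l : R, (fun n => B (f i) (u n)) @ U --> l.
    move=> i; apply: (ucvg _ (1 + B (f i) (f i) * c)) => n.
    have h1 := sip_CS B (f i) (u n); have := sip_ge0 B (f i).
    set b := B (f i) (u n); set d := B (f i) (f i) => d0.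
    have h : b ^+ 2 <= d * c by apply: le_trans h1 _; rewrite ler_wpM2l.
    by rewrite ler_norml; apply/andP; split; nra.
  pose eta := Num.sqrt (e / (8 * k.+1%:R)).
  have etap : 0 < e / (8 * k.+1%:R) by rewrite divr_gt0// mulr_gt0.
  have eta0 : 0 < eta by rewrite sqrtr_gt0.
  exists [set n | forall i, `|l i - B (f i) (u n)| <= eta]; split.
    apply: filter_forall => i.
    have := hl i; move/cvgrPdist_le => /(_ _ eta0).
    exact.
  move=> m n /= hm hn; rewrite symB_norm; apply: le_trans (hf _) _.
  have h1 : e' * B (u m - u n) (u m - u n) <= e / 2.
    have := sip_normB B (u m) (u n); have := uc m; have := uc n.
    set p := B (u n) _; set q := B (u m) _; set r := B (u m - _) _ => pn qm rr.
    apply: le_trans (_ : e' * (4 * (c + 1)) <= _).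
      by rewrite ler_pM2l//; lra.
    have c1 : c + 1 != 0 by rewrite gt_eqF// ltr_wpDl.
    suff -> : e' * (4 * (c + 1)) = e / 2 by [].
    by rewrite /e'; field.
  have h2 : \sum_(i < k) B (f i) (u m - u n) ^+ 2 <= \sum_(i < k) (4 * eta ^+ 2).
    apply: ler_sum => i _; rewrite sipDr sipNr.
    have := hm i; have := hn i; rewrite !ler_norml => /andP[a1 a2] /andP[a3 a4].
    nra.
  move: h2; rewrite sumr_const card_ord -[_ *+ k]mulr_natl sqr_sqrtr ?(ltW etap)// => h2.
  have h3 : k%:R * (4 * (e / (8 * k.+1%:R))) <= e / 2.
    have k1 : k.+1%:R != 0 :> R by rewrite pnatr_eq0.
    have kk : k%:R <= k.+1%:R :> R by rewrite ler_nat.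
    have kp : 0 < k.+1%:R :> R by rewrite ltr0n.
    move: k1 kk kp; move: (k.+1%:R : R) (k%:R : R) => p q p0 qp pp.
    have -> : q * (4 * (e / (8 * p))) = (q / p) * (e / 2) by field.
    by rewrite ler_piMl ?divr_ge0 ?(ltW e0)// ler_pdivrMr// mul1r.
  by apply: le_trans (lerD h1 (le_trans h2 h3)) _; rewrite -splitr.
have /choice[A hA] : forall n : nat, exists A, U A /\ forall m p, A m -> A p ->
    B (T (u m) - T (u p)) (T (u m) - T (u p)) <= n.+1%:R^-1.
  by move=> n; apply: small; rewrite invr_gt0.
have /choice[s hs] : forall n : nat, exists m, (n <= m)%N /\
    forall j, (j <= n)%N -> A j m.
  move=> n; apply: (@filter_ex _ U) => //; apply: filterI.
    by apply: sU; exact: nbhs_infty_ge.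
  have : U [set m | forall j : 'I_n.+1, A j m].
    by apply: filter_forall => j; case: (hA j).
  by apply: filterS => m /= h j jn; exact: (h (Ordinal (jn : (j < n.+1)%N))).
exists s; split; first by move=> n; case: (hs n).
move=> e e0; have [N hN] := invSn_lt e0; exists N => m n Nm Nn.
apply: le_trans (hN N (leqnn _)).
have [_ h] := hA N; apply: h; [have [_] := hs m|have [_] := hs n]; exact.
Qed.

End compact_symmetric.

Section more_semi_inner.
Variables (R : realType) (V : lmodType R) (B : semi_inner V).
Implicit Types (x y z : V) (a b : R) (u v : nat -> V) (M : set V).

Lemma sip_nullP x : B x x = 0 <-> forall z, B x z = 0.
Proof. by split=> [x0 z|->//]; exact: sip_null. Qed.

Lemma sip_gt0 x : B x x <> 0 -> 0 < B x x.
Proof. by move=> /eqP x0; rewrite lt_neqAle eq_sym x0 sip_ge0. Qed.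

Lemma sip_le_half x y : 2 * B x y <= B x x + B y y.
Proof. have := sip_ge0 B (x - y); rewrite !sipE (sipC B y x); lra. Qed.

Lemma eq_null_sip x y z : B (x - y) (x - y) = 0 -> B x z = B y z.
Proof.
by move=> /sip_nullP/(_ z); rewrite !sipE => h; apply/eqP; rewrite -subr_eq0 h.
Qed.

Lemma eq_null_norm x y z : B (x - y) (x - y) = 0 ->
  B (z - x) (z - x) = B (z - y) (z - y).
Proof.
move=> h; have e w := eq_null_sip w h.
by rewrite !sipE !(sipC B z) !e !(sipC B _ x) !e !(sipC B y).
Qed.

Definition orth M := [set x | forall m, M m -> B x m = 0].

Lemma orth_subspace M : subspace (orth M).
Proof.
split=> [m _|x y hx hy m Mm|a x hx m Mm]; first exact: sip0l.
  by rewrite sipE hx// hy// addr0.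
by rewrite sipE hx// mulr0.
Qed.

Lemma orth_adherent M x p : orth M x -> adherent B M p -> B x p = 0.
Proof.
move=> Mx Mp; apply: (@sip_lim0 _ _ (B x x)) => e e0.
have [m Mm pm] := Mp _ e0.
have -> : B x p = B x (p - m) by rewrite !sipE (Mx _ Mm) subr0.
by apply: le_trans (sip_CS _ _ _) _; rewrite ler_wpM2l// sip_ge0.
Qed.

Lemma orth_closed M x : adherent B (orth M) x -> orth M x.
Proof.
by move=> hx m Mm; rewrite sipC; apply: (orth_adherent _ hx) => y My; rewrite sipC My.
Qed.

Lemma cvg_adherent M u l : (forall n, M (u n)) -> cvg_for B u l -> adherent B M l.
Proof.
by move=> Mu ul e /ul[N hN]; exists (u N) => //; rewrite sip_opp; exact: hN.
Qed.

(** The lower bound turns a sequence whose image is Cauchy into a Cauchy sequence,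
    so the range of S is closed; its orthogonal complement is null, so the range is
    everything. S is linear modulo null vectors only. *)
Lemma complete_range (S : V -> V) (c C : R) : complete_for B ->
  (forall x y z, B (S (x + y)) z = B (S x) z + B (S y) z) ->
  (forall a x z, B (S (a *: x)) z = a * B (S x) z) ->
  0 < c -> (forall x, c * B x x <= B (S x) (S x)) ->
  (forall x, B (S x) (S x) <= C * B x x) ->
  (forall w, (forall x, B (S x) w = 0) -> B w w = 0) ->
  forall f, exists x, B (f - S x) (f - S x) = 0.
Proof.
move=> cpl SD SZ c0 Slow Sup Strv f.
pose M := [set y | exists x, B (y - S x) (y - S x) = 0].
have SE x y z : B (S (x - y)) z = B (S x) z - B (S y) z.
  by rewrite SD -scaleN1r SZ mulN1r.
have SnB x y : B (S x - S y) (S x - S y) = B (S (x - y)) (S (x - y)).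
  rewrite SE !(sipC B _ (S (x - y))) !SE !sipE (sipC B (S y) (S x)); ring.
have sM : subspace M.
  split=> [|x y [x' hx] [y' hy]|a x [x' hx]].
  - exists 0; apply/sip_nullP => z; rewrite !sipE sip0l.
    by have := SZ 0 0 z; rewrite scale0r mul0r => ->; rewrite subr0.
  - exists (x' + y'); apply/sip_nullP => z; rewrite !sipE SD.
    rewrite -!(eq_null_sip _ hx) -!(eq_null_sip _ hy); ring.
  - exists (a *: x'); apply/sip_nullP => z; rewrite !sipE SZ.
    rewrite -!(eq_null_sip _ hx); ring.
have MS x : M (S x) by exists x; rewrite subrr sip0l.
have [p [Mp fp]] := projection cpl sM f.
have fp0 : B (f - p) (f - p) = 0 by apply: Strv => x; rewrite sipC; exact: fp.
have /choice[u hu] : forall n : nat, exists x,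
    B (p - S x) (p - S x) <= n.+1%:R^-1.
  move=> n; have [|m [x mx] pm] := Mp n.+1%:R^-1; first by rewrite invr_gt0.
  by exists x; rewrite -(eq_null_norm p mx).
have cu : cauchy_for B u.
  move=> e e0; have [|N hN] := @invSn_lt R (c * e / 4).
    by rewrite divr_gt0// mulr_gt0.
  exists N => m n Nm Nn; rewrite -(ler_pM2l c0).
  apply: le_trans (Slow _) _; rewrite -SnB.
  have -> : S (u m) - S (u n) = (p - S (u n)) - (p - S (u m)).
    by rewrite opprB [RHS]addrC addrA subrK.
  apply: le_trans (sip_normB _ _ _) _.
  have := hu m; have := hu n; have := hN _ Nm; have := hN _ Nn.
  move: (B _ _) (B _ _) (m.+1%:R^-1) (n.+1%:R^-1) => a b em en; lra.
have [x ux] := cpl _ cu; exists x.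
apply: (@sip_lim0 _ _ 0) => e e0; rewrite mul0r.
suff -> : B (f - S x) (f - S x) = 0 by rewrite expr0n.
have fx : B (f - S x) (f - S x) = B (p - S x) (p - S x).
  by rewrite (sip_opp B f) (eq_null_norm (S x) fp0) (sip_opp B (S x)).
apply/eqP; rewrite fx eq_le sip_ge0 andbT.
apply: (@le_lim _ _ _ (2 + 2 * `|C|)) => {}e {}e0; rewrite add0r.
have [N hN] := ux _ e0; have [N' hN'] := invSn_lt e0.
have h1 := hN (maxn N N') (leq_maxl _ _); have h2 := hN' (maxn N N') (leq_maxr _ _).
have h3 := le_trans (hu (maxn N N')) h2.
move: h1 h3; set y := u _ => h1 h3.
have := sip_normD B (p - S y) (S y - S x); rewrite addrA subrK SnB => h4.
apply: le_trans h4 _.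
have h5 := Sup (y - x).
have : C * B (y - x) (y - x) <= `|C| * e.
  apply: le_trans (_ : `|C| * B (y - x) (y - x) <= _).
    by rewrite ler_wpM2r ?sip_ge0// ler_norm.
  by rewrite ler_wpM2l.
lra.
Qed.

End more_semi_inner.

Section compact_symmetric_eigenvectors.
Variables (R : realType) (V : lmodType R) (B : semi_inner V).
Variable T : V -> V.
Hypothesis Tsym : symmetric_map B T.
Hypothesis Tcpt : compact_map B T.
Implicit Types (x y z : V) (a b : R) (u v : nat -> V) (M : set V).

Lemma compact_map_bounded : exists2 K : R, 0 < K & forall x, B (T x) (T x) <= K * B x x.
Proof.
have [k [f hf]] := Tcpt ltr01.
exists (1 + \sum_(i < k) B (f i) (f i)).
  by rewrite ltr_pwDl// sumr_ge0// => i _; exact: sip_ge0.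
move=> x; apply: le_trans (hf x) _; rewrite mulrDl lerD2l mulr_suml.
by apply: ler_sum => i _; exact: sip_CS.
Qed.

Hypothesis Bcpl : complete_for B.

(** Let k be the infimum over N of |x - al T x|^2 / |T x|^2. Then the quadratic form
    of Q = (1 - al T)^2 - k T^2 is nonnegative on N. A minimising sequence w with
    |T w| = 1 satisfies Q w -> 0; since 1 = Q + 2 al T - (al^2 - k) T^2 and T is
    compact, a subsequence converges to some l with Q l = 0. Finally Q is the product
    of 1 - (al - sqrt k) T and 1 - (al + sqrt k) T, so that either l or its image
    under the first factor is the required h, and (rho - al)^2 = k. *)
Lemma compact_eigen (N : set V) (al : R) g : subspace N ->
  (forall x, adherent B N x -> N x) -> (forall x, N x -> N (T x)) ->
  N g -> 0 < B (T g) (T g) ->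
  exists h rho, [/\ N h, 0 < B h h, B (h - rho *: T h) (h - rho *: T h) = 0 &
    (rho - al) ^+ 2 * B (T g) (T g) <= B (g - al *: T g) (g - al *: T g)].
Proof.
move=> sN clN TN Ng Tg0; have [N0 ND NZ] := sN.
have [K K0 hK] := compact_map_bounded.
pose S := [set B (x - al *: T x) (x - al *: T x) / B (T x) (T x) |
            x in [set x | N x /\ 0 < B (T x) (T x)]].
have Slb : has_inf S.
  split; first by exists (B (g - al *: T g) (g - al *: T g) / B (T g) (T g)), g.
  by exists 0 => _ [m _ <-]; rewrite divr_ge0 ?sip_ge0.
pose k := inf S.
have k0 : 0 <= k.
  by apply: lb_le_inf; [case: Slb|move=> _ [m _ <-]; rewrite divr_ge0 ?sip_ge0].
have kP x : N x -> k * B (T x) (T x) <= B (x - al *: T x) (x - al *: T x).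
  move=> Nx; have [->|/sip_gt0 x0] := pselect (B (T x) (T x) = 0).
    by rewrite mulr0 sip_ge0.
  by rewrite -ler_pdivlMr//; apply: ge_inf; [case: Slb|exists x].
(* The numerator minus k times the denominator, as a quadratic form. *)
pose Q x := x - (2 * al) *: T x + (al ^+ 2 - k) *: T (T x).
have QE x : B (Q x) x = B (x - al *: T x) (x - al *: T x) - k * B (T x) (T x).
  by rewrite /Q !(sipE, Tsym); ring.
have Qsym x y : B (Q x) y = B x (Q y) by rewrite /Q !(sipE, Tsym).
have Qge0 x : N x -> 0 <= B (Q x) x by move=> Nx; rewrite QE subr_ge0 kP.
have QN x : N x -> N (Q x).
  move=> Nx; apply: ND; last by apply: NZ; apply/TN/TN.
  by apply: subspaceB => //; apply: NZ; exact: TN.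
have QCS x y : N x -> N y -> B (Q x) y ^+ 2 <= B (Q x) x * B (Q y) y.
  move=> Nx Ny; apply: disc_le0 (Qge0 _ Ny) _ => t.
  have := Qge0 (x + t *: y) (ND _ _ Nx (NZ t _ Ny)).
  have <- : B (Q (x + t *: y)) (x + t *: y) =
      B (Q x) x + 2 * B (Q x) y * t + B (Q y) y * t ^+ 2.
    rewrite Qsym [B (x + _) _]sipDl [B (t *: y) _]sipZl -!Qsym.
    rewrite [B (Q x) (x + _)]sipDr [B (Q x) (t *: y)]sipZr.
    rewrite [B (Q y) (x + _)]sipDr [B (Q y) (t *: y)]sipZr (Qsym y x) (sipC B y).
    ring.
  exact.
have QB x y : B (Q x - Q y) (Q x - Q y) = B (Q (x - y)) (Q (x - y)).
  have e z : B (Q x - Q y) z = B (Q (x - y)) z by rewrite sipDl sipNl !Qsym !sipE.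
  by rewrite e sipC e.
have [C C0 hC] : exists2 C, 0 < C & forall x, B (Q x) (Q x) <= C * B x x.
  exists (4 + 16 * al ^+ 2 * K + 2 * (al ^+ 2 - k) ^+ 2 * K * K).
    have := mulr_ge0 (sqr_ge0 al) (ltW K0).
    have := mulr_ge0 (mulr_ge0 (sqr_ge0 (al ^+ 2 - k)) (ltW K0)) (ltW K0).
    lra.
  move=> x; apply: le_trans (sip_normD _ _ _) _.
  have := sip_normB B x ((2 * al) *: T x); have := hK x; have := hK (T x).
  rewrite [B (_ *: _) (_ *: _)]sipZl [B _ (_ *: _)]sipZr.
  rewrite [B ((al ^+ 2 - k) *: _) _]sipZl [B _ ((al ^+ 2 - k) *: _)]sipZr.
  move: (B (x - _) _) (B (T (T x)) _) (B (T x) _) (B x x) => p q r s h1 h2 h3.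
  have h4 : (al ^+ 2 - k) ^+ 2 * q <= (al ^+ 2 - k) ^+ 2 * (K * (K * s)).
    apply: ler_wpM2l; first exact: sqr_ge0.
    by apply: le_trans h1 _; rewrite ler_pM2l.
  have h5 := ler_wpM2l (sqr_ge0 al) h2.
  lra.
have Qsmall x : N x -> B (Q x) (Q x) <= (1 + C) * B (Q x) x.
  move=> Nx; have Cl : B (Q (Q x)) (Q x) <= (1 + C) * B (Q x) (Q x).
    have := sip_le_half B (Q (Q x)) (Q x); have := hC (Q x).
    have := sip_ge0 B (Q x); move: (B _ _) (B _ _) (B _ _) => p q r; nra.
  have := QCS x (Q x) Nx (QN _ Nx); have := Qge0 _ Nx.
  have [->|/sip_gt0] := pselect (B (Q x) (Q x) = 0).
    by move=> h _; rewrite mulr_ge0// addr_ge0// ltW.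
  move: (B (Q x) (Q x)) (B (Q x) x) (B (Q (Q x)) (Q x)) Cl => p q r rp p0 q0 pq.
  rewrite -(ler_pM2r p0) -expr2; apply: le_trans pq _.
  by rewrite (mulrC (1 + C)) -mulrA ler_wpM2l.
have /choice[u hu] : forall n : nat, exists x, [/\ N x, B (T x) (T x) = 1,
    B x x <= 2 * (k + 1) + 2 * al ^+ 2 & B (Q x) x <= n.+1%:R^-1].
  move=> n; have [|_ [x [Nx x0] <-]] := @inf_adherent R S n.+1%:R^-1 _ Slb.
    by rewrite invr_gt0.
  rewrite -/k ltr_pdivrMr// => hx.
  (* Rescale so that |T x| = 1. *)
  pose c := (Num.sqrt (B (T x) (T x)))^-1.
  have c2 : c ^+ 2 * B (T x) (T x) = 1.
    by rewrite exprVn sqr_sqrtr ?sip_ge0// mulVf// gt_eqF.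
  have Tc : B (T (c *: x)) (T (c *: x)) = 1.
    by rewrite -c2 !(symE Tsym); ring.
  have Nc : N (c *: x) by exact: NZ.
  have qc : B (c *: x - al *: T (c *: x)) (c *: x - al *: T (c *: x)) =
      c ^+ 2 * B (x - al *: T x) (x - al *: T x).
    by rewrite !(symE Tsym); ring.
  have hc : B (c *: x - al *: T (c *: x)) (c *: x - al *: T (c *: x)) <= k + n.+1%:R^-1.
    rewrite qc; apply: le_trans (ler_wpM2l (sqr_ge0 c) (ltW hx)) _.
    by rewrite mulrCA c2 mulr1.
  exists (c *: x); split => //.
    have := sip_normD B (c *: x - al *: T (c *: x)) (al *: T (c *: x)).
    rewrite subrK [B (al *: _) _]sipZl [B (T _) (al *: _)]sipZr Tc mulr1 => h.
    apply: le_trans h _; rewrite -expr2 lerD2r ler_pM2l//; apply: le_trans hc _.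
    by rewrite lerD2l invf_le1// ler1n.
  by rewrite QE Tc mulr1 lerBlDl.
have [s [sn cT]] := compact_extraction Tsym Tcpt (fun n => let: And4 _ _ h _ := hu n in h).
pose w n := u (s n).
have hw n : [/\ N (w n), B (T (w n)) (T (w n)) = 1 &
    B (Q (w n)) (Q (w n)) <= (1 + C) * n.+1%:R^-1].
  have [Nw Tw _ Qw] := hu (s n); split => //; apply: le_trans (Qsmall _ Nw) _.
  rewrite ler_pM2l ?addr_gt0//; apply: le_trans Qw _.
  by rewrite lef_pV2 ?posrE// ler_nat ltnS.
have cQ : cauchy_for B (fun n => Q (w n)).
  move=> e e0; have [|n0 hn0] := @invSn_lt R (e / (4 * (1 + C))).
    by rewrite divr_gt0// mulr_gt0// addr_gt0.
  exists n0 => m n mn0 nn0; apply: le_trans (sip_normB _ _ _) _.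
  have [_ _ h1] := hw m; have [_ _ h2] := hw n.
  have := hn0 _ mn0; have := hn0 _ nn0.
  rewrite !ler_pdivlMr ?mulr_gt0 ?addr_gt0//.
  move: h1 h2; move: (B _ _) (B _ _) (n.+1%:R^-1) (m.+1%:R^-1) => p q a b; lra.
have cTT : cauchy_for B (fun n => T (T (w n))).
  move=> e e0; have [n0 hn0] := cT _ (divr_gt0 e0 K0).
  exists n0 => m n mn0 nn0; rewrite (symB_norm Tsym); apply: le_trans (hK _) _.
  by have := hn0 _ _ mn0 nn0; rewrite ler_pdivlMr// mulrC.
have cw : cauchy_for B w.
  have -> : w = fun n => Q (w n) +
      ((2 * al) *: T (w n) + (- (al ^+ 2 - k)) *: T (T (w n))).
    by apply/funext => n; rewrite /Q scaleNr addrACA addrN addr0 subrK.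
  apply: cauchyD => //; apply: cauchyD; exact: cauchyZ.
have [l wl] := Bcpl cw.
have Nl : N l by apply: clN; apply: cvg_adherent wl => n; case: (hw n).
have Ql0 : B (Q l) (Q l) = 0.
  apply/eqP; rewrite eq_le sip_ge0 andbT.
  apply: (@le_lim _ _ _ (2 * (1 + C) + 2 * C)) => e e0; rewrite add0r.
  have [n0 hn0] := wl _ e0; have [n1 hn1] := invSn_lt e0.
  have h1 := hn0 (maxn n0 n1) (leq_maxl _ _).
  have h2 := hn1 (maxn n0 n1) (leq_maxr _ _).
  have [_ _ h3] := hw (maxn n0 n1); move: h1 h2 h3; set y := w _ => h1 h2 h3.
  have -> : Q l = Q y - (Q y - Q l) by rewrite opprB addrC subrK.
  apply: le_trans (sip_normB _ _ _) _; rewrite QB.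
  have h5 := hC (y - l).
  have h6 : (1 + C) * (maxn n0 n1).+1%:R^-1 <= (1 + C) * e by rewrite ler_pM2l// addr_gt0.
  have h7 : C * B (y - l) (y - l) <= C * e by rewrite ler_pM2l.
  have := le_trans h3 h6; have := le_trans h5 h7; clear.
  by move: (B _ _) (B _ _) => p q; lra.
have l0 : 0 < B l l.
  have e0 : 0 < (4 * K)^-1 by rewrite invr_gt0 mulr_gt0.
  have [n0 hn0] := wl _ e0; have [_ Tw _] := hw n0.
  have := hn0 _ (leqnn _); rewrite -[_^-1]div1r ler_pdivlMr ?mulr_gt0// => h1.
  have := sip_normB B (T (w n0)) (T (w n0) - T l).
  have := sip_normD B (T (w n0) - T l) (T l); rewrite subrK Tw (symB_norm Tsym).
  have := hK (w n0 - l); have := hK l.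
  move: h1; move: (B (w n0 - l) _) (B l l) (B (T l) (T l)) (B (T (w n0 - l)) _).
  move=> p q r t h1 h2 h3 h4 _; nra.
pose ka := Num.sqrt k.
have ka2 : ka ^+ 2 = k by rewrite sqr_sqrtr.
have kg := kP _ Ng.
have NT := TN _ Nl.
(* (1 - (al + ka) T) h1 = Q l = 0. *)
pose h1 := l - (al - ka) *: T l.
have [h10|/sip_gt0 h10] := pselect (B h1 h1 = 0).
  exists l, (al - ka); split => //.
  by rewrite (_ : al - ka - al = - ka) ?sqrrN ?ka2//; ring.
exists h1, (al + ka); split => //.
- by apply: subspaceB => //; apply: NZ.
- apply/sip_nullP => z; rewrite -[RHS](sip_null z Ql0) /h1 /Q !(symE Tsym).
  by rewrite -ka2; ring.
- by rewrite (_ : al + ka - al = ka) ?ka2//; ring.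
Qed.

(** Write g = p + g' with p in the closure of M and g' orthogonal to M. As T
    preserves the orthogonal complement of M, compact_eigen applied there bounds
    |g' - al T g'|^2 from below by r |T g'|^2: the minimal quotient is attained at an
    eigenvector orthogonal to M. The other part T p is approximated in M, whence the
    error e; the cross terms vanish. *)
Lemma spectral_gap (M : set V) (r al : R) : subspace M ->
  (forall m, M m -> exists2 m', M m' & B (T m - m') (T m - m') = 0) ->
  (forall h rho, orth B M h -> 0 < B h h ->
     B (h - rho *: T h) (h - rho *: T h) = 0 -> r <= (rho - al) ^+ 2) ->
  0 <= r ->
  forall g e, 0 < e -> exists2 m, M m &
    r * B (T g - m) (T g - m) <= B (g - al *: T g) (g - al *: T g) + e.
Proof.
move=> sM TM hM r0 g e e0; have [K K0 hK] := compact_map_bounded.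
have [p [Mp gp]] := projection Bcpl sM g.
pose g' := g - p; have Ng' : orth B M g' by exact: gp.
have TN x : orth B M x -> orth B M (T x).
  move=> Nx m Mm; have [m' Mm' mm'] := TM m Mm.
  by rewrite Tsym sipC (eq_null_sip _ mm') sipC Nx.
have h1 : r * B (T g') (T g') <= B (g' - al *: T g') (g' - al *: T g').
  have [->|/sip_gt0 x0] := pselect (B (T g') (T g') = 0).
    by rewrite mulr0 sip_ge0.
  have [h [rho [Nh h0 hr]]] := compact_eigen al (orth_subspace B M)
    (@orth_closed _ _ B M) TN Ng' x0.
  by apply: le_trans; rewrite ler_pM2r//; exact: (hM h).
have eta0 : 0 < e / (r * K + 1) by rewrite divr_gt0// ltr_wpDl// mulr_ge0// ltW.
have [m0 Mm0 pm0] := Mp _ eta0; have [m Mm m0m] := TM _ Mm0.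
exists m => //.
have oz x : orth B M x -> B x p = 0 by move=> /orth_adherent; apply.
have -> : B (T g - m) (T g - m) = B (T g') (T g') + B (T (p - m0)) (T (p - m0)).
  rewrite -(eq_null_norm _ m0m) (symB_norm Tsym).
  have -> : g - m0 = g' + (p - m0) by rewrite addrA subrK.
  have z1 : B (T g') (T (p - m0)) = 0.
    rewrite -Tsym sipDr sipNr oz ?(TN _ (TN _ Ng') _ Mm0) ?subr0//.
    exact: (TN _ (TN _ Ng')).
  move: z1; move: (p - m0) (g') => d f z1.
  by rewrite (symDr Tsym) !(symD Tsym) z1 (sipC B (T d)) z1 addr0 add0r.
have h2 : B (g - al *: T g) (g - al *: T g) =
    B (g' - al *: T g') (g' - al *: T g') + B (p - al *: T p) (p - al *: T p).
  have gE : g = g' + p by rewrite subrK.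
  have z1 : B g' p = 0 by exact: oz.
  have z2 : B (T g') p = 0 by apply: oz; exact: TN.
  have z3 : B (T g') (T p) = 0 by rewrite -Tsym; apply: oz; exact: (TN _ (TN _ Ng')).
  have z4 : B g' (T p) = 0 by rewrite -Tsym.
  rewrite gE; move: z1 z2 z3 z4; move: (g') => f z1 z2 z3 z4.
  rewrite !(symE Tsym) (sipC B p f) (sipC B p (T f)) (sipC B (T p) f) (sipC B (T p) (T f)).
  rewrite z1 z2 z3 z4; ring.
rewrite h2 mulrDr.
have h3 : r * B (T (p - m0)) (T (p - m0)) <= e.
  apply: le_trans (ler_wpM2l r0 (hK _)) _; rewrite mulrA.
  apply: le_trans (ler_wpM2l (mulr_ge0 r0 (ltW K0)) pm0) _.
  rewrite mulrCA ler_piMr ?(ltW e0)// ler_pdivrMr ?ltr_wpDl ?mulr_ge0 ?(ltW K0)//.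
  by rewrite mul1r lerDl.
have := sip_ge0 B (p - al *: T p); lra.
Qed.

End compact_symmetric_eigenvectors.

(** * Square-integrable functions *)

Section square_integrable.
Context d (T : measurableType d) (R : realType).
Variables (mu : {measure set T -> \bar R}) (O : set T) (mO : measurable O).
Implicit Types f g : T -> R.

Definition sqint f := measurable_fun O f /\
  mu.-integrable O (EFin \o (fun x => f x ^+ 2)).

Lemma integrable_le f g : measurable_fun O f ->
  (forall x, O x -> `|f x| <= g x) -> mu.-integrable O (EFin \o g) ->
  mu.-integrable O (EFin \o f).
Proof.
move=> mf fg ig; apply: le_integrable ig => //.
  exact/measurable_EFinP.
move=> x Ox /=; rewrite lee_fin; apply: le_trans (fg x Ox) (ler_norm _).
Qed.

Lemma sqintM f g : sqint f -> sqint g ->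
  mu.-integrable O (EFin \o (fun x => f x * g x)).
Proof.
move=> [mf f2] [mg g2]; apply: (@integrable_le _ (fun x => f x ^+ 2 + g x ^+ 2)).
- exact: measurable_funM.
- move=> x _; rewrite normrM -(real_normK (num_real (f x))) -(real_normK (num_real (g x))).
  by have := sqr_ge0 (`|f x| - `|g x|); have := normr_ge0 (f x); have := normr_ge0 (g x); nra.
- by have := integrableD mO f2 g2; apply: eq_integrable.
Qed.

Lemma sqint_le f g : measurable_fun O f ->
  (forall x, O x -> f x ^+ 2 <= g x) -> mu.-integrable O (EFin \o g) -> sqint f.
Proof.
move=> mf fg ig; split => //; apply: integrable_le ig; first exact: measurable_funX.
by move=> x Ox; rewrite ger0_norm ?sqr_ge0// fg.
Qed.

Lemma sqintD f g : sqint f -> sqint g -> sqint (f \+ g).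
Proof.
move=> [mf f2] [mg g2]; apply: (@sqint_le _ (fun x => 2 * f x ^+ 2 + 2 * g x ^+ 2)).
- exact: measurable_funD.
- by move=> x _ /=; have := sqr_ge0 (f x - g x); lra.
- have := integrableD mO (integrableZl mO 2 f2) (integrableZl mO 2 g2).
  exact: eq_integrable.
Qed.

Lemma sqintZ (a : R) f : sqint f -> sqint (fun x => a * f x).
Proof.
move=> [mf f2]; apply: (@sqint_le _ (fun x => a ^+ 2 * f x ^+ 2)).
- exact: measurable_funM.
- by move=> x _ /=; rewrite exprMn.
- by have := integrableZl mO (a ^+ 2) f2; exact: eq_integrable.
Qed.

(** The measurability of O is a parameter because the closure under addition, from
    which the module structure of sqfun is built, needs it. *)
Definition sq_pred of measurable O : {pred T -> R} := fun f => `[< sqint f >].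

Lemma sq_submod_closed : submod_closed (sq_pred mO).
Proof.
split; first by apply/asboolP; split; [exact: measurable_cst|];
  apply: eq_integrable (integrable0 _ _) => //= x _; rewrite expr0n.
move=> a f g /asboolP sf /asboolP sg; apply/asboolP.
exact: (sqintD (sqintZ a sf) sg).
Qed.

HB.instance Definition _ := GRing.isSubmodClosed.Build R (T -> R)
  (sq_pred mO) sq_submod_closed.

Record sqfun := SqFun { sqfun_val :> T -> R ; _ : sqfun_val \in sq_pred mO }.
HB.instance Definition _ := [isSub for sqfun_val].
HB.instance Definition _ := gen_eqMixin sqfun.
HB.instance Definition _ := gen_choiceMixin sqfun.
HB.instance Definition _ := [SubChoice_isSubLmodule of sqfun by <:].

End square_integrable.

Section sqfun_theory.
Context d (T : measurableType d) (R : realType).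
Variables (mu : {measure set T -> \bar R}) (O : set T) (mO : measurable O).
Local Notation W := (sqfun mu mO).
Implicit Types f g h : W.

Lemma sqfunP f : sqint mu O f.
Proof. by case: f => f /= /asboolP. Qed.

Definition mk_sqfun (f : T -> R) (sf : sqint mu O f) : W := SqFun (introT (asboolP _) sf : f \in sq_pred mu mO).

Lemma sqfunDE (f g : W) x : (f + g) x = f x + g x.
Proof. by []. Qed.
Lemma sqfunBE (f g : W) x : (f - g) x = f x - g x.
Proof. by []. Qed.
Lemma sqfunZE (a : R) (f : W) x : (a *: f) x = a * f x.
Proof. by []. Qed.

Definition sq_ip (f g : W) : R := \int[mu]_(x in O) (f x * g x).

Lemma sq_ipC f g : sq_ip f g = sq_ip g f.
Proof. by apply: eq_Rintegral => x _; rewrite mulrC. Qed.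
Lemma sq_ipDl f g h : sq_ip (f + g) h = sq_ip f h + sq_ip g h.
Proof.
rewrite /sq_ip -RintegralD//; last 2 first.
- exact: (sqintM mO (sqfunP f) (sqfunP h)).
- exact: (sqintM mO (sqfunP g) (sqfunP h)).
by apply: eq_Rintegral => x _; rewrite -mulrDl.
Qed.
Lemma sq_ipZl a f h : sq_ip (a *: f) h = a * sq_ip f h.
Proof.
rewrite /sq_ip -RintegralZl//; last exact: (sqintM mO (sqfunP f) (sqfunP h)).
by apply: eq_Rintegral => x _; rewrite mulrA.
Qed.
Lemma sq_ip_ge0 f : 0 <= sq_ip f f.
Proof. by apply: Rintegral_ge0 => x _; rewrite -expr2 sqr_ge0. Qed.

Definition sq_inner : semi_inner W := SemiInner sq_ipC sq_ipDl sq_ipZl sq_ip_ge0.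

Lemma sq_ip_fin (f g : W) : (\int[mu]_(x in O) (f x * g x)%:E)%E = (sq_ip f g)%:E.
Proof.
rewrite /sq_ip /Rintegral fineK//.
exact: (integrable_fin_num mO (sqintM mO (sqfunP f) (sqfunP g))).
Qed.

Lemma sq_normE (f : W) : (\int[mu]_(x in O) ((f x) ^+ 2)%:E)%E = (sq_ip f f)%:E.
Proof. by rewrite -sq_ip_fin; under eq_integral do rewrite expr2. Qed.

Lemma sq_null_ae (f : W) : sq_ip f f = 0 -> ae_eq mu O f (cst 0).
Proof.
move=> f0; have [mf f2] := sqfunP f.
have : ae_eq mu O (EFin \o (fun x => f x ^+ 2)) (cst 0%E).
  apply/(ae_eq_integral_abs mu mO); first by apply/measurable_EFinP/measurable_funX.
  under eq_integral do rewrite /= ger0_norm ?sqr_ge0//.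
  by rewrite sq_normE f0.
by apply: filterS => x h Ox; have [/eqP] := h Ox; rewrite sqrf_eq0 => /eqP.
Qed.

(** The Riesz-Fischer theorem. Let a k be the increments of a subsequence, with
    squared norms at most 4^-k. The sum of the 2^k (a k)^2 is integrable, hence a.e.
    finite, and |a k| <= 2^-k + 2^k (a k)^2 makes the subsequence converge a.e. The
    limit l is defined as an upper limit so as to be measurable everywhere, and
    Fatou's lemma bounds the distance from l to the sequence. *)
Lemma sq_complete : complete_for sq_inner.
Proof.
move=> u cu.
have /choice[N hN] : forall k : nat, exists N, forall m n, (N <= m)%N -> (N <= n)%N ->
    sq_ip (u m - u n) (u m - u n) <= (4 ^+ k)^-1.
  by move=> k; apply: cu; rewrite invr_gt0 exprn_gt0.
pose s k := (\max_(j < k.+1) N j)%N.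
have sN j k : (j <= k)%N -> (N j <= s k)%N.
  by move=> jk; exact: (@leq_bigmax 'I_k.+1 (fun j => N j) (Ordinal (jk : (j < k.+1)%N))).
pose a k := u (s k.+1) - u (s k).
pose G x := (\sum_(0 <= k <oo) (2 ^+ k * a k x ^+ 2)%:E)%E.
have G0 k x : O x -> (0 <= (2 ^+ k * a k x ^+ 2)%:E)%E.
  by move=> _; rewrite lee_fin; apply: mulr_ge0; [exact: exprn_ge0|exact: sqr_ge0].
have mG k : measurable_fun O (fun x => (2 ^+ k * a k x ^+ 2)%:E).
  apply/measurable_EFinP/measurable_funM => //.
  by apply: measurable_funX; case: (sqfunP (a k)).
have intG : (\int[mu]_(x in O) G x < +oo)%E.
  rewrite /G integral_nneseries//.
  apply: (@le_lt_trans _ _ (\sum_(0 <= k <oo) (2 / (2 ^ k.+1)%:R)%:E)%E); last first.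
    have := @epsilon_trick R (fun _ => 0%E) 2 xpredT (fun _ => lexx _) (ler0n _ _).
    rewrite [X in (_ <= X + _)%E]eseries0// add0e => h; apply: le_lt_trans (ltry 2); apply: le_trans h.
    by apply: lee_nneseries => [k _|k _]; rewrite ?add0e// lee_fin divr_ge0.
  apply: lee_nneseries.
    by move=> k _ _; apply: integral_ge0 => x /G0.
  move=> k _.
  under eq_integral do rewrite EFinM.
  rewrite ge0_integralZl_EFin//; last 2 first.
  - by move=> x _; rewrite lee_fin sqr_ge0.
  - by apply/measurable_EFinP/measurable_funX; case: (sqfunP (a k)).
  rewrite sq_normE -EFinM lee_fin.
  have := hN k (s k.+1) (s k) (sN _ _ (leqnSn _)) (sN _ _ (leqnn _)).
  rewrite -/(a k) => h; apply: le_trans (ler_wpM2l (exprn_ge0 k (ler0n R 2)) h) _.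
  rewrite (_ : 4 = 2 * 2); last by ring.
  rewrite exprMn invfM mulrA divff ?expf_neq0// mul1r natrX exprS invfM mulrA.
  by rewrite divff// mul1r.
have aeG : {ae mu, forall x, O x -> exists c : R, (fun k => u (s k) x) @ \oo --> c}.
  have iG : mu.-integrable O G.
    apply/integrableP; split; first by apply: ge0_emeasurable_sum => // k x Ox _; exact: G0.
    have Gge0 x : O x -> (0 <= G x)%E.
      by move=> Ox; apply: nneseries_ge0 => k _ _; exact: G0.
    by under eq_integral => x xO do rewrite (gee0_abs (Gge0 _ (set_mem xO))).
  apply: (filterS _ (integrable_ae mO iG)) => x /= h Ox; have {h} := h Ox => Gx.
  have b0 k : 0 <= 2 ^+ k * a k x ^+ 2.
    by apply: mulr_ge0; [exact: exprn_ge0|exact: sqr_ge0].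
  have cb : cvgn (series (fun k => 2 ^+ k * a k x ^+ 2)).
    apply: nondecreasing_is_cvgn.
      by apply: nondecreasing_series => k _ _; exact: b0.
    exists (fine (G x)) => _ [n _ <-].
    rewrite -lee_fin fineK// /series/= -sumEFin.
    by apply: nneseries_lim_ge => k _; rewrite lee_fin.
  have cg : cvgn (series (geometric (1 : R) (2^-1))).
    by apply: is_cvg_geometric_series; rewrite ger0_norm ?invr_ge0// invf_lt1// ltr1n.
  have ca : cvgn (series (fun k => a k x)).
    apply: normed_cvg.
    apply: (@series_le_cvg _ _ (fun k => geometric 1 2^-1 k + 2 ^+ k * a k x ^+ 2)).
    - by move=> n; exact: normr_ge0.
    - by move=> n; rewrite addr_ge0// /geometric/= mul1r exprn_ge0// invr_ge0.
    - move=> n /=; rewrite mul1r exprVn.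
      have p2 : 0 < 2 ^+ n :> R by exact: exprn_gt0.
      rewrite -(real_normK (num_real (a n x))).
      have := normr_ge0 (a n x); move: `|a n x| (2 ^+ n) p2 => y p p0 y0.
      rewrite -(ler_pM2l p0) mulrDr divff ?gt_eqF//.
      by have := sqr_ge0 (p * y - 1); nra.
    - rewrite (_ : (fun _ => _) = geometric 1 2^-1 \+ (fun k => 2 ^+ k * a k x ^+ 2))//.
      exact: is_cvg_seriesD.
  exists (u (s 0%N) x + limn (series (fun k => a k x))).
  have -> : (fun k => u (s k) x) = (fun k => u (s 0%N) x + series (fun k => a k x) k).
    by apply/funext => k; rewrite {1}(eq_sum_telescope (fun k => u (s k) x) k).
  by apply: cvgD => //; exact: cvg_cst.
pose l x := fine (limn_esup (fun k => (u (s k) x)%:E)).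
have lP x (c : R) : (fun k => u (s k) x) @ \oo --> c -> l x = c.
  move=> h; rewrite /l is_cvg_limn_esupE; last by apply/cvg_ex; exists c%:E; apply/cvg_EFin => //; exact: nearW.
  by have /cvg_lim -> // : (fun k => (u (s k) x)%:E) @ \oo --> c%:E by apply/cvg_EFin => //; exact: nearW.
have ml : measurable_fun O l.
  apply: measurableT_comp; first exact: fine_measurable.
  apply: measurable_fun_limn_esup => k; apply/measurable_EFinP.
  by case: (sqfunP (u (s k))).
have key k m : (N k <= m)%N ->
    (\int[mu]_(x in O) ((u m x - l x) ^+ 2)%:E <= ((4 ^+ k)^-1)%:E)%E.
  move=> Nm.
  have mm n : measurable_fun O (fun x => ((u m x - u (s n) x) ^+ 2)%:E).
    apply/measurable_EFinP/measurable_funX/measurable_funB; first by case: (sqfunP (u m)).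
    by case: (sqfunP (u (s n))).
  have -> : (\int[mu]_(x in O) ((u m x - l x) ^+ 2)%:E =
      \int[mu]_(x in O) limn_einf (fun n => ((u m x - u (s n) x) ^+ 2)%:E))%E.
    apply: ge0_ae_eq_integral => //.
    - by apply/measurable_EFinP/measurable_funX/measurable_funB; first by case: (sqfunP (u m)).
    - apply: measurableT_comp => //; apply: measurable_fun_limn_esup => n.
      by apply: measurableT_comp => //; exact: mm.
    - by move=> x _; rewrite lee_fin sqr_ge0.
    - move=> x _; rewrite limn_einf_lim; apply: lime_ge; first exact: is_cvg_einfs.
      by apply: nearW => n; apply: le_ereal_inf_tmp => _ [j _ <-]; rewrite lee_fin sqr_ge0.
    apply: (filterS _ aeG) => x /= h Ox; have {h} [c hc] := h Ox; rewrite (lP _ _ hc).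
    have h : (fun n => ((u m x - u (s n) x) ^+ 2)%:E) @ \oo --> ((u m x - c) ^+ 2)%:E.
      apply/cvg_EFin; first exact: nearW.
      rewrite /comp/= expr2; under eq_fun do rewrite expr2.
      by apply: cvgM; (apply: cvgB; [exact: cvg_cst|exact: hc]).
    by rewrite is_cvg_limn_einfE; [rewrite (cvg_lim _ h)|apply/cvg_ex; exists ((u m x - c) ^+ 2)%:E].
  apply: le_trans (fatou mu mO mm _) _.
    by move=> n x _; rewrite lee_fin sqr_ge0.
  rewrite limn_einf_lim; apply: lime_le; first exact: is_cvg_einfs.
  exists k => // n /= kn.
  apply: (@le_trans _ _ (\int[mu]_(x in O) ((u m x - u (s n) x) ^+ 2)%:E)%E).
    by apply: ereal_inf_lbound; exists n => /=.
  by rewrite (sq_normE (u m - u (s n))) lee_fin; apply: hN => //; exact: sN.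
have Wl k m : (N k <= m)%N -> sqint mu O (fun x => u m x - l x).
  move=> Nm; split.
    by apply: measurable_funB => //; case: (sqfunP (u m)).
  apply/integrableP; split.
    apply/measurable_EFinP/measurable_funX/measurable_funB => //.
    by case: (sqfunP (u m)).
  under eq_integral do rewrite /= ger0_norm ?sqr_ge0//.
  by apply: le_lt_trans (key _ _ Nm) _; exact: ltry.
have sl : sqint mu O l.
  have := Wl 0%N (N 0%N) (leqnn _) => h.
  have := sqfunP (u (N 0%N) - mk_sqfun h).
  by congr (sqint _ _ _); apply/funext => x; rewrite sqfunBE/= opprB addrC subrK.
exists (mk_sqfun sl) => e e0.
have [k hk] : exists k, (4 ^+ k)^-1 <= e.
  have [k hk] := invSn_lt e0; exists k; apply: le_trans (hk k (leqnn _)).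
  rewrite lef_pV2 ?posrE ?exprn_gt0// -natrX ler_nat.
  by apply: leq_trans (ltn_expl k (isT : (1 < 4)%N)) _.
exists (N k) => m Nm; apply: le_trans hk; rewrite -lee_fin -[sq_inner _ _]/(sq_ip _ _).
by rewrite -sq_normE; exact: key.
Qed.

End sqfun_theory.

(** * Lebesgue measure on row vectors *)

Section rV_measurable.
Variables (R : realType).

Lemma rV_ballE n (x y : 'rV[R]_n) (e : R) : 0 < e ->
  ball x e y <-> forall i, `|x ord0 i - y ord0 i| < e.
Proof.
move=> e0; split.
  by move=> [_ h] i; have := h ord0 i.
by move=> h; split => // i j; rewrite (ord1 i); exact: h.
Qed.

(** The sigma-algebra is generated by the coordinates, so an open set has to be
    exhibited as a countable union of cubes with rational centres. *)
Lemma open_rV_measurable n (U : set 'rV[R]_n) : open U -> measurable U.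
Proof.
move=> oU.
pose F (p : 'rV[rat]_n * nat) : set 'rV[R]_n :=
  [set y | forall i, `|ratr (p.1 ord0 i) - y ord0 i| < p.2.+1%:R^-1].
have mF p : measurable (F p).
  rewrite (_ : F p = \bigcap_(i in [set: 'I_n])
      ((fun y : 'rV[R]_n => y ord0 i) @^-1`
        [set t | `|ratr (p.1 ord0 i) - t| < p.2.+1%:R^-1])); last first.
    by apply/seteqP; split => y /= h i => [_|]; exact: h.
  apply: fin_bigcap_measurable; first exact: finite_finset.
  move=> i _; rewrite -[X in measurable X]setTI.
  apply: measurable_rV_coord => //.
  rewrite (_ : mkset _ = ball (ratr (p.1 ord0 i) : R) p.2.+1%:R^-1)//.
  exact: measurable_ball.
rewrite (_ : U = \bigcup_(p in [set: 'rV[rat]_n * nat])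
   (if pselect (F p `<=` U) then F p else set0)); last first.
  apply/seteqP; split => [x Ux|x [p _]]; last by case: pselect => //; apply.
  have [e /= e0 he] := (nbhs_ballP x U).1 (open_nbhs_nbhs (conj oU Ux)).
  have [k hk] : exists k, k.+1%:R^-1 <= e / 2.
    have [N hN] := @invSn_lt R (e / 2) (divr_gt0 e0 (ltr0n R 2)).
    by exists N; exact: hN.
  have k0 : 0 < k.+1%:R^-1 :> R by rewrite invr_gt0.
  have /choice[q hq] : forall i, exists q : rat, `|ratr q - x ord0 i| < k.+1%:R^-1.
    move=> i; have := @rat_in_itvoo R (x ord0 i - k.+1%:R^-1) (x ord0 i + k.+1%:R^-1).
    rewrite ltrBlDr -addrA ltrDl addr_gt0// => /(_ isT)[q].
    by rewrite in_itv/= -ltr_distl => h; exists q.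
  exists (\row_i q i, k) => //.
  case: pselect => [|[]] /=; first by move=> _ i /=; rewrite mxE.
  move=> y /= hy; apply: he; apply/rV_ballE => // i.
  have := hy i; rewrite mxE => hyi.
  rewrite -(subrK (ratr (q i)) (x ord0 i)) -addrA.
  apply: le_lt_trans (ler_normD _ _) _; rewrite distrC.
  apply: lt_le_trans (ltrD (hq i) hyi) _.
  by apply: le_trans (lerD hk hk) _; rewrite -splitr.
apply: countable_bigcupT_measurable => // p.
by case: (pselect (F p `<=` U)) => h; [exact: mF|exact: measurable0].
Qed.

Lemma continuous_rV_measurable n (f : 'rV[R]_n -> R) : continuous f ->
  measurable_fun setT f.
Proof.
move=> cf; apply: (measurability _ (RGenOpens.measurableE R)).
move=> _ [B [a [b ->]] <-]; rewrite setTI; apply: open_rV_measurable.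
by apply: open_comp => // x _; exact: cf.
Qed.

Lemma rV_measurable_fun d (T : measurableType d) n (g : T -> 'rV[R]_n) :
  (forall i, measurable_fun setT (fun x => g x ord0 i)) -> measurable_fun setT g.
Proof.
move=> mg; apply: measurability; first by [].
rewrite -bigcup_seq => _ [B [i _ [C mC <-]] <-]; rewrite !setTI.
by rewrite -comp_preimage -[X in measurable X]setTI; exact: mg.
Qed.

Definition tail_rV n (x : 'rV[R]_n.+1) : 'rV[R]_n := \row_j x ord0 (lift ord0 j).

Lemma cons_rV0 n (p : 'rV[R]_n * R) : cons_rV p ord0 ord0 = p.2.
Proof.
rewrite /cons_rV; have -> : (ord0 : 'I_n.+1) = lshift n (ord0 : 'I_1) by exact: val_inj.
by rewrite (@row_mxEl _ 1 1 n) mxE eqxx.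
Qed.

Lemma cons_rVS n (p : 'rV[R]_n * R) j : cons_rV p ord0 (lift ord0 j) = p.1 ord0 j.
Proof.
rewrite /cons_rV; have -> : (lift ord0 j : 'I_n.+1) = rshift 1 j by exact: val_inj.
by rewrite (@row_mxEr _ 1 1 n).
Qed.

Lemma tail_cons n (p : 'rV[R]_n * R) : tail_rV (cons_rV p) = p.1.
Proof. by apply/rowP => j; rewrite mxE cons_rVS. Qed.

Definition cyl n (Q : set 'rV[R]_n) (I : set R) : set 'rV[R]_n.+1 :=
  [set x | Q (tail_rV x) /\ I (x ord0 ord0)].

Lemma cylE n (Q : set 'rV[R]_n) (I : set R) : @cons_rV R n @^-1` (cyl Q I) = Q `*` I.
Proof. by apply/seteqP; split => p /=; rewrite /cyl/= tail_cons cons_rV0. Qed.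

Lemma measurable_cyl n (Q : set 'rV[R]_n) (I : set R) :
  measurable Q -> measurable I -> measurable (cyl Q I).
Proof.
move=> mQ mI; rewrite (_ : cyl Q I = (@tail_rV n @^-1` Q) `&`
   ((fun x : 'rV[R]_n.+1 => x ord0 ord0) @^-1` I))//.
apply: measurableI.
  rewrite -[X in measurable X]setTI.
  apply: rV_measurable_fun mQ => // i.
  rewrite (_ : (fun x => _) = (fun x : 'rV[R]_n.+1 => x ord0 (lift ord0 i))).
    exact: measurable_rV_coord.
  by apply/funext => x; rewrite mxE.
by rewrite -[X in measurable X]setTI; exact: measurable_rV_coord.
Qed.

Lemma lebesgue_cyl n (Q : set 'rV[R]_n) (I : set R) :
  measurable Q -> measurable I ->
  lebesgue_rV R n.+1 (cyl Q I) = (lebesgue_rV R n Q * lebesgue_measure I)%E.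
Proof.
move=> mQ mI; rewrite /= /pushforward cylE; exact: product_measure1E.
Qed.

(** Half-open, so that the slabs of a box tile it exactly. *)
Definition box n (M : R) : set 'rV[R]_n := [set x | forall i, -M <= x ord0 i < M].

Lemma boxS n M : @box n.+1 M = cyl (@box n M) `[- M, M[.
Proof.
apply/seteqP; split => x; rewrite /box/cyl/= in_itv/=.
  by move=> h; split => // i; rewrite mxE.
by move=> [h h0] i; case: (unliftP ord0 i) => [j ->|->//]; have := h j; rewrite mxE.
Qed.

Lemma measurable_box n M : measurable (@box n M).
Proof.
elim: n => [|n IH]; last by rewrite boxS; exact: measurable_cyl.
by rewrite (_ : box M = setT)//; apply/seteqP; split => // x _ [].
Qed.

Lemma box_fin n M : (lebesgue_rV R n (@box n M) < +oo)%E.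
Proof.
elim: n => [|n IH].
  rewrite /= diracE; exact: ltry.
rewrite boxS lebesgue_cyl//; last exact: measurable_box.
rewrite lte_mul_pinfty// ?fin_num_abs; last first.
  by rewrite lebesgue_measure_itv/=; case: ifP => _; rewrite -?EFinB ltry.
by rewrite gee0_abs.
Qed.

Lemma rV_sigma_finite n : sigma_finite setT (lebesgue_rV R n).
Proof.
exists (fun k => @box n k%:R); last by move=> k; split; [exact: measurable_box|exact: box_fin].
apply/seteqP; split => // x _.
pose s := \sum_(i < n) `|x ord0 i|.
exists (Num.truncn s).+1 => //= i.
have : `|x ord0 i| < (Num.truncn s).+1%:R.
  apply: le_lt_trans (_ : s < _); last exact: truncnS_gt.
  by rewrite /s (bigD1 i)//= lerDl sumr_ge0.
by rewrite ltr_norml => /andP[/ltW -> ->].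
Qed.

(** The form in which Fubini's theorem takes its measures. *)
Lemma rV_sigma_finite_measure n :
  exists m : {sigma_finite_measure set 'rV[R]_n -> \bar R},
  lebesgue_rV R n = (m : {measure set 'rV[R]_n -> \bar R}).
Proof.
pose H1 := isSFinite.Build _ _ _ _ (sfinite_measure_sigma_finite (rV_sigma_finite n)).
pose H2 := isSigmaFinite.Build _ _ _ _ (rV_sigma_finite n).
pose m := HB.pack_for {sigma_finite_measure set 'rV[R]_n -> \bar R}
  (Measure.sort (lebesgue_rV R n)) H1 H2.
by exists m; exact: eq_measure.
Qed.

Lemma lebesgue_rVS n : lebesgue_rV R n.+1 =
  measure_function_pushforward__canonical__measure_function_Measure
    (lebesgue_rV R n \x (@lebesgue_measure R))%E (@measurable_cons_rV R n).
Proof. by []. Qed.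

End rV_measurable.

Lemma bounded_integrable d (T : measurableType d) (R : realType)
    (mu : {measure set T -> \bar R}) (D : set T) (f : T -> R) (K : R) :
  measurable D -> (mu D < +oo)%E -> measurable_fun D f ->
  (forall x, D x -> `|f x| <= K) -> mu.-integrable D (EFin \o f).
Proof.
move=> mD muD mf fK; apply: measurable_bounded_integrable => //.
exists K; split; first exact: num_real.
by move=> y Ky x Dx; apply: le_trans (fK x Dx) (ltW Ky).
Qed.

Section fubini_real.
Variables (R : realType) (n : nat) (Q : set 'rV[R]_n) (I : set R).
Hypotheses (mQ : measurable Q) (mI : measurable I).
Hypotheses (Qfin : (lebesgue_rV R n Q < +oo)%E) (Ifin : (lebesgue_measure I < +oo)%E).
Variables (f : 'rV[R]_n.+1 -> R) (K : R).
Hypotheses (mf : measurable_fun setT f) (fK : forall x, cyl Q I x -> `|f x| <= K).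

Lemma cyl_fin : (lebesgue_rV R n.+1 (cyl Q I) < +oo)%E.
Proof.
by rewrite lebesgue_cyl// lte_mul_pinfty// ge0_fin_numE.
Qed.

Lemma cons_cyl y t : Q y -> I t -> cyl Q I (cons_rV (y, t)).
Proof. by move=> Qy It; rewrite /cyl/= tail_cons cons_rV0. Qed.

Lemma measurable_cons1 (t : R) : measurable_fun setT (fun y : 'rV[R]_n => cons_rV (y, t)).
Proof.
apply: rV_measurable_fun => i; case: (unliftP ord0 i) => [j ->|->].
  under eq_fun do rewrite cons_rVS; exact: measurable_rV_coord.
by under eq_fun do rewrite cons_rV0 /=; exact: measurable_cst.
Qed.

Lemma measurable_cons2 (y : 'rV[R]_n) : measurable_fun setT (fun t : R => cons_rV (y, t)).
Proof.
apply: rV_measurable_fun => i; case: (unliftP ord0 i) => [j ->|->].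
  by under eq_fun do rewrite cons_rVS /=; exact: measurable_cst.
by under eq_fun do rewrite cons_rV0 /=; exact: measurable_id.
Qed.

Lemma integrable_cyl : (lebesgue_rV R n.+1).-integrable (cyl Q I) (EFin \o f).
Proof.
apply: bounded_integrable fK; [exact: measurable_cyl|exact: cyl_fin|].
exact: measurable_funTS.
Qed.

Lemma integrable_slice1 t : I t ->
  (lebesgue_rV R n).-integrable Q (EFin \o (fun y => f (cons_rV (y, t)))).
Proof.
move=> It; apply: (@bounded_integrable _ _ _ _ _ _ K) => //.
  by apply: measurable_funTS; apply: measurableT_comp (measurable_cons1 t).
by move=> y Qy; apply/fK/cons_cyl.
Qed.

Lemma integrable_slice2 y : Q y ->
  lebesgue_measure.-integrable I (EFin \o (fun t => f (cons_rV (y, t)))).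
Proof.
move=> It; apply: (@bounded_integrable _ _ _ _ _ _ K) => //.
  by apply: measurable_funTS; apply: measurableT_comp (measurable_cons2 y).
by move=> t Qt; apply/fK/cons_cyl.
Qed.

Let g := EFin \o (f \o @cons_rV R n).

Let mg : measurable_fun setT g.
Proof.
apply/measurable_EFinP; apply: measurableT_comp => //; exact: measurable_cons_rV.
Qed.

Let ig : (lebesgue_rV R n \x (@lebesgue_measure R))%E.-integrable (Q `*` I) g.
Proof.
apply: (@bounded_integrable _ _ _ _ _ _ K).
- exact: measurableX.
- by move: cyl_fin; rewrite lebesgue_rVS /= /pushforward cylE.
- by apply/measurable_EFinP; exact: measurable_funTS.
- by move=> [y t] [/= Qy It]; apply/fK/cons_cyl.
Qed.

Let h := g \_ (Q `*` I).

Let hE y t : h (y, t) = if (y \in Q) && (t \in I) then (f (cons_rV (y, t)))%:E else 0%E.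
Proof.
rewrite /h patchE (_ : (_ \in _) = (y \in Q) && (t \in I))//.
apply/idP/idP; rewrite !inE /=.
  by move=> [Qy It]; apply/andP; rewrite !inE.
by move=> /andP[]; rewrite !inE.
Qed.

Let ih : (lebesgue_rV R n \x (@lebesgue_measure R))%E.-integrable setT h.
Proof.
refine (proj1 (integrable_mkcond _ _) ig).
exact: (measurableX mQ (mI : measurable (I : set (g_sigma_algebraType R.-ocitv.-measurable)))).
Qed.

Let intE : (\int[lebesgue_rV R n.+1]_(x in cyl Q I) (f x)%:E)%E =
  (\int[lebesgue_rV R n \x lebesgue_measure]_z h z)%E.
Proof.
rewrite lebesgue_rVS integral_pushforward.
- by rewrite cylE [LHS]integral_mkcond.
- exact: measurable_cons_rV.
- exact/measurable_EFinP.
- by rewrite cylE.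
- exact: measurable_cyl.
Qed.

Lemma Rintegral_slice1 t : I t ->
  (\int[lebesgue_rV R n]_(y in Q) (f (cons_rV (y, t)))%:E)%E =
  (\int[lebesgue_rV R n]_(y in Q) f (cons_rV (y, t)))%:E.
Proof.
by move=> It; rewrite /Rintegral fineK//; apply: integrable_fin_num => //; exact: integrable_slice1.
Qed.

Lemma Rintegral_slice2 y : Q y ->
  (\int[lebesgue_measure]_(t in I) (f (cons_rV (y, t)))%:E)%E =
  (\int[lebesgue_measure]_(t in I) f (cons_rV (y, t)))%:E.
Proof.
by move=> It; rewrite /Rintegral fineK//; apply: integrable_fin_num => //; exact: integrable_slice2.
Qed.

Lemma integrable_slice_integral : lebesgue_measure.-integrable I
  (EFin \o (fun t => \int[lebesgue_rV R n]_(y in Q) f (cons_rV (y, t)))).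
Proof.
apply: (@bounded_integrable _ _ _ _ _ _ (K * fine (lebesgue_rV R n Q))) => //.
- have [m mE] := rV_sigma_finite_measure R n.
  move: ih; rewrite mE => ihm; apply/measurable_EFinP.
  have := measurable_fubini_G ihm => /(measurable_funTS (D := I)).
  apply: eq_measurable_fun => t tI; rewrite /fubini_G -mE /= -Rintegral_slice1; last exact: set_mem.
  rewrite [RHS]integral_mkcond; apply: eq_integral => y _.
  by rewrite hE tI andbT patchE.
- move=> t It; apply: le_trans (le_normr_Rintegral mQ (integrable_slice1 It)) _.
  rewrite -Rintegral_cst//; apply: le_Rintegral => //.
  + exact: integrable_norm (integrable_slice1 It).
  + by apply: (@bounded_integrable _ _ _ _ _ _ `|K|) => //.
  + by move=> y Qy; apply/fK/cons_cyl.
Qed.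

Lemma integrable_slice_integral2 : (lebesgue_rV R n).-integrable Q
  (EFin \o (fun y => \int[lebesgue_measure]_(t in I) f (cons_rV (y, t)))).
Proof.
apply: (@bounded_integrable _ _ _ _ _ _ (K * fine (lebesgue_measure I))) => //.
- have [m mE] := rV_sigma_finite_measure R n.
  move: ih; rewrite mE => ihm; apply/measurable_EFinP.
  have := measurable_fubini_F ihm => /(measurable_funTS (D := Q)).
  apply: eq_measurable_fun => y yQ; rewrite /fubini_F /= -Rintegral_slice2; last exact: set_mem.
  rewrite [RHS]integral_mkcond; apply: eq_integral => t _.
  by rewrite hE yQ patchE.
- move=> y Qy; apply: (le_trans (le_normr_Rintegral _ (integrable_slice2 Qy))) => //.
  rewrite -Rintegral_cst//; apply: le_Rintegral => //.
  + exact: integrable_norm (integrable_slice2 Qy).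
  + by apply: (@bounded_integrable _ _ _ _ _ _ `|K|) => //.
  + by move=> t It; apply/fK/cons_cyl.
Qed.

(** Fubini's theorem along the recursive construction of lebesgue_rV, for real
    integrals of bounded functions on sets of finite measure. *)
Lemma Rintegral_cyl : \int[lebesgue_rV R n.+1]_(x in cyl Q I) f x =
  \int[lebesgue_measure]_(t in I) \int[lebesgue_rV R n]_(y in Q) f (cons_rV (y, t)).
Proof.
have [m mE] := rV_sigma_finite_measure R n.
rewrite /Rintegral; congr fine; rewrite intE.
move: ih; rewrite mE => ihm; rewrite -(integral21_prod_meas1 ihm) [RHS]integral_mkcond.
apply: eq_integral => t _; rewrite patchE /fubini_G; case: ifPn => tI.
  rewrite -mE -Rintegral_slice1; last exact: set_mem.
  by rewrite [RHS]integral_mkcond; apply: eq_integral => y _; rewrite hE tI andbT patchE.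
by rewrite integral0_eq// => y _; rewrite hE (negbTE tI) andbF.
Qed.

Lemma Rintegral_cyl_swap : \int[lebesgue_rV R n.+1]_(x in cyl Q I) f x =
  \int[lebesgue_rV R n]_(y in Q) \int[lebesgue_measure]_(t in I) f (cons_rV (y, t)).
Proof.
have [m mE] := rV_sigma_finite_measure R n.
rewrite /Rintegral; congr fine; rewrite intE.
move: ih; rewrite mE => ihm; rewrite -(integral12_prod_meas1 ihm) [RHS]integral_mkcond.
apply: eq_integral => y _; rewrite patchE /fubini_F; case: ifPn => yQ.
  rewrite -Rintegral_slice2; last exact: set_mem.
  by rewrite [RHS]integral_mkcond; apply: eq_integral => t _; rewrite hE yQ patchE.
by rewrite integral0_eq// => t _; rewrite hE (negbTE yQ).
Qed.

End fubini_real.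

(** * Continuously differentiable functions *)

Section C1.
Variable R : realType.

Lemma cons_rV_shift n (y : 'rV[R]_n) t h j :
  cons_rV (h *: delta_mx ord0 j + y, t) = h *: delta_mx ord0 (lift ord0 j) + cons_rV (y, t).
Proof.
apply/rowP => i; rewrite [RHS]mxE [X in _ = X + _]mxE [X in _ = _ * X + _]mxE.
case: (unliftP ord0 i) => [k ->|->].
  by rewrite !cons_rVS /= !mxE (inj_eq lift_inj).
by rewrite !cons_rV0 (negbTE (neq_lift _ _)) andbF mulr0 add0r.
Qed.

Lemma cons_rV_shift0 n (y : 'rV[R]_n) t h :
  cons_rV (y, h + t) = h *: delta_mx ord0 ord0 + cons_rV (y, t).
Proof.
apply/rowP => i; rewrite [RHS]mxE [X in _ = X + _]mxE [X in _ = _ * X + _]mxE.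
case: (unliftP ord0 i) => [k ->|->].
  by rewrite !cons_rVS [lift _ _ == _]eq_sym (negbTE (neq_lift _ _)) andbF mulr0 add0r.
by rewrite !cons_rV0 /= mulr1.
Qed.

Lemma continuous_cons1 n (t : R) : continuous (fun y : 'rV[R]_n => cons_rV (y, t)).
Proof.
move=> y A /nbhs_ballP[e /= e0 he]; apply/nbhs_ballP; exists e => //= z.
move=> /(rV_ballE y z e0) h; apply: he; apply/rV_ballE => // i.
case: (unliftP ord0 i) => [j ->|->]; last by rewrite !cons_rV0/= subrr normr0.
by rewrite !cons_rVS.
Qed.

Lemma continuous_cons2 n (y : 'rV[R]_n) : continuous (fun t : R => cons_rV (y, t)).
Proof.
move=> t A /nbhs_ballP[e /= e0 he]; apply/nbhs_ballP; exists e => //= z.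
move=> h; apply: he; apply/rV_ballE => // i.
case: (unliftP ord0 i) => [j ->|->]; first by rewrite !cons_rVS/= subrr normr0.
by rewrite !cons_rV0.
Qed.

Definition C1 n (f : 'rV[R]_n -> R) := continuous f /\
  forall i, (forall x, derivable f x (delta_mx ord0 i)) /\ continuous (pderiv i f).

Let quot_slice n (f : 'rV[R]_n.+1 -> R) t i (y : 'rV[R]_n) :
  (fun h : R => h^-1 *: (((fun y => f (cons_rV (y, t))) \o shift y)
    (h *: delta_mx ord0 i) - f (cons_rV (y, t)))) =
  (fun h => h^-1 *: ((f \o shift (cons_rV (y, t)))
    (h *: delta_mx ord0 (lift ord0 i)) - f (cons_rV (y, t)))).
Proof. by apply/funext => h /=; rewrite cons_rV_shift. Qed.

Let quot_slice0 n (f : 'rV[R]_n.+1 -> R) t (y : 'rV[R]_n) :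
  (fun h : R => h^-1 *: (((fun t => f (cons_rV (y, t))) \o shift t)
    (h *: 1) - f (cons_rV (y, t)))) =
  (fun h => h^-1 *: ((f \o shift (cons_rV (y, t)))
    (h *: delta_mx ord0 ord0) - f (cons_rV (y, t)))).
Proof. by apply/funext => h /=; rewrite -cons_rV_shift0 [h *: 1]mulr1. Qed.

Lemma pderiv_slice n (f : 'rV[R]_n.+1 -> R) t i (y : 'rV[R]_n) :
  pderiv i (fun y => f (cons_rV (y, t))) y = pderiv (lift ord0 i) f (cons_rV (y, t)).
Proof.
by rewrite /pderiv /derive quot_slice.
Qed.

Lemma C1_slice n (f : 'rV[R]_n.+1 -> R) t : C1 f -> C1 (fun y => f (cons_rV (y, t))).
Proof.
move=> [cf df]; split.
  by move=> y; exact: (cvg_comp _ _ (@continuous_cons1 n t y) (cf _)).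
move=> i; have [d1 d2] := df (lift ord0 i); split.
  by move=> y; have := d1 (cons_rV (y, t)); rewrite /derivable quot_slice.
rewrite (_ : pderiv _ _ = fun y => pderiv (lift ord0 i) f (cons_rV (y, t))); last first.
  by apply/funext => y; exact: pderiv_slice.
by move=> y; exact: (cvg_comp _ _ (@continuous_cons1 n t y) (d2 _)).
Qed.

Lemma bounded_on_box n (f : 'rV[R]_n -> R) (M : R) : continuous f ->
  exists2 K, 0 <= K & forall x, box M x -> `|f x| <= K.
Proof.
move=> cf.
have cB : compact [set x : 'rV[R]_n | forall i, `[- M, M]%classic (x ord0 i : R)].
  by apply: (@rV_compact R n (fun=> `[- M, M]%classic)) => i; exact: segment_compact.
have cfB : compact (f @` [set x : 'rV[R]_n | forall i, `[- M, M]%classic (x ord0 i : R)]).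
  by apply: continuous_compact => //; apply: continuous_subspaceT.
have [K [_ hK]] := compact_bounded cfB.
exists (`|K| + 1); first by rewrite addr_ge0.
move=> x Bx; apply: hK; first by rewrite (le_lt_trans (ler_norm _))// ltrDl.
by exists x => // i; have /andP[h1 h2] := Bx i; rewrite /= in_itv/= h1 ltW.
Qed.

Lemma FTC_slice n (f : 'rV[R]_n.+1 -> R) (y : 'rV[R]_n) a b : C1 f -> a <= b ->
  \int[lebesgue_measure]_(t in `[a, b]) pderiv ord0 f (cons_rV (y, t)) =
  f (cons_rV (y, b)) - f (cons_rV (y, a)).
Proof.
move=> [cf df]; rewrite le_eqVlt => /predU1P[->|ab].
  by rewrite set_itv1 Rintegral_set1 subrr.
have [d1 d2] := df ord0.
pose F := fun t : R => f (cons_rV (y, t)).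
have dF t : derivable F t 1.
  by have := d1 (cons_rV (y, t)); rewrite /derivable quot_slice0.
have F' t : F^`()%classic t = pderiv ord0 f (cons_rV (y, t)).
  by rewrite derive1E /pderiv /derive quot_slice0.
have cF : continuous F.
  by move=> t; exact: (cvg_comp _ _ (@continuous_cons2 n y t) (cf _)).
rewrite /Rintegral (@continuous_FTC2 R (fun t => pderiv ord0 f (cons_rV (y, t))) F a b)//.
- apply: continuous_subspaceT => t.
  exact: (cvg_comp _ _ (@continuous_cons2 n y t) (d2 _)).
- split; first by move=> x _; exact: dF.
    by apply: cvg_at_right_filter; exact: cF.
  by apply: cvg_at_left_filter; exact: cF.
Qed.

(** Induction on the dimension. A derivative in a coordinate other than the first is
    a derivative of the slices; for the first coordinate, the fundamental theorem of
    calculus on each line leaves two boundary values, which vanish. *)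
Lemma integral_pderiv_eq0 n (f : 'rV[R]_n -> R) M : C1 f -> 0 < M ->
  (forall x, f x != 0 -> forall i, `|x ord0 i| < M) ->
  forall i, \int[lebesgue_rV R n]_(x in box M) pderiv i f x = 0.
Proof.
elim: n f => [f _ _ _ []//|n IH f Cf M0 fM i].
have [cf df] := Cf; have [_ c'] := df i.
have [K K0 hK] := bounded_on_box M c'.
have mc := continuous_rV_measurable c'.
have Ifin : (lebesgue_measure `[(- M)%R, M[%classic < +oo)%E.
  by rewrite lebesgue_measure_itv/=; case: ifP => _; rewrite -?EFinB ltry.
have mI : measurable `[- M, M[%classic by exact: measurable_itv.
have mQ := @measurable_box R n M.
rewrite boxS; rewrite boxS in hK.
case: (unliftP ord0 i) hK mc c' => [j ->|->] hK mc c'.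
  rewrite (Rintegral_cyl mQ mI (box_fin n M) Ifin mc hK).
  under eq_Rintegral => t tI.
    rewrite (_ : \int[_]_(_ in _) _ = 0); last first.
      under eq_Rintegral do rewrite -pderiv_slice.
      apply: IH => //; first exact: C1_slice.
      by move=> y fy k; have := fM _ fy (lift ord0 k); rewrite cons_rVS.
    over.
  by rewrite Rintegral_cst// mul0r.
rewrite (Rintegral_cyl_swap mQ mI (box_fin n M) Ifin mc hK).
under eq_Rintegral => y yQ.
  rewrite (_ : \int[_]_(_ in _) _ = 0); last first.
    rewrite Rintegral_itv_bndo_bndc; last first.
      by apply: (integrable_slice2 mI Ifin mc hK); exact: set_mem.
    rewrite FTC_slice//; last by lra.
    have z t : `|t| = M -> f (cons_rV (y, t)) = 0.
      move=> tM; apply/eqP/negP => /negP/fM/(_ ord0).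
      by rewrite cons_rV0/= tM ltxx.
    by rewrite !z ?subrr// ?normrN gtr0_norm.
  over.
by rewrite Rintegral_cst// ?mul0r.
Qed.

End C1.

(** * A compactness inequality on boxes *)

Section finite_measure.
Context d (T : measurableType d) (R : realType) (mu : {measure set T -> \bar R}).
Variables (E : set T) (mE : measurable E) (Efin : (mu E < +oo)%E).

Lemma integrable_bounded_sqr (f : T -> R) (K : R) : measurable_fun E f ->
  (forall x, E x -> `|f x| <= K) -> mu.-integrable E (EFin \o (fun x => f x ^+ 2)).
Proof.
move=> mf fK; apply: (@bounded_integrable _ _ _ _ _ _ (K ^+ 2)) => //.
  exact: measurable_funX.
by move=> x Ex; rewrite normrX; apply: lerXn2r; rewrite ?nnegrE ?fK//; exact: le_trans (normr_ge0 _) (fK x Ex).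
Qed.

Lemma Rintegral_CS (f : T -> R) (K : R) : measurable_fun E f ->
  (forall x, E x -> `|f x| <= K) ->
  (\int[mu]_(x in E) f x) ^+ 2 <= fine (mu E) * \int[mu]_(x in E) (f x ^+ 2).
Proof.
move=> mf fK.
have sf : sqint mu E f by split => //; exact: (integrable_bounded_sqr mf fK).
have s1 : sqint mu E (fun=> 1).
  by split => //; apply: (@integrable_bounded_sqr _ 1) => // x _; rewrite normr1.
have := sip_CS (sq_inner mu mE) (mk_sqfun mE s1) (mk_sqfun mE sf).
rewrite /= /sq_ip /=; under eq_Rintegral do rewrite mul1r.
rewrite Rintegral_cst// !mul1r => h; apply: le_trans h _.
by rewrite (eq_Rintegral _ (g := fun x => f x ^+ 2))// => x _; rewrite expr2.
Qed.

(** Let c be the mean of g. By Cauchy-Schwarz (g x - c)^2 is at most the mean of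
    (g x - g x')^2 over x', hence at most D, and the integral of g^2 is the integral
    of (g - c)^2 plus the square of the integral of g over the measure of E. *)
Lemma Rintegral_oscillation (g : T -> R) (K D : R) : measurable_fun E g -> 0 < fine (mu E) ->
  (forall x, E x -> `|g x| <= K) ->
  (forall x x', E x -> E x' -> (g x - g x') ^+ 2 <= D) ->
  \int[mu]_(x in E) (g x ^+ 2) <=
    fine (mu E) * D + (fine (mu E))^-1 * (\int[mu]_(x in E) g x) ^+ 2.
Proof.
move=> mg E0 gK gD; set L := fine (mu E); set G := \int[mu]_(x in E) g x.
have ig : mu.-integrable E (EFin \o g) by exact: bounded_integrable gK.
have ig2 := integrable_bounded_sqr mg gK.
have ic (c : R) : mu.-integrable E (EFin \o (fun=> c)).
  by apply: (@bounded_integrable _ _ _ _ _ _ `|c|).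
have icg (c : R) : mu.-integrable E (EFin \o (fun x => c * g x)).
  by have := integrableZl mE c ig; apply: eq_integrable.
pose c := G / L.
have gc x : E x -> (g x - c) ^+ 2 <= D.
  move=> Ex.
  have mgx : measurable_fun E (fun x' => g x - g x') by exact: measurable_funB.
  have bgx x' : E x' -> `|g x - g x'| <= K + K.
    by move=> Ex'; apply: le_trans (ler_normB _ _) _; rewrite lerD ?gK.
  have := Rintegral_CS mgx bgx.
  rewrite RintegralB// Rintegral_cst// -/L -/G => h.
  have h2 : \int[mu]_(x0 in E) ((g x - g x0) ^+ 2) <= D * L.
    rewrite -Rintegral_cst//; apply: le_Rintegral => //.
      exact: (integrable_bounded_sqr mgx bgx).
    by move=> x' Ex'; exact: gD.
  have L0 : 0 < L by [].
  have := le_trans h (ler_wpM2l (ltW L0) h2).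
  rewrite (_ : g x * L - G = (g x - c) * L); last by rewrite /c; field; rewrite gt_eqF.
  have -> : L * (D * L) = D * L ^+ 2 by ring.
  by rewrite exprMn ler_pM2r// exprn_gt0.
have : \int[mu]_(x in E) ((g x - c) ^+ 2) <= D * L.
  rewrite -Rintegral_cst//; apply: le_Rintegral => //.
  apply: (@integrable_bounded_sqr _ (K + `|c|)); first exact: measurable_funB.
  by move=> x Ex; apply: le_trans (ler_normB _ _) _; rewrite lerD2r gK.
rewrite (_ : \int[mu]_(x in E) ((g x - c) ^+ 2) =
   \int[mu]_(x in E) (g x ^+ 2) - (2 * c) * G + c ^+ 2 * L); last first.
  rewrite -RintegralZl// -Rintegral_cst// -RintegralB// -RintegralD//.
    by apply: eq_Rintegral => x _; ring.
  by have := integrableB mE ig2 (icg (2 * c)); apply: eq_integrable.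
have -> : L^-1 * G ^+ 2 = (2 * c) * G - c ^+ 2 * L.
  by rewrite /c; field; rewrite gt_eqF.
lra.
Qed.

End finite_measure.

Section partition.
Variable R : realType.
Local Notation leb := (@lebesgue_measure R).

Definition cell (a eta : R) (j : nat) : set R := `[a + j%:R * eta, a + j.+1%:R * eta[%classic.

Lemma Rintegral_cells (a eta : R) (h : R -> R) N : 0 <= eta ->
  leb.-integrable `[a, a + N%:R * eta[ (EFin \o h) ->
  \int[leb]_(t in `[a, a + N%:R * eta[) h t =
  \sum_(j < N) \int[leb]_(t in cell a eta j) h t.
Proof.
move=> e0; elim: N => [|N IH] ih.
  by rewrite mul0r addr0 set_itvco0 Rintegral_set0 big_ord0.
have aN : a <= a + N%:R * eta by rewrite lerDl mulr_ge0.
have NN : a + N%:R * eta <= a + N.+1%:R * eta by rewrite lerD2l ler_wpM2r// ler_nat.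
have U : `[a, a + N.+1%:R * eta[%classic = `[a, a + N%:R * eta[ `|` cell a eta N.
  by rewrite /cell -itv_bndbnd_setU// !bnd_simp.
rewrite big_ord_recr/= -IH; last first.
  by apply: integrableS ih => //; rewrite U; exact: subsetUl.
rewrite {1}U Rintegral_setU//; [exact: measurable_itv| |].
  by rewrite -U.
apply/disj_setPRL => t; rewrite /cell/= !in_itv/= => /andP[h1 _] /andP[_ h2].
by move: h2; rewrite ltNge h1.
Qed.

End partition.

Section rellich.
Variable R : realType.
Local Notation leb := (@lebesgue_measure R).

Lemma Rintegral_subset d (T : measurableType d) (mu : {measure set T -> \bar R})
    (A B : set T) (f : T -> R) : measurable A -> measurable B -> A `<=` B ->
  (forall x, B x -> 0 <= f x) -> mu.-integrable B (EFin \o f) ->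
  \int[mu]_(x in A) f x <= \int[mu]_(x in B) f x.
Proof.
move=> mA mB AB f0 fB; have fA := integrableS mB mA AB fB.
rewrite /Rintegral fine_le//; [exact: integrable_fin_num fA|exact: integrable_fin_num fB|].
apply: ge0_subset_integral => //; first exact: measurable_int fB.
Qed.

Lemma Rintegral_sum d (T : measurableType d) (mu : {measure set T -> \bar R})
    (D : set T) (I : Type) (r : seq I) (F : I -> T -> R) : measurable D ->
  (forall i, mu.-integrable D (EFin \o F i)) ->
  mu.-integrable D (EFin \o (fun x => \sum_(i <- r) F i x)) /\
  \int[mu]_(x in D) (\sum_(i <- r) F i x) = \sum_(i <- r) \int[mu]_(x in D) F i x.
Proof.
move=> mD iF; elim: r => [|i r [IH1 IH2]].
  split; last by under eq_Rintegral do rewrite big_nil; rewrite Rintegral_cst// mul0r big_nil.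
  by apply: eq_integrable (integrable0 _ _) => //= x _; rewrite big_nil.
split.
  by have := integrableD mD (iF i) IH1; apply: eq_integrable => //= x _; rewrite big_cons.
by rewrite big_cons -IH2 -RintegralD//; apply: eq_Rintegral => x _; rewrite big_cons.
Qed.

Lemma leb_itv_co (a b : R) : a <= b -> leb `[a, b[%classic = (b - a)%:E.
Proof.
rewrite lebesgue_measure_itv/= lte_fin le_eqVlt => /predU1P[->|->].
  by rewrite ltxx subrr.
by rewrite EFinB.
Qed.

Lemma leb_itv_cc (a b : R) : a <= b -> leb `[a, b]%classic = (b - a)%:E.
Proof. by move=> ab; rewrite -leb_itv_co// !lebesgue_measure_itv. Qed.

Lemma cyl_box n (Q : set 'rV[R]_n) (M a b : R) : Q `<=` box M -> - M <= a -> b <= M ->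
  cyl Q `[a, b[ `<=` box M.
Proof.
move=> QM Ma bM x [Qx]; rewrite boxS /= !in_itv/= => /andP[h1 h2]; split; first exact: QM.
by rewrite /= in_itv/= (le_trans Ma h1) (lt_le_trans h2 bM).
Qed.

(** The difference is the integral of the first derivative over [t', t]; apply
    Cauchy-Schwarz and enlarge the interval. *)
Lemma slice_diff n (f : 'rV[R]_n.+1 -> R) (y : 'rV[R]_n) (M a b t t' : R) : C1 f ->
  box M y -> - M <= a -> b <= M -> a <= t < b -> a <= t' < b ->
  (f (cons_rV (y, t)) - f (cons_rV (y, t'))) ^+ 2 <=
  (b - a) * \int[leb]_(r in `[a, b[) (pderiv ord0 f (cons_rV (y, r)) ^+ 2).
Proof.
move=> Cf My Ma bM; have [_ cd] := Cf.2 ord0.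
wlog tt' : t t' / t' <= t.
  move=> hw /[dup] ht /andP[t1 t2] /[dup] ht' /andP[t1' t2'].
  have [|/ltW] := leP t' t; first by move=> h; exact: hw.
  by move=> tt'; rewrite -sqrrN opprB; exact: hw.
move=> /andP[at_ tb] /andP[at' tb'].
have [K K0 hK] := bounded_on_box M cd.
have md : measurable_fun setT (fun r => pderiv ord0 f (cons_rV (y, r))).
  exact: (measurableT_comp (continuous_rV_measurable cd) (measurable_cons2 y)).
have dK (r : R) : a <= r < b -> `|pderiv ord0 f (cons_rV (y, r))| <= K.
  move=> /andP[ar rb]; apply: hK; rewrite boxS /cyl/= tail_cons cons_rV0/=; split => //.
  by rewrite in_itv/= (le_trans Ma ar) (lt_le_trans rb bM).
have sub : `[t', t] `<=` `[a, b[.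
  by move=> r/=; rewrite !in_itv/= => /andP[h1 h2]; rewrite (le_trans at' h1) (le_lt_trans h2 tb).
rewrite -FTC_slice//.
have ltt : (leb `[t', t]%classic < +oo)%E by rewrite leb_itv_cc// ltry.
apply: (@le_trans _ _ (fine (leb `[t', t]%classic) *
   \int[leb]_(r in `[t', t]) (pderiv ord0 f (cons_rV (y, r)) ^+ 2))).
  apply: (Rintegral_CS _ ltt (K := K)) => //; first exact: measurable_funTS.
  by move=> r /sub /= hr; apply: dK; rewrite in_itv/= in hr.
rewrite leb_itv_cc//=; apply: ler_pM.
- by rewrite subr_ge0.
- by apply: Rintegral_ge0 => r _; rewrite sqr_ge0.
- by rewrite lerB// ltW.
- apply: Rintegral_subset => //; [by move=> r _; rewrite sqr_ge0|].
  apply: (@integrable_bounded_sqr _ _ _ _ _ _ _ _ K) => //.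
  + have h : (leb `[a, b[%classic < +oo)%E.
      by rewrite leb_itv_co ?ltry// (le_trans at_ (ltW tb)).
    exact: h.
  + exact: measurable_funTS.
Qed.

(** slice_diff for each y, then Cauchy-Schwarz over Q and Fubini. *)
Lemma slice_oscillation n (f : 'rV[R]_n.+1 -> R) (Q : set 'rV[R]_n) (M a b t t' : R) :
  C1 f -> measurable Q -> Q `<=` box M -> - M <= a -> b <= M ->
  a <= t < b -> a <= t' < b ->
  (\int[lebesgue_rV R n]_(y in Q) f (cons_rV (y, t)) -
   \int[lebesgue_rV R n]_(y in Q) f (cons_rV (y, t'))) ^+ 2 <=
  fine (lebesgue_rV R n Q) * ((b - a) *
    \int[lebesgue_rV R n.+1]_(x in cyl Q `[a, b[) (pderiv ord0 f x ^+ 2)).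
Proof.
move=> Cf mQ QM Ma bM ht ht'; have [cf df] := Cf; have [_ cd] := df ord0.
have [K K0 hK] := bounded_on_box M cf; have [K' K'0 hK'] := bounded_on_box M cd.
have cQ := cyl_box QM Ma bM.
have mI : measurable `[a, b[%classic by exact: measurable_itv.
have ab : a <= b by case/andP: ht => h1 /ltW; exact: le_trans.
have Ifin : (leb `[a, b[%classic < +oo)%E by rewrite leb_itv_co// ltry.
have Qfin : (lebesgue_rV R n Q < +oo)%E.
  apply: le_lt_trans (box_fin n M); apply: le_measure; rewrite ?inE//.
  exact: measurable_box.
have mf := continuous_rV_measurable cf.
have md2 : measurable_fun setT (fun x => pderiv ord0 f x ^+ 2).
  by apply: measurable_funX; exact: continuous_rV_measurable.
have fK x : cyl Q `[a, b[ x -> `|f x| <= K by move=> /cQ/hK.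
have dK x : cyl Q `[a, b[ x -> `|pderiv ord0 f x ^+ 2| <= K' ^+ 2.
  by move=> /cQ/hK' h; rewrite normrX lerXn2r// nnegrE.
have It r : a <= r < b -> `[a, b[%classic r by rewrite /= in_itv.
have isl r hr := integrable_slice1 mQ Qfin mf fK (It r hr).
rewrite -RintegralB//; [|exact: isl|exact: isl].
have msl r : measurable_fun Q (fun y => f (cons_rV (y, r))).
  by apply: measurable_funTS; exact: (measurableT_comp mf (measurable_cons1 r)).
have mdiff : measurable_fun Q (fun y => f (cons_rV (y, t)) - f (cons_rV (y, t'))).
  exact: measurable_funB.
have bdiff y : Q y -> `|f (cons_rV (y, t)) - f (cons_rV (y, t'))| <= K + K.
  move=> Qy; apply: le_trans (ler_normB _ _) _.
  by rewrite lerD// fK//; apply: cons_cyl => //; exact: It.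
apply: le_trans (Rintegral_CS mQ Qfin mdiff bdiff) _.
apply: ler_wpM2l; first by rewrite fine_ge0.
rewrite (Rintegral_cyl_swap mQ mI Qfin Ifin md2 dK).
rewrite -RintegralZl//; last exact: (integrable_slice_integral2 mQ mI Qfin Ifin md2 dK).
apply: le_Rintegral => //.
- exact: (integrable_bounded_sqr mQ Qfin mdiff bdiff).
- have := integrableZl mQ (b - a) (integrable_slice_integral2 mQ mI Qfin Ifin md2 dK).
  exact: eq_integrable.
- by move=> y /QM yM; exact: (slice_diff Cf yM Ma bM ht ht').
Qed.

(** Rellich's theorem in quantitative form; the sets Q do not depend on f, so the
    second sum consists of finitely many fixed linear functionals. By induction on
    the dimension: on the slice at height t the inequality leaves the squares of the
    averages g j t over finitely many sets Q j. Cut the last interval into N cells of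
    length eta. On a cell g j oscillates little, by slice_oscillation, so that its
    square is controlled by eta^2 times the energy of the first derivative and by the
    square of its integral over the cell, which is an integral of f over a cylinder.
    A large N makes the first contribution smaller than e. *)
Lemma rellich_box n (M e : R) : 0 < M -> 0 < e ->
  exists (J : finType) (Q : J -> set 'rV[R]_n) (C : R), [/\ 0 <= C,
    forall j, measurable (Q j), forall j, Q j `<=` box M &
    forall f, C1 f -> \int[lebesgue_rV R n]_(x in box M) (f x ^+ 2) <=
      e * \sum_(i < n) \int[lebesgue_rV R n]_(x in box M) (pderiv i f x ^+ 2) +
      C * \sum_j (\int[lebesgue_rV R n]_(x in Q j) f x) ^+ 2].
Proof.
move=> M0 e0; elim: n => [|n [J [Q [C [C0 mQ QM IH]]]]].
  exists unit, (fun=> box M), 1; split; [exact: ler01|by move=> _; exact: measurable_box|by move=> _ x|].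
  move=> f Cf; rewrite big_ord0 mulr0 add0r mul1r.
  rewrite (eq_bigr (fun=> (\int[lebesgue_rV R 0]_(x in box M) f x) ^+ 2))//.
  rewrite sumr_const card_unit mulr1n.
  have dE (g : 'rV[R]_0 -> R) : measurable_fun setT g ->
      \int[lebesgue_rV R 0]_(x in box M) g x = g 0.
    move=> mg; rewrite /Rintegral /= integral_dirac//; last 2 first.
    - exact: measurable_box.
    - by apply/measurable_EFinP; exact: measurable_funTS.
    have B0 : box M (0 : 'rV[R]_0) by case.
    by rewrite diracE mem_set// mul1e.
  have mf := continuous_rV_measurable Cf.1.
  by rewrite !dE//; exact: measurable_funX.
have Qfin j : (lebesgue_rV R n (Q j) < +oo)%E.
  apply: le_lt_trans (box_fin n M); apply: le_measure; rewrite ?inE//.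
  exact: measurable_box.
pose S := C * \sum_j fine (lebesgue_rV R n (Q j)).
have S0 : 0 <= S by rewrite mulr_ge0// sumr_ge0// => j _; exact: fine_ge0.
have [N N0 hN] : exists2 N : nat, (0 < N)%N & (2 * M / N%:R) ^+ 2 * S <= e.
  (* N^2 >= N > 4 M^2 S / e. *)
  exists (Num.truncn (4 * M ^+ 2 * S / e)).+1 => //.
  set N := (Num.truncn _).+1.
  have hN : 4 * M ^+ 2 * S / e < N%:R by exact: truncnS_gt.
  have N1 : 1 <= N%:R :> R by rewrite ler1n.
  have Np : 0 < N%:R :> R by apply: lt_le_trans N1.
  rewrite exprMn exprVn mulrAC ler_pdivrMr ?exprn_gt0//.
  move: hN; rewrite ltr_pdivrMr// => hN.
  rewrite exprMn (_ : 2 ^+ 2 = 4); last by ring.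
  apply: le_trans (ltW hN) _; rewrite mulrC ler_pM2l// expr2.
  by rewrite ler_peMl// ltW.
pose eta := 2 * M / N%:R.
have Np : 0 < N%:R :> R by rewrite ltr0n.
have eta0 : 0 < eta by rewrite divr_gt0// mulr_gt0.
have NE : - M + N%:R * eta = M by rewrite /eta; field; rewrite gt_eqF.
have cellM k : (k < N)%N -> - M <= - M + k%:R * eta /\ - M + k.+1%:R * eta <= M.
  move=> kN; split; first by rewrite lerDl mulr_ge0// ltW.
  by rewrite -[leRHS]NE lerD2l ler_pM2r// ler_nat.
have cell_lt k : - M + k%:R * eta < - M + k.+1%:R * eta.
  by rewrite ltrD2l ltr_pM2r// ltr_nat.
have cell_len k : (- M + k.+1%:R * eta) - (- M + k%:R * eta) = eta.
  by rewrite -natr1; ring.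
exists (J * 'I_N)%type, (fun p : J * 'I_N => cyl (Q p.1) (cell (- M) eta p.2)), (C / eta).
have mcell k : measurable (cell (- M) eta k) by exact: measurable_itv.
split.
- by rewrite divr_ge0// ltW.
- by move=> j; exact: measurable_cyl.
- by move=> [j k]; have [] := cellM k (ltn_ord k); exact: cyl_box.
move=> f Cf; have [cf df] := Cf.
have [K K0 hK] := bounded_on_box M cf.
have mf := continuous_rV_measurable cf.
have mI : measurable `[- M, M[%classic by exact: measurable_itv.
have mB := @measurable_box R n M; have Bfin := box_fin n M.
have Ifin : (leb `[(- M)%R, M[%classic < +oo)%E by rewrite leb_itv_co ?ltry//; lra.
have f2K x : cyl (box M) `[- M, M[ x -> `|f x ^+ 2| <= K ^+ 2.
  by rewrite -boxS => /hK h; rewrite normrX lerXn2r// nnegrE.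
have mf2 : measurable_fun setT (fun x => f x ^+ 2) by exact: measurable_funX.
have md2 i : measurable_fun setT (fun x => pderiv i f x ^+ 2).
  by apply: measurable_funX; apply: continuous_rV_measurable; case: (df i).
have /choice[K' hK'] : forall i, exists K', forall x, box M x -> `|pderiv i f x ^+ 2| <= K'.
  move=> i; have [K1 K10 h] := bounded_on_box M (df i).2; exists (K1 ^+ 2) => x /h hx.
  by rewrite normrX lerXn2r// nnegrE.
have d2K i x : cyl (box M) `[- M, M[ x -> `|pderiv i f x ^+ 2| <= K' i.
  by rewrite -boxS; exact: hK'.
have MM : - M <= M by lra.
(* The averages left over by the inequality on the slice at height t. *)
pose g j t := \int[lebesgue_rV R n]_(y in Q j) f (cons_rV (y, t)).
have fKj j a b x : - M <= a -> b <= M -> cyl (Q j) `[a, b[ x -> `|f x| <= K.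
  by move=> Ma bM /(cyl_box (QM j) Ma bM)/hK.
have ig j a b : - M <= a -> a <= b -> b <= M ->
    leb.-integrable `[a, b[ (EFin \o g j).
  move=> Ma ab bM; have hf x := @fKj j a b x Ma bM.
  apply: (integrable_slice_integral (mQ j) _ (Qfin j) _ mf hf); first exact: measurable_itv.
  by rewrite leb_itv_co// ltry.
have gK j t : - M <= t < M -> `|g j t| <= K * fine (lebesgue_rV R n (Q j)).
  move=> ht; have hf x := @fKj j (- M) M x (lexx _) (lexx _).
  have It : `[- M, M[%classic t by rewrite /= in_itv.
  have ist := integrable_slice1 (mQ j) (Qfin j) mf hf It.
  apply: le_trans (le_normr_Rintegral (mQ j) ist) _.
  rewrite -Rintegral_cst//; apply: le_Rintegral => //.
  + exact: integrable_norm ist.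
  + by apply: (@bounded_integrable _ _ _ _ _ _ `|K|) => //.
  + by move=> y Qy; exact: (hf _ (cons_cyl Qy It)).
have ig2 j : leb.-integrable `[- M, M[ (EFin \o (fun t => g j t ^+ 2)).
  apply: (@integrable_bounded_sqr _ _ _ leb _ mI Ifin _ (K * fine (lebesgue_rV R n (Q j)))).
    apply/measurable_EFinP; exact: measurable_int (ig j (- M) M (lexx _) MM (lexx _)).
  by move=> t /=; rewrite in_itv/=; exact: gK.
have gcell j : \int[leb]_(t in `[- M, M[) (g j t ^+ 2) <=
    eta ^+ 2 * fine (lebesgue_rV R n (Q j)) *
      \int[lebesgue_rV R n.+1]_(x in box M) (pderiv ord0 f x ^+ 2) +
    eta^-1 * \sum_(k < N) (\int[lebesgue_rV R n.+1]_(x in cyl (Q j) (cell (- M) eta k)) f x) ^+ 2.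
  have mfX := md2 ord0; have hd x := @d2K ord0 x.
  have dKj a b x : - M <= a -> b <= M -> cyl (Q j) `[a, b[ x -> `|pderiv ord0 f x ^+ 2| <= K' ord0.
    by move=> Ma bM /(cyl_box (QM j) Ma bM); exact: hK'.
  pose P k := \int[lebesgue_rV R n.+1]_(x in cyl (Q j) (cell (- M) eta k)) (pderiv ord0 f x ^+ 2).
  have cfin k : (leb (cell (- M) eta k) < +oo)%E.
    by rewrite /cell leb_itv_co ?ltry// ltW.
  have clen k : fine (leb (cell (- M) eta k)) = eta.
    by rewrite /cell leb_itv_co ?ltW//= cell_len.
  have PE : \sum_(k < N) P k <= \int[lebesgue_rV R n.+1]_(x in box M) (pderiv ord0 f x ^+ 2).
    have dM x := @dKj (- M) M x (lexx _) (lexx _).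
    apply: (@le_trans _ _ (\int[lebesgue_rV R n.+1]_(x in cyl (Q j) `[- M, M[) (pderiv ord0 f x ^+ 2))).
      rewrite (Rintegral_cyl (mQ j) mI (Qfin j) Ifin mfX dM) -[X in `[_, X[]NE (Rintegral_cells (ltW eta0)).
        rewrite le_eqVlt; apply/orP; left; apply/eqP; apply: eq_bigr => k _.
        have [h1 h2] := cellM k (ltn_ord k).
        by rewrite /P (Rintegral_cyl (mQ j) (mcell k) (Qfin j) (cfin k) mfX (fun x => @dKj _ _ x h1 h2)).
      by rewrite NE; exact: (integrable_slice_integral (mQ j) mI (Qfin j) Ifin mfX dM).
    apply: Rintegral_subset.
    - exact: measurable_cyl.
    - exact: measurable_box.
    - exact: cyl_box.
    - by move=> x _; rewrite sqr_ge0.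
    - by rewrite boxS; exact: (integrable_cyl mB mI Bfin Ifin mfX hd).
  apply: (@le_trans _ _ (\sum_(k < N) (eta * (fine (lebesgue_rV R n (Q j)) * (eta * P k)) +
     eta^-1 * (\int[lebesgue_rV R n.+1]_(x in cyl (Q j) (cell (- M) eta k)) f x) ^+ 2))).
    rewrite -[X in `[_, X[]NE (Rintegral_cells (ltW eta0)); last by rewrite NE; exact: ig2.
    apply: ler_sum => k _; have [h1 h2] := cellM k (ltn_ord k).
    have subM t : cell (- M) eta k t -> - M <= t < M.
      by rewrite /cell/= in_itv/= => /andP[t1 t2]; rewrite (le_trans h1 t1) (lt_le_trans t2 h2).
    rewrite (Rintegral_cyl (mQ j) (mcell k) (Qfin j) (cfin k) mf (fun x => @fKj j _ _ x h1 h2)).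
    have mg : measurable_fun (cell (- M) eta k) (g j).
      by apply/measurable_EFinP; exact: measurable_int (ig j _ _ h1 (ltW (cell_lt k)) h2).
    have := @Rintegral_oscillation _ _ _ leb _ (mcell k) (cfin k) (g j)
      (K * fine (lebesgue_rV R n (Q j))) (fine (lebesgue_rV R n (Q j)) * (eta * P k)) mg.
    rewrite !clen; apply => //.
      by move=> t /subM; exact: gK.
    move=> t t'; rewrite /cell/= !in_itv/= => ht ht'.
    have := slice_oscillation Cf (mQ j) (QM j) h1 h2 ht ht'.
    by rewrite cell_len.
  rewrite big_split/=; apply: lerD; last by rewrite mulr_sumr.
  rewrite (eq_bigr (fun k : 'I_N => eta ^+ 2 * fine (lebesgue_rV R n (Q j)) * P k)); last first.
    by move=> k _; ring.
  rewrite -mulr_sumr ler_wpM2l// mulr_ge0 ?sqr_ge0// fine_ge0//.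
pose Z t := e * \sum_(i < n) \int[lebesgue_rV R n]_(y in box M)
     (pderiv (lift ord0 i) f (cons_rV (y, t)) ^+ 2) + C * \sum_j (g j t) ^+ 2.
have iZ1 i : leb.-integrable `[- M, M[ (EFin \o (fun t => \int[lebesgue_rV R n]_(y in box M)
     (pderiv i f (cons_rV (y, t)) ^+ 2))).
  exact: (integrable_slice_integral mB mI Bfin Ifin (md2 i) (@d2K i)).
have [s1 e1] := @Rintegral_sum _ _ leb _ _ (index_enum 'I_n) _ mI (fun i => iZ1 (lift ord0 i)).
have [s2 e2] := @Rintegral_sum _ _ leb _ _ (index_enum J) _ mI ig2.
have iA := integrable_slice_integral mB mI Bfin Ifin mf2 f2K.
have iZ : leb.-integrable `[- M, M[ (EFin \o Z).
  have := @integrableD _ _ _ leb _ mI _ _ (@integrableZl _ _ _ leb _ mI e _ s1) (@integrableZl _ _ _ leb _ mI C _ s2).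
  exact: eq_integrable.
have i1 : leb.-integrable `[- M, M[ (EFin \o (fun t => e * \sum_(i < n)
    \int[lebesgue_rV R n]_(y in box M) (pderiv (lift ord0 i) f (cons_rV (y, t)) ^+ 2))).
  by have := @integrableZl _ _ _ leb _ mI e _ s1; apply: eq_integrable.
have i2 : leb.-integrable `[- M, M[ (EFin \o (fun t => C * \sum_j (g j t) ^+ 2)).
  by have := @integrableZl _ _ _ leb _ mI C _ s2; apply: eq_integrable.
pose P i := \int[lebesgue_rV R n.+1]_(x in box M) (pderiv i f x ^+ 2).
have PE i : P i = \int[leb]_(t in `[- M, M[) \int[lebesgue_rV R n]_(y in box M)
     (pderiv i f (cons_rV (y, t)) ^+ 2).
  by rewrite /P boxS (Rintegral_cyl mB mI Bfin Ifin (md2 i) (@d2K i)).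
have P0 i : 0 <= P i by apply: Rintegral_ge0 => x _; rewrite sqr_ge0.
apply: (@le_trans _ _ (\int[leb]_(t in `[- M, M[) Z t)).
  rewrite boxS (Rintegral_cyl mB mI Bfin Ifin mf2 f2K).
  apply: le_Rintegral => // t _; rewrite /Z.
  have E : \sum_(i < n) \int[lebesgue_rV R n]_(y in box M)
        (pderiv (lift ord0 i) f (cons_rV (y, t)) ^+ 2) =
      \sum_(i < n) \int[lebesgue_rV R n]_(y in box M)
        (pderiv i (fun y => f (cons_rV (y, t))) y ^+ 2).
    by apply: eq_bigr => i _; apply: eq_Rintegral => y _; rewrite pderiv_slice.
  rewrite E; exact: (IH _ (C1_slice t Cf)).
rewrite /Z RintegralD// RintegralZl// RintegralZl// e1 e2.
rewrite (eq_bigr (fun i => P (lift ord0 i))); last by move=> i _; rewrite PE.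
rewrite big_ord_recl -/(P ord0) mulrDr.
have h1 : C * \sum_j \int[leb]_(t in `[- M, M[) (g j t ^+ 2) <= e * P ord0 +
    C / eta * \sum_j \sum_(k < N)
      (\int[lebesgue_rV R n.+1]_(x in cyl (Q j) (cell (- M) eta k)) f x) ^+ 2.
  apply: le_trans (ler_wpM2l C0 (ler_sum _ (fun j _ => gcell j))) _.
  rewrite big_split/= mulrDr -mulr_suml -mulr_sumr -mulr_sumr -/(P ord0).
  rewrite mulrA [C * (_ * _)]mulrCA -/S [X in _ + X]mulrA lerD2r ler_wpM2r//.
rewrite pair_bigA/= in h1.
by apply: le_trans (lerD (lexx _) h1) _; rewrite addrA lerD2r addrC.
Qed.

End rellich.

(** * Riesz representation and products of spaces *)

Section riesz.
Variables (R : realType) (V : lmodType R) (B : semi_inner V).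

(** The component w, orthogonal to the kernel of l, of any vector on which l does not
    vanish represents l once it is normalised. *)
Lemma riesz (l : V -> R) (C : R) : complete_for B ->
  (forall x y, l (x + y) = l x + l y) -> (forall a x, l (a *: x) = a * l x) ->
  (forall x, l x ^+ 2 <= C * B x x) -> exists r, forall x, B r x = l x.
Proof.
move=> cpl lD lZ lC.
have lB x y : l (x - y) = l x - l y by rewrite lD -scaleN1r lZ mulN1r.
have [[x0 l0]|l0] := pselect (exists x, l x <> 0); last first.
  exists 0 => x; rewrite sip0l; apply/esym; apply: contrapT => lx; apply: l0.
  by exists x.
pose M := [set x | l x = 0].
have sM : subspace M.
  split=> [|x y /= hx hy|a x /= hx]; rewrite /M/=.
  - by rewrite -(scale0r 0) lZ mul0r.
  - by rewrite lD hx hy addr0.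
  - by rewrite lZ hx mulr0.
have [p [Mp xp]] := projection cpl sM x0.
have lp : l p = 0.
  apply: (@sip_lim0 _ _ C) => e e0.
  have [C0|C0] := ltP C 0.
    have := lC x0; have := sip_ge0 B x0; have : l x0 ^+ 2 > 0.
      by rewrite lt_neqAle sqr_ge0 andbT eq_sym sqrf_eq0; exact/eqP.
    nra.
  have [m Mm pm] := Mp _ e0.
  have -> : l p = l (p - m) by rewrite lB Mm subr0.
  by apply: le_trans (lC _) _; rewrite ler_wpM2l.
pose w := x0 - p.
have lw : l w <> 0 by rewrite /w lB lp subr0.
have ww : B w w <> 0.
  move=> w0; apply: lw; apply/eqP; rewrite -sqrf_eq0 eq_le sqr_ge0 andbT.
  by apply: le_trans (lC w) _; rewrite w0 mulr0.
exists ((l w / B w w) *: w) => x.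
have : M (x - (l x / l w) *: w).
  by rewrite /M/= lB lZ divfK ?subrr//; exact/eqP.
move=> /xp; rewrite -/w; move: w lw ww => w lw ww; rewrite sipDr sipNr sipZr => h.
have bw : B w x = l x / l w * B w w by apply/eqP; rewrite -subr_eq0 h.
by rewrite sipZl bw; field; apply/andP; split; apply/eqP.
Qed.

Lemma equivalent_complete (B' : semi_inner V) (c C : R) : 0 < c -> 0 < C ->
  (forall x, c * B x x <= B' x x) -> (forall x, B' x x <= C * B x x) ->
  complete_for B -> complete_for B'.
Proof.
move=> c0 C0 cB CB cpl u cu.
have [|l ul] := cpl u.
  move=> e e0; have [N hN] := cu _ (mulr_gt0 c0 e0); exists N => m n Nm Nn.
  by rewrite -(ler_pM2l c0); apply: le_trans (cB _) (hN _ _ Nm Nn).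
exists l => e e0; have [N hN] := ul _ (divr_gt0 e0 C0); exists N => n Nn.
by apply: le_trans (CB _) _; rewrite mulrC -ler_pdivlMr//; exact: hN.
Qed.

Lemma equivalent_adherent (B' : semi_inner V) (C : R) M x : 0 < C ->
  (forall x, B' x x <= C * B x x) -> adherent B M x -> adherent B' M x.
Proof.
move=> C0 CB Mx e e0; have [m Mm xm] := Mx _ (divr_gt0 e0 C0); exists m => //.
by apply: le_trans (CB _) _; rewrite mulrC -ler_pdivlMr.
Qed.

End riesz.

Section pair.
Variables (R : realType) (V1 V2 : lmodType R) (B1 : semi_inner V1) (B2 : semi_inner V2).
Local Notation V := (V1 * V2)%type.

Definition pair_ip (x y : V) := B1 x.1 y.1 + B2 x.2 y.2.

Let pC x y : pair_ip x y = pair_ip y x.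
Proof. by rewrite /pair_ip sipC [B2 _ _]sipC. Qed.
Let pDl x y z : pair_ip (x + y) z = pair_ip x z + pair_ip y z.
Proof. by rewrite /pair_ip/= !sipDl addrACA. Qed.
Let pZl a x z : pair_ip (a *: x) z = a * pair_ip x z.
Proof. by rewrite /pair_ip/= !sipZl mulrDr. Qed.
Let p_ge0 x : 0 <= pair_ip x x.
Proof. by rewrite addr_ge0 ?sip_ge0. Qed.

Definition pair_inner : semi_inner V := SemiInner pC pDl pZl p_ge0.

Lemma pair_complete : complete_for B1 -> complete_for B2 -> complete_for pair_inner.
Proof.
move=> c1 c2 u cu.
have [|l1 h1] := c1 (fun n => (u n).1).
  move=> e /cu[N hN]; exists N => m n Nm Nn.
  by apply: le_trans (hN _ _ Nm Nn); rewrite /= /pair_ip/= lerDl sip_ge0.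
have [|l2 h2] := c2 (fun n => (u n).2).
  move=> e /cu[N hN]; exists N => m n Nm Nn.
  by apply: le_trans (hN _ _ Nm Nn); rewrite /= /pair_ip/= lerDr sip_ge0.
exists (l1, l2) => e e0.
have [N1 hN1] := h1 _ (divr_gt0 e0 (ltr0n R 2)).
have [N2 hN2] := h2 _ (divr_gt0 e0 (ltr0n R 2)).
exists (maxn N1 N2) => n; rewrite geq_max => /andP[n1 n2].
rewrite [leRHS](splitr e); exact: lerD (hN1 _ n1) (hN2 _ n2).
Qed.

End pair.

Section ffun.
Variables (R : realType) (V : lmodType R) (B : semi_inner V) (d : nat).
Local Notation F := {ffun 'I_d -> V}.

Definition ffun_ip (x y : F) := \sum_(i < d) B (x i) (y i).

Let pC x y : ffun_ip x y = ffun_ip y x.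
Proof. by apply: eq_bigr => i _; rewrite sipC. Qed.
Let pDl x y z : ffun_ip (x + y) z = ffun_ip x z + ffun_ip y z.
Proof. by rewrite /ffun_ip -big_split; apply: eq_bigr => i _; rewrite ffunE sipDl. Qed.
Let pZl a x z : ffun_ip (a *: x) z = a * ffun_ip x z.
Proof. by rewrite /ffun_ip mulr_sumr; apply: eq_bigr => i _; rewrite ffunE sipZl. Qed.
Let p_ge0 x : 0 <= ffun_ip x x.
Proof. by apply: sumr_ge0 => i _; exact: sip_ge0. Qed.

Definition ffun_inner : semi_inner F := SemiInner pC pDl pZl p_ge0.

Lemma ffun_complete : complete_for B -> complete_for ffun_inner.
Proof.
move=> cpl u cu.
have coord (x : F) i : B (x i) (x i) <= ffun_inner x x.
  by rewrite /= /ffun_ip (bigD1 i)//= lerDl sumr_ge0// => j _; exact: sip_ge0.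
have /choice[l hl] : forall i, exists l, cvg_for B (fun n => u n i) l.
  move=> i; apply: cpl => e /cu[N hN]; exists N => m n Nm Nn.
  apply: le_trans (hN _ _ Nm Nn); apply: le_trans (coord _ i).
  by rewrite !ffunE.
exists [ffun i => l i] => e e0.
have e'0 : 0 < e / d.+1%:R by rewrite divr_gt0.
have /choice[N hN] : forall i, exists N, forall n, (N <= n)%N ->
    B (u n i - l i) (u n i - l i) <= e / d.+1%:R by move=> i; exact: hl.
exists (\max_i N i)%N => n hn.
rewrite /= /ffun_ip; apply: (@le_trans _ _ (\sum_(i < d) (e / d.+1%:R))).
  apply: ler_sum => i _; rewrite !ffunE; apply: hN; apply: leq_trans hn.
  exact: leq_bigmax.
rewrite sumr_const card_ord -[_ *+ d]mulr_natl mulrCA ler_piMr ?(ltW e0)//.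
by rewrite ler_pdivrMr ?mul1r// ler_nat.
Qed.

End ffun.

(** * Multiplication by bounded functions *)

Section essentially_bounded.
Context d (T : measurableType d) (R : realType).
Variables (mu : {measure set T -> \bar R}) (O : set T) (mO : measurable O).
Implicit Types m f : T -> R.

Definition ess_bounded m := measurable_fun O m /\
  exists M : R, {ae mu, forall x, O x -> `|m x| <= M}.

Lemma sqint_mul m f : ess_bounded m -> sqint mu O f -> sqint mu O (fun x => m x * f x).
Proof.
move=> [mm [M hM]] [mf /integrableP[_ f2]]; split; first exact: measurable_funM.
have mmf : measurable_fun O (EFin \o (fun x => (m x * f x) ^+ 2)).
  by apply/measurable_EFinP/measurable_funX/measurable_funM.
apply/integrableP; split => //.
apply: (@le_lt_trans _ _ (\int[mu]_(x in O) ((M ^+ 2)%:E * (f x ^+ 2)%:E))%E).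
  apply: ae_ge0_le_integral => //.
  - exact: measurableT_comp.
  - by move=> x _; rewrite -EFinM lee_fin mulr_ge0 ?sqr_ge0.
  - apply/measurable_EFinP/measurable_funM => //; exact: measurable_funX.
  - apply: (filterS _ hM) => x hx Ox /=; rewrite lee_fin ger0_norm ?sqr_ge0//.
    rewrite exprMn ler_wpM2r ?sqr_ge0// -(real_normK (num_real (m x))).
    by rewrite lerXn2r ?nnegrE ?hx// (le_trans _ (hx Ox)).
rewrite ge0_integralZl_EFin ?sqr_ge0//; last 2 first.
- by move=> x _; rewrite lee_fin sqr_ge0.
- by apply/measurable_EFinP; exact: measurable_funX.
have f2' : (\int[mu]_(x in O) (f x ^+ 2)%:E < +oo)%E.
  by move: f2; under eq_integral do rewrite /= ger0_norm ?sqr_ge0//.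
by rewrite lte_mul_pinfty// lee_fin sqr_ge0.
Qed.

Definition mul_sqfun m (hm : ess_bounded m) (f : sqfun mu mO) : sqfun mu mO :=
  mk_sqfun mO (sqint_mul hm (sqfunP f)).

Lemma mul_sqfunC m (hm : ess_bounded m) (f g : sqfun mu mO) :
  sq_ip (mul_sqfun hm f) g = sq_ip f (mul_sqfun hm g).
Proof. by apply: eq_Rintegral => x _ /=; ring. Qed.

Lemma sq_ip_integrable (f g : sqfun mu mO) : mu.-integrable O (EFin \o (fun x => f x * g x)).
Proof. exact: (sqintM mO (sqfunP f) (sqfunP g)). Qed.

Lemma ae_le_Rintegral (f g : T -> R) : mu.-integrable O (EFin \o f) ->
  mu.-integrable O (EFin \o g) -> {ae mu, forall x, O x -> f x <= g x} ->
  \int[mu]_(x in O) f x <= \int[mu]_(x in O) g x.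
Proof.
move=> fi gi fg; rewrite -subr_ge0 -RintegralB//.
have igf : mu.-integrable O (EFin \o (fun x => g x - f x)).
  by have := integrableB mO gi fi; apply: eq_integrable.
have -> : \int[mu]_(x in O) (g x - f x) = \int[mu]_(x in O) `|g x - f x|.
  rewrite /Rintegral; congr fine; apply: ae_eq_integral => //.
  - exact: measurable_int igf.
  - apply/measurable_EFinP; apply: measurableT_comp => //.
    by apply/measurable_EFinP; exact: measurable_int igf.
  by apply: (filterS _ fg) => x h Ox; rewrite ger0_norm// subr_ge0 h.
by apply: Rintegral_ge0.
Qed.

End essentially_bounded.

Section lipschitz_measurable.
Variables (R : realType) (n : nat) (O : set 'rV[R]_n) (oO : open O).

(** On an open set a Lipschitz function pulls open intervals back to open sets, and
    on a bounded set it is bounded. *)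
Lemma lipschitz_ess_bounded (mu : {measure set 'rV[R]_n -> \bar R}) (f : 'rV[R]_n -> R^o) :
  bounded_set O -> [lipschitz f x | x in O] -> ess_bounded mu O (f : 'rV[R]_n -> R).
Proof.
move=> [b [_ bO]] /pinfty_ex_gt0[k k0 hk].
have lip x y : O x -> O y -> `|f x - f y| <= k * `|x - y|.
  by move=> Ox Oy; exact: (hk (x, y)).
have {}bO x : O x -> `|x| <= `|b| + 1.
  by apply: bO; rewrite (le_lt_trans (ler_norm _))// ltrDl.
split; last first.
  have [[x0 O0]|O0] := pselect (exists x, O x); last first.
    by exists 0; apply: aeW => x Ox; case: O0; exists x.
  exists (`|f x0| + k * (`|b| + 1 + (`|b| + 1))); apply: aeW => x Ox.
  rewrite -(subrK (f x0) (f x)) addrC; apply: le_trans (ler_normD _ _) _.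
  rewrite lerD2l; apply: le_trans (lip _ _ Ox O0) _; rewrite ler_pM2l//.
  by apply: le_trans (ler_normB _ _) _; rewrite lerD// bO.
move=> mO; apply: (measurability _ (RGenOpens.measurableE R)) => //.
move=> _ [B [u [v ->]] <-]; apply: open_rV_measurable.
rewrite openE => x [Ox /= fx]; apply/nbhs_ballP.
have [e1 /= e10 he1] := (nbhs_ballP x O).1 (open_nbhs_nbhs (conj oO Ox)).
move: fx; rewrite in_itv/= => /andP[uf fv].
pose e2 := Num.min (f x - u) (v - f x) / k.
have e20 : 0 < e2 by rewrite divr_gt0// lt_min !subr_gt0 uf fv.
exists (Num.min e1 e2); first by rewrite /= lt_min e10 e20.
move=> y; rewrite -ball_normE/= => xy.
have Oy : O y.
  by apply: he1; rewrite -ball_normE/=; apply: lt_le_trans xy _; rewrite ge_min lexx.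
split => //=; rewrite in_itv/=.
have : `|f x - f y| < Num.min (f x - u) (v - f x).
  apply: le_lt_trans (lip _ _ Ox Oy) _; rewrite mulrC -ltr_pdivlMr//.
  by apply: lt_le_trans xy _; rewrite ge_min lexx orbT.
by rewrite lt_min !ltr_norml; lra.
Qed.

End lipschitz_measurable.

(** * Test functions and integration by parts *)

Section real_test_functions.
Variables (R : realType) (d : nat) (Omega : set 'rV[R]_d).
Implicit Types f g : 'rV[R]_d -> R.

Lemma smooth_C1 f : smooth f -> C1 f.
Proof.
move=> sf; split; first by move=> x; exact: differentiable_continuous (sf [::] x).
move=> i; split; first by move=> x; apply: diff_derivable; exact: (sf [::] x).
by move=> x; exact: differentiable_continuous (sf [:: i] x).
Qed.

Lemma smoothD f g : smooth f -> smooth g -> smooth (f \+ g).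
Proof.
move=> sf sg s x.
have -> : foldr (@pderiv R d) (f \+ g) s = foldr (@pderiv R d) f s \+ foldr (@pderiv R d) g s.
  elim: s => //= i s ->; apply/funext => y; rewrite /pderiv deriveD//.
    by apply: diff_derivable; exact: sf.
  by apply: diff_derivable; exact: sg.
by apply: differentiableD; [exact: sf|exact: sg].
Qed.

Lemma smoothZ (a : R) f : smooth f -> smooth (fun x => a * f x).
Proof.
move=> sf s x.
have -> : foldr (@pderiv R d) (fun x => a * f x) s = a \*: foldr (@pderiv R d) f s.
  elim: s => //= i s ->; apply/funext => y; rewrite /pderiv deriveZ//.
  by apply: diff_derivable; exact: sf.
by apply: differentiableZ; exact: sf.
Qed.

Lemma smooth0 : smooth (fun _ : 'rV[R]_d => 0).
Proof.
move=> s x; suff -> : foldr (@pderiv R d) (fun=> 0) s = cst 0 by exact: differentiable_cst.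
by elim: s => //= i s ->; apply/funext => y; rewrite /pderiv derive_cst.
Qed.

(** Real test functions: exactly the real and imaginary parts of the complex ones. *)
Definition rtest f := [/\ smooth f, compact (closure [set x | f x != 0]) &
  closure [set x | f x != 0] `<=` Omega].

Lemma compact_support_sub (A B : set 'rV[R]_d) : compact (closure B) -> A `<=` B ->
  compact (closure A).
Proof.
move=> cB AB; apply: subclosed_compact cB _; first exact: closed_closure.
exact: closure_subset.
Qed.

Lemma rtest0 : rtest (fun=> 0).
Proof.
have E : closure [set x | (fun _ : 'rV[R]_d => 0 : R) x != 0] = set0.
  by rewrite (_ : mkset _ = set0) ?closure0//; apply/seteqP; split => x //=; rewrite eqxx.
by split; rewrite ?E; [exact: smooth0|exact: compact0|].
Qed.

Lemma rtestD f g : rtest f -> rtest g -> rtest (f \+ g).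
Proof.
move=> [sf cf fO] [sg cg gO].
have sub : closure [set x | (f \+ g) x != 0] `<=`
    closure [set x | f x != 0] `|` closure [set x | g x != 0].
  rewrite -closureU; apply: closure_subset => x /=; apply: contraNP.
  by move=> /not_orP[/negP/negPn/eqP-> /negP/negPn/eqP->]; rewrite addr0.
split; first exact: smoothD.
- apply: subclosed_compact (compactU cf cg) sub; exact: closed_closure.
- by move=> x /sub[/fO|/gO].
Qed.

Lemma rtestZ a f : rtest f -> rtest (fun x => a * f x).
Proof.
move=> [sf cf fO].
have sub : closure [set x | a * f x != 0] `<=` closure [set x | f x != 0].
  by apply: closure_subset => x /=; apply: contraNN => /eqP->; rewrite mulr0.
split; first exact: smoothZ.
- apply: subclosed_compact cf sub; exact: closed_closure.
- by move=> x /sub/fO.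
Qed.

Lemma pderivD f g i : C1 f -> C1 g -> pderiv i (f \+ g) = pderiv i f \+ pderiv i g.
Proof.
move=> [_ df] [_ dg]; apply/funext => y; rewrite /pderiv deriveD//.
  by case: (df i).
by case: (dg i).
Qed.

Lemma pderivZ a f i : C1 f -> pderiv i (fun x => a * f x) = (fun x => a * pderiv i f x).
Proof. by move=> [_ df]; apply/funext => y; rewrite /pderiv deriveZ//; case: (df i). Qed.

Lemma pderivM f g i : C1 f -> C1 g ->
  pderiv i (fun x => f x * g x) = (fun x => f x * pderiv i g x + g x * pderiv i f x).
Proof.
move=> [_ df] [_ dg]; apply/funext => y; rewrite /pderiv deriveM//.
  by case: (df i).
by case: (dg i).
Qed.

Lemma C1M f g : C1 f -> C1 g -> C1 (fun x => f x * g x).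
Proof.
move=> Cf Cg; have [cf df] := Cf; have [cg dg] := Cg; split.
  by move=> x; exact: (cvgM (cf x) (cg x)).
move=> i; split.
  by move=> x; apply: derivableM; [case: (df i)|case: (dg i)].
rewrite pderivM// => x; have [_ c1] := df i; have [_ c2] := dg i.
exact: (cvgD (cvgM (cf x) (c2 x)) (cvgM (cg x) (c1 x))).
Qed.

Lemma rtest_out f x : rtest f -> ~ Omega x -> f x = 0.
Proof.
move=> [_ _ fO] Ox; apply/eqP/negP => /negP fx; apply: Ox; apply: fO.
exact: subset_closure.
Qed.

Lemma rtest_C1 f : rtest f -> C1 f.
Proof. by case=> /smooth_C1. Qed.

Hypothesis bO : bounded_set Omega.

Lemma bounded_sub_box : exists2 M : R, 0 < M & forall x, Omega x -> forall i, `|x ord0 i| < M.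
Proof.
have [b [_ hb]] := bO; exists (`|b| + 2); first by rewrite ltr_wpDl.
move=> x Ox i; have h : `|x| <= `|b| + 1.
  by apply: hb => //; rewrite (le_lt_trans (ler_norm _))// ltrDl.
have : ball (0 : 'rV[R]_d) (`|b| + 2) x.
  by rewrite -ball_normE/= sub0r normrN; apply: le_lt_trans h _; rewrite ltrD2l ltr1n.
by move=> /rV_ballE; rewrite ltr_wpDl// => /(_ isT i); rewrite mxE sub0r normrN.
Qed.

Hypothesis oO : open Omega.
Local Notation mu := (lebesgue_rV R d).
Let mO : measurable Omega := open_rV_measurable oO.

Lemma Omega_fin : (mu Omega < +oo)%E.
Proof.
have [M M0 hM] := bounded_sub_box.
apply: le_lt_trans (box_fin d M); apply: le_measure; rewrite ?inE//.
  exact: measurable_box.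
by move=> x /hM h i; have := h i; rewrite ltr_norml => /andP[/ltW-> ->].
Qed.

Lemma continuous_sqint f : continuous f -> sqint mu Omega f.
Proof.
move=> cf; have mf := continuous_rV_measurable cf.
have [M M0 hM] := bounded_sub_box; have [K K0 hK] := bounded_on_box M cf.
split; first exact: measurable_funTS.
apply: (integrable_bounded_sqr mO Omega_fin (K := K)); first exact: measurable_funTS.
move=> x /hM h; apply: hK => i; have := h i.
by rewrite ltr_norml => /andP[/ltW-> ->].
Qed.

Lemma integral_box_Omega (g : 'rV[R]_d -> R) M : (forall x, ~ Omega x -> g x = 0) ->
  (forall x, Omega x -> forall i, `|x ord0 i| < M) ->
  \int[mu]_(x in box M) g x = \int[mu]_(x in Omega) g x.
Proof.
move=> g0 hM; rewrite Rintegral_mkcond [RHS]Rintegral_mkcond; congr (Rintegral _ _ _).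
apply/funext => x; rewrite !patchE; have [Ox|nOx] := pselect (Omega x).
  rewrite !mem_set//= => i; have := hM _ Ox i.
  by rewrite ltr_norml => /andP[/ltW-> ->].
by rewrite g0//; do 2 case: ifP.
Qed.

(** The product f g is continuously differentiable and vanishes outside Omega, so its
    derivatives have integral zero over a box containing Omega. *)
Lemma rtest_by_parts f g i : rtest f -> rtest g ->
  \int[mu]_(x in Omega) (f x * pderiv i g x) = - \int[mu]_(x in Omega) (pderiv i f x * g x).
Proof.
move=> tf tg; have Cf := rtest_C1 tf; have Cg := rtest_C1 tg.
have [M M0 hM] := bounded_sub_box.
have sf := continuous_sqint Cf.1; have sg := continuous_sqint Cg.1.
have sdf := continuous_sqint (Cf.2 i).2; have sdg := continuous_sqint (Cg.2 i).2.
apply/eqP; rewrite -subr_eq0 opprK -RintegralD//; last 2 first.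
- exact: (sqintM mO sf sdg).
- exact: (sqintM mO sdf sg).
have h0 x : f x * g x != 0 -> forall j, `|x ord0 j| < M.
  move=> fg j; apply: hM; apply: contrapT => nO; move: fg.
  by rewrite (rtest_out tf nO) mul0r eqxx.
have := integral_pderiv_eq0 (C1M Cf Cg) M0 h0 i; rewrite pderivM// => <-.
apply/eqP; rewrite integral_box_Omega//; first by apply: eq_Rintegral => x _; ring.
by move=> x nO; rewrite (rtest_out tf nO) (rtest_out tg nO) !mul0r addr0.
Qed.

End real_test_functions.

(** * The weak Dirichlet problem for real functions *)

Section real_operator.
Variables (R : realType) (d : nat) (Omega : set 'rV[R]_d).
Hypotheses (oO : open Omega) (bO : bounded_set Omega).
Local Notation mu := (lebesgue_rV R d).
Local Notation mO := (open_rV_measurable oO).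
Local Notation W := (sqfun mu mO).
Local Notation IP := (sq_inner mu mO).
Local Notation K := (W * {ffun 'I_d -> W})%type.

Let measurable_Omega : measurable Omega := mO.

(** A function of H^1 is paired with its gradient, so that the H^1 norm is the norm
    of a product of L^2 spaces. *)
Definition h1_inner : semi_inner K := pair_inner IP (ffun_inner IP d).
Local Notation Std := h1_inner.

Lemma h1_complete : complete_for Std.
Proof.
by apply: pair_complete; [exact: sq_complete|apply: ffun_complete; exact: sq_complete].
Qed.

Definition grad_pairs : set K := [set p : K | exists psi, [/\ rtest Omega psi,
  p.1 = psi :> ('rV[R]_d -> R) & forall i, p.2 i = pderiv i psi :> ('rV[R]_d -> R)]].

Definition test_pair f (tf : rtest Omega f) : K :=
  (mk_sqfun mO (continuous_sqint bO oO (rtest_C1 tf).1),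
   [ffun i => mk_sqfun mO (continuous_sqint bO oO ((rtest_C1 tf).2 i).2)]).

Lemma test_pairP f (tf : rtest Omega f) : grad_pairs (test_pair tf).
Proof. by exists f; split => // i; rewrite /= ffunE. Qed.

Lemma grad_pairs_subspace : subspace grad_pairs.
Proof.
split.
- exists (fun=> 0); split => //; first exact: rtest0.
  move=> i; rewrite ffunE; apply/funext => x; rewrite /pderiv (_ : (fun=> 0) = cst 0)//.
  by rewrite derive_cst.
- move=> p q [f [tf pf df]] [g [tg qg dg]]; exists (f \+ g); split.
  + exact: rtestD.
  + have E : (p + q).1 = p.1 + q.1 by [].
    by apply/funext => x; rewrite E sqfunDE pf qg.
  + move=> i; rewrite (pderivD _ (rtest_C1 tf) (rtest_C1 tg)); apply/funext => x.
    by rewrite ffunE sqfunDE df dg.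
- move=> a p [f [tf pf df]]; exists (fun x => a * f x); split.
  + exact: rtestZ.
  + have E : (a *: p).1 = a *: p.1 by [].
    by apply/funext => x; rewrite E sqfunZE pf.
  + move=> i; rewrite (pderivZ _ _ (rtest_C1 tf)); apply/funext => x.
    by rewrite ffunE sqfunZE df.
Qed.

(** H^1_0 as the closure of the graph of the gradient on test functions: its elements
    carry their weak gradient as second component. *)
Definition h10 : set K := adherent Std grad_pairs.

(** For a fixed g both sides are products with fixed vectors, gathered in q. Test
    functions are orthogonal to q by rtest_by_parts, hence so is their closure. *)
Lemma h10_by_parts (p : K) (g : 'rV[R]_d -> R) i : h10 p -> rtest Omega g ->
  \int[mu]_(x in Omega) (p.1 x * pderiv i g x) =
  - \int[mu]_(x in Omega) (p.2 i x * g x).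
Proof.
move=> hp tg.
pose q : K := ((test_pair tg).2 i, [ffun j => if j == i then (test_pair tg).1 else 0]).
have qE (r : K) : Std q r = sq_ip r.1 ((test_pair tg).2 i) + sq_ip (r.2 i) (test_pair tg).1.
  rewrite /= /pair_ip /= sq_ipC; congr (_ + _).
  rewrite /ffun_ip (bigD1 i)//= ffunE eqxx sq_ipC big1 ?addr0// => j ji.
  by rewrite ffunE (negbTE ji); exact: (sip0l IP).
have : orth Std grad_pairs q.
  move=> m [f [tf mf df]]; rewrite qE /sq_ip ffunE mf df /=.
  by rewrite (rtest_by_parts bO oO i tf tg) addNr.
move=> /orth_adherent/(_ hp); rewrite qE /sq_ip ffunE /= => /eqP.
by rewrite addr_eq0 => /eqP.
Qed.

Variables (V : 'rV[R]_d -> R) (V_inf : ess_bounded mu Omega V).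
Hypothesis V_ge0 : {ae mu, forall x, Omega x -> 0 <= V x}.
Variable A : 'rV[R]_d -> 'M[R]_d.
Hypothesis A_sym : forall x, Omega x -> (A x)^T = A x.
Variables (c C : R).
Hypotheses (c_gt0 : 0 < c) (C_gt0 : 0 < C).
Hypothesis A_ell : {ae mu, forall x, Omega x -> forall v : 'cV[R]_d,
     c * (v^T *m v) ord0 ord0 <= (v^T *m A x *m v) ord0 ord0 /\
     (v^T *m A x *m v) ord0 ord0 <= C * (v^T *m v) ord0 ord0}.
Hypothesis A_inf : forall i j, ess_bounded mu Omega (fun x => A x i j).

Definition grad_form (p q : {ffun 'I_d -> W}) : R :=
  \sum_i \sum_j sq_ip (mul_sqfun (A_inf i j) (p j)) (q i).

(** The form of L + 1. The shift makes it coercive on H^1 without an appeal to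
    Poincare's inequality, and makes (L + 1)^-1 a bounded operator. *)
Definition form (p q : K) : R :=
  grad_form p.2 q.2 + (sq_ip (mul_sqfun V_inf p.1) q.1 + sq_ip p.1 q.1).

Let formC p q : form p q = form q p.
Proof.
rewrite /form /grad_form exchange_big /=; congr (_ + (_ + _)); last exact: sq_ipC.
  apply: eq_bigr => i _; apply: eq_bigr => j _; apply: eq_Rintegral => x /set_mem Ox /=.
  have -> : A x j i = A x i j by rewrite -{1}(A_sym Ox) mxE.
  by ring.
by rewrite mul_sqfunC sq_ipC.
Qed.

Let formDl p q r : form (p + q) r = form p r + form q r.
Proof.
rewrite /form /= sq_ipDl !(mul_sqfunC V_inf) sq_ipDl.
have -> : grad_form (p.2 + q.2) r.2 = grad_form p.2 r.2 + grad_form q.2 r.2.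
  rewrite /grad_form -big_split; apply: eq_bigr => i _; rewrite -big_split.
  by apply: eq_bigr => j _; rewrite !mul_sqfunC ffunE sq_ipDl.
ring.
Qed.

Let formZl a p r : form (a *: p) r = a * form p r.
Proof.
rewrite /form /= sq_ipZl !(mul_sqfunC V_inf) sq_ipZl.
have -> : grad_form (a *: p.2) r.2 = a * grad_form p.2 r.2.
  rewrite /grad_form mulr_sumr; apply: eq_bigr => i _; rewrite mulr_sumr.
  by apply: eq_bigr => j _; rewrite !mul_sqfunC ffunE sq_ipZl.
ring.
Qed.

(** Ellipticity at the vector of the values of the gradient, integrated. *)
Lemma grad_form_bounds (p : {ffun 'I_d -> W}) :
  c * \sum_i sq_ip (p i) (p i) <= grad_form p p /\
  grad_form p p <= C * \sum_i sq_ip (p i) (p i).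
Proof.
pose v x : 'cV[R]_d := \col_i p i x.
have vv x : ((v x)^T *m v x) ord0 ord0 = \sum_i p i x * p i x.
  by rewrite mxE; apply: eq_bigr => i _; rewrite !mxE.
have vAv x : ((v x)^T *m A x *m v x) ord0 ord0 =
    \sum_i \sum_j (A x i j * p j x) * p i x.
  rewrite mxE exchange_big /=; apply: eq_bigr => j _; rewrite !mxE mulr_suml.
  by apply: eq_bigr => i _; rewrite !mxE; ring.
have [i1 e1] := Rintegral_sum (index_enum 'I_d) mO (fun i => sq_ip_integrable (p i) (p i)).
have [i2 e2] := Rintegral_sum (index_enum 'I_d) mO (fun i =>
  (Rintegral_sum (index_enum 'I_d) mO
    (fun j => sq_ip_integrable (mul_sqfun (A_inf i j) (p j)) (p i))).1).
have gE : grad_form p p = \int[mu]_(x in Omega) (\sum_i \sum_j (A x i j * p j x) * p i x).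
  rewrite e2; apply: eq_bigr => i _.
  by rewrite (Rintegral_sum _ mO (fun j => sq_ip_integrable (mul_sqfun (A_inf i j) (p j)) (p i))).2.
have cE (k : R) : k * \sum_i sq_ip (p i) (p i) =
    \int[mu]_(x in Omega) (k * \sum_i p i x * p i x).
  by rewrite RintegralZl//; congr (_ * _); exact: esym e1.
have ik (k : R) : mu.-integrable Omega (EFin \o (fun x => k * \sum_i p i x * p i x)).
  by have := integrableZl mO k i1; apply: eq_integrable.
rewrite !cE gE; split; apply: (ae_le_Rintegral mO) => //;
  apply: (filterS _ A_ell) => x h Ox; have [] := h Ox (v x); by rewrite vv vAv.
Qed.

Lemma pot_ge0 (u : W) : 0 <= sq_ip (mul_sqfun V_inf u) u.
Proof.
have -> : 0 = \int[mu]_(x in Omega) (0 : R) by rewrite Rintegral_cst// mul0r.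
apply: (ae_le_Rintegral mO); first exact: integrable0.
  exact: sq_ip_integrable.
apply: (filterS _ V_ge0) => x h Ox /=.
by rewrite -mulrA mulr_ge0 ?h// -expr2 sqr_ge0.
Qed.

Lemma pot_le : exists2 M, 0 <= M & forall u : W, sq_ip (mul_sqfun V_inf u) u <= M * sq_ip u u.
Proof.
have [_ [M hM]] := V_inf; exists `|M| => // u.
rewrite -RintegralZl//; last exact: sq_ip_integrable.
apply: (ae_le_Rintegral mO); first exact: sq_ip_integrable.
  by have := integrableZl mO `|M| (sq_ip_integrable u u); apply: eq_integrable.
apply: (filterS _ hM) => x h Ox /=.
rewrite -mulrA ler_wpM2r//; first by rewrite -expr2 sqr_ge0.
by apply: le_trans (ler_norm _) _; apply: le_trans (h Ox) (ler_norm _).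
Qed.

Lemma form_ge (p : K) : c * \sum_i sq_ip (p.2 i) (p.2 i) + sq_ip p.1 p.1 <= form p p.
Proof.
rewrite /form; have := pot_ge0 p.1; have [+ _] := grad_form_bounds p.2; lra.
Qed.

Let form_ge0 p : 0 <= form p p.
Proof.
apply: le_trans (form_ge p); rewrite addr_ge0 ?sq_ip_ge0// mulr_ge0 ?(ltW c_gt0)//.
by apply: sumr_ge0 => i _; exact: sq_ip_ge0.
Qed.

Definition form_inner : semi_inner K := SemiInner formC formDl formZl form_ge0.
Local Notation B := form_inner.

Lemma form_lower (p : K) : Num.min c 1 * Std p p <= B p p.
Proof.
apply: le_trans (form_ge p); rewrite /= /pair_ip /= /ffun_ip /=.
have s0 : 0 <= \sum_i sq_ip (p.2 i) (p.2 i) by apply: sumr_ge0 => i _; exact: sq_ip_ge0.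
rewrite mulrDr addrC; apply: lerD; first by rewrite ler_wpM2r// ge_min lexx.
by rewrite ler_piMl ?sq_ip_ge0// ge_min lexx orbT.
Qed.

Lemma form_upper : exists2 C', 0 < C' & forall p : K, B p p <= C' * Std p p.
Proof.
have [M M0 hM] := pot_le; exists (C + M + 1); first by rewrite ltr_wpDl// addr_ge0// ltW.
move=> p; rewrite /= /form /pair_ip /= /ffun_ip /=.
have [_ h1] := grad_form_bounds p.2; have h2 := hM p.1.
have s0 : 0 <= \sum_i sq_ip (p.2 i) (p.2 i) by apply: sumr_ge0 => i _; exact: sq_ip_ge0.
have u0 := sq_ip_ge0 p.1.
have h3 := mulr_ge0 M0 s0; have h4 := mulr_ge0 (ltW C_gt0) u0.
lra.
Qed.

Lemma form_complete : complete_for B.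
Proof.
have [C' C'0 hC'] := form_upper.
have m0 : 0 < Num.min c 1 by rewrite lt_min c_gt0 ltr01.
exact: (equivalent_complete m0 C'0 form_lower hC' h1_complete).
Qed.

Lemma h10_form (q : K) : h10 q -> adherent B grad_pairs q.
Proof. by have [C' C'0 hC'] := form_upper; exact: (equivalent_adherent C'0 hC'). Qed.

Lemma adherent_h10 (q : K) : adherent B grad_pairs q -> h10 q.
Proof.
have m0 : 0 < Num.min c 1 by rewrite lt_min c_gt0 ltr01.
apply: (@equivalent_adherent _ _ B Std (Num.min c 1)^-1); first by rewrite invr_gt0.
by move=> x; rewrite mulrC ler_pdivlMr// mulrC; exact: form_lower.
Qed.

Lemma h10B (p q : K) : h10 p -> h10 q -> h10 (p - q).
Proof.
move=> hp hq e e0; have e4 : 0 < e / 4 by rewrite divr_gt0.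
have [m Mm pm] := hp _ e4; have [m' Mm' qm] := hq _ e4; exists (m - m').
  exact: subspaceB grad_pairs_subspace Mm Mm'.
have -> : p - q - (m - m') = (p - m) - (q - m') by rewrite !opprB addrACA [RHS]addrACA [- m - q]addrC.
have h := sip_normB Std (p - m) (q - m').
move: (Std _ _) (Std (p - m) _) (Std (q - m') _) pm qm h => x y z; lra.
Qed.

Lemma riesz_functional (f : W) : exists r : K, forall m : K, B r m = IP f m.1.
Proof.
apply: (riesz (C := IP f f)) form_complete _ _ _.
- by move=> x y; rewrite -sipDr.
- by move=> a x; rewrite -sipZr.
- move=> x; apply: le_trans (sip_CS IP _ _) _; rewrite ler_wpM2l ?sip_ge0//.
  apply: le_trans (form_ge x); rewrite lerDr mulr_ge0 ?(ltW c_gt0)//.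
  by apply: sumr_ge0 => i _; exact: sq_ip_ge0.
Qed.

(** The weak form of the equation (L + 1) p = f. *)
Definition weak_solution (p : K) (f : W) :=
  h10 p /\ forall m, grad_pairs m -> B p m = IP f m.1.

(** Represent the functional on all pairs by Riesz, then project the representative
    onto the closure of the graph of the gradient. *)
Lemma weak_solution_ex (f : W) : exists p, weak_solution p f.
Proof.
have [r hr] := riesz_functional f.
have [p [Mp rp]] := projection form_complete grad_pairs_subspace r.
exists p; split; first exact: adherent_h10.
move=> m Mm; rewrite -hr; apply/eqP; rewrite eq_sym -subr_eq0.
by have := rp _ Mm; rewrite sipDl sipNl => ->.
Qed.

Lemma weak_solution_h10 p f q : weak_solution p f -> h10 q -> B p q = IP f q.1.
Proof.
move=> [hp pf] hq; have [r hr] := riesz_functional f.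
have : orth B grad_pairs (p - r).
  by move=> m Mm; rewrite sipDl sipNl hr pf// subrr.
by move=> /orth_adherent/(_ (h10_form hq)); rewrite sipDl sipNl hr => /eqP; rewrite subr_eq0 => /eqP.
Qed.

Lemma weak_solution_uniq p p' f : weak_solution p f -> weak_solution p' f ->
  Std (p - p') (p - p') = 0.
Proof.
move=> hp hp'; have hB := h10B hp.1 hp'.1.
have B0 : B (p - p') (p - p') = 0.
  by rewrite [LHS]sipDl sipNl (weak_solution_h10 hp hB) (weak_solution_h10 hp' hB) subrr.
have m0 : 0 < Num.min c 1 by rewrite lt_min c_gt0 ltr01.
apply/eqP; rewrite eq_le sip_ge0 andbT -(ler_pM2l m0) mulr0 -B0.
exact: form_lower.
Qed.

Definition sol (f : W) : K := projT1 (cid (weak_solution_ex f)).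
(** The operator (L + 1)^-1 on real functions. *)
Definition resolvent (f : W) : W := (sol f).1.
Local Notation T := resolvent.

Lemma weak_solP f : weak_solution (sol f) f.
Proof. exact: (projT2 (cid (weak_solution_ex f))). Qed.

Lemma resolvent_sym : symmetric_map IP T.
Proof.
move=> f g; rewrite -(weak_solution_h10 (weak_solP f) (weak_solP g).1) sipC [RHS]sipC.
exact: (esym (weak_solution_h10 (weak_solP g) (weak_solP f).1)).
Qed.

(** Test the equation for T f with T f itself. *)
Lemma resolvent_energy f :
  c * \sum_i sq_ip ((sol f).2 i) ((sol f).2 i) <= sq_ip f f.
Proof.
have h1 := form_ge (sol f); have h2 := weak_solution_h10 (weak_solP f) (weak_solP f).1.
have h3 := sip_le_half IP f (T f); have h4 := sip_ge0 IP (T f).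
rewrite -[form _ _]/(B (sol f) (sol f)) h2 in h1; rewrite -/(T f) in h1 h3.
have s0 : 0 <= c * \sum_i sq_ip ((sol f).2 i) ((sol f).2 i).
  by rewrite mulr_ge0 ?(ltW c_gt0)// sumr_ge0// => i _; exact: sq_ip_ge0.
rewrite -[sq_ip (T f) (T f)]/(IP (T f) (T f)) in h1.
by rewrite -[leRHS]/(IP f f); lra.
Qed.

(** For a test function, extend by zero to a box and apply rellich_box; the integrals
    over the sets Q j are products with their indicators. Both sides pass to the
    closure, at the cost of a factor 4 in the constants. *)
Lemma h10_rellich (e : R) : 0 < e -> exists (J : finType) (w : J -> W),
  forall p : K, h10 p ->
  sq_ip p.1 p.1 <= e * \sum_i sq_ip (p.2 i) (p.2 i) + \sum_j (sq_ip (w j) p.1) ^+ 2.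
Proof.
move=> e0; have [M M0 hM] := bounded_sub_box bO.
have e4 : 0 < e / 4 by rewrite divr_gt0.
have [J [Q [C' [C'0 mQ QM hQ]]]] := @rellich_box R d M _ M0 e4.
have sQ j : sqint mu Omega (\1_(Q j)).
  split; first exact: measurable_indic.
  apply: (integrable_bounded_sqr measurable_Omega (Omega_fin bO oO) (K := 1)).
    exact: measurable_indic.
  by move=> x _; rewrite indicE; case: (_ \in _); rewrite ?normr1 ?normr0.
pose w1 j : W := mk_sqfun mO (sQ j).
pose s := Num.sqrt C'; have s2 : s ^+ 2 = C' by rewrite sqr_sqrtr.
exists J, (fun j => (2 * s) *: w1 j).
have hm (m : K) : grad_pairs m -> sq_ip m.1 m.1 <=
    e / 4 * \sum_i sq_ip (m.2 i) (m.2 i) + C' * \sum_j (sq_ip (w1 j) m.1) ^+ 2.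
  move=> [f [tf mf df]]; have := hQ f (rtest_C1 tf).
  rewrite (@integral_box_Omega R d Omega _ M _ hM); last first.
    by move=> x nO; rewrite (rtest_out tf nO) expr0n.
  have -> : \int[mu]_(x in Omega) f x ^+ 2 = sq_ip m.1 m.1.
    by apply: eq_Rintegral => x _; rewrite mf expr2.
  have dz i x : ~ Omega x -> pderiv i f x = 0.
    move=> nO; rewrite /pderiv (_ : 0 = 'D_(delta_mx ord0 i) (cst 0 : 'rV[R]_d -> R) x); last by rewrite derive_cst.
    have [_ _ fO] := tf; have cS := @closed_closure _ [set y | f y != 0].
    have nS : (~` closure [set y | f y != 0]) x by move=> /fO.
    apply: near_eq_derive.
    apply: (filterS _ (open_nbhs_nbhs (conj (closed_openC cS) nS))) => y /= nSy.
    by apply: contrapT => /eqP fy; apply: nSy; exact: subset_closure.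
  have -> : \sum_i \int[mu]_(x in box M) pderiv i f x ^+ 2 = \sum_i sq_ip (m.2 i) (m.2 i).
    apply: eq_bigr => i _; rewrite (@integral_box_Omega R d Omega _ M _ hM).
      by apply: eq_Rintegral => x _; rewrite df expr2.
    by move=> x nO; rewrite dz// expr0n.
  have -> : \sum_j (\int[mu]_(x in Q j) f x) ^+ 2 = \sum_j (sq_ip (w1 j) m.1) ^+ 2.
    apply: eq_bigr => j _; congr (_ ^+ 2).
    rewrite /sq_ip Rintegral_mkcond [RHS]Rintegral_mkcond; congr (Rintegral _ _ _).
    apply/funext => x; rewrite !patchE mf /= indicE.
    have [Ox|nOx] := pselect (Omega x).
      by rewrite [x \in Omega]mem_set//; case: ifP => _; rewrite ?mul1r ?mul0r.
    rewrite (rtest_out tf nOx) mulr0; by do 2 case: ifP.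
  exact.
move=> p hp; apply: (@le_lim _ _ _ (2 + e * 1 + 4 * C' * \sum_j sq_ip (w1 j) (w1 j))) => h h0.
have [m Mm pm] := hp _ h0.
move: pm; rewrite /= /pair_ip /= /ffun_ip; set q := p - m => pm.
have pE : p = m + q by rewrite addrC subrK.
have q1 : sq_ip q.1 q.1 <= h.
  apply: le_trans pm; rewrite lerDl; apply: sumr_ge0 => i _; exact: sq_ip_ge0.
have q2 : \sum_i sq_ip (q.2 i) (q.2 i) <= h.
  by apply: le_trans pm; rewrite lerDr sq_ip_ge0.
have k1 : sq_ip p.1 p.1 <= 2 * sq_ip m.1 m.1 + 2 * sq_ip q.1 q.1.
  by rewrite pE; exact: (sip_normD IP m.1 q.1).
have k2 : \sum_i sq_ip (m.2 i) (m.2 i) <=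
    2 * \sum_i sq_ip (p.2 i) (p.2 i) + 2 * \sum_i sq_ip (q.2 i) (q.2 i).
  rewrite !mulr_sumr -big_split; apply: ler_sum => i _ /=.
  have -> : m.2 i = p.2 i - q.2 i by rewrite /q !ffunE opprB addrC subrK.
  exact: (sip_normB IP).
have k3 : \sum_j (sq_ip (w1 j) m.1) ^+ 2 <=
    2 * \sum_j (sq_ip (w1 j) p.1) ^+ 2 + 2 * h * \sum_j sq_ip (w1 j) (w1 j).
  rewrite !mulr_sumr -big_split; apply: ler_sum => j _ /=.
  have -> : sq_ip (w1 j) m.1 = sq_ip (w1 j) p.1 - sq_ip (w1 j) q.1.
    by rewrite -(sipNr IP) -(sipDr IP) /q /= opprB addrC subrK.
  have := sip_CS IP (w1 j) q.1; have := sq_ip_ge0 (w1 j).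
  rewrite -[IP (w1 j) q.1]/(sq_ip _ _) -[IP (w1 j) (w1 j)]/(sq_ip _ _) -[IP q.1 q.1]/(sq_ip _ _).
  move: (sq_ip (w1 j) p.1) (sq_ip (w1 j) q.1) (sq_ip (w1 j) (w1 j)) => a b z z0 bz.
  have : b ^+ 2 <= h * z by apply: le_trans bz _; rewrite mulrC ler_wpM2r.
  have := sqr_ge0 (a + b); nra.
have k4 := hm _ Mm.
have -> : \sum_j sq_ip ((2 * s) *: w1 j) p.1 ^+ 2 = 4 * C' * \sum_j (sq_ip (w1 j) p.1) ^+ 2.
  by rewrite mulr_sumr; apply: eq_bigr => j _; rewrite sq_ipZl exprMn exprMn s2; ring.
have Z0 : 0 <= \sum_j sq_ip (w1 j) (w1 j) by apply: sumr_ge0 => j _; exact: sq_ip_ge0.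
have k5 := ler_wpM2l (ltW e4) k2; have k6 := ler_wpM2l C'0 k3.
have k7 := ler_wpM2l (ltW e4) q2.
move: k1 k4 k5 k6 k7 q1 q2; clear; move: (sq_ip p.1 _) (sq_ip m.1 _) (sq_ip q.1 _).
move: (\sum_i _) (\sum_i _) (\sum_i _) (\sum_i _) (\sum_i _) (\sum_i _) => g1 g2 g3 g4 g5 g6.
move=> z1 z2 z3; lra.
Qed.

(** In h10_rellich the gradient term is absorbed by the energy estimate, and symmetry
    turns a functional of T f into a functional of f. *)
Lemma resolvent_compact : compact_map IP T.
Proof.
move=> e e0; have [J [w hw]] := h10_rellich (mulr_gt0 e0 c_gt0).
exists #|J|, (fun k => T (w (enum_val k))) => f.
apply: le_trans (hw _ (weak_solP f).1) _; apply: lerD.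
  by rewrite -mulrA ler_pM2l//; exact: resolvent_energy.
rewrite (reindex_onto (@enum_val J predT) enum_rank)/=; last by move=> j _; rewrite enum_rankK.
rewrite (eq_bigl xpredT); last by move=> j; rewrite enum_valK eqxx.
apply: ler_sum => k _; rewrite le_eqVlt; apply/orP; left; apply/eqP; congr (_ ^+ 2).
exact: (esym (resolvent_sym _ _)).
Qed.

End real_operator.

Local Open Scope complex_scope.

(** * Complex functions as pairs of real functions *)

Section complex_parts.
Variable R : realType.

Lemma complex_sum (I : finType) (F G : I -> R) :
  \sum_i (F i +i* G i) = (\sum_i F i) +i* (\sum_i G i).
Proof. by elim/big_rec3: _ => // i x y z _ ->. Qed.

Lemma normc_sqr (z : R[i]) : Normc.normc z ^+ 2 = complex.Re z ^+ 2 + complex.Im z ^+ 2.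
Proof. by case: z => a b /=; rewrite sqr_sqrtr// addr_ge0 ?sqr_ge0. Qed.

End complex_parts.

Section complex_L2.
Variables (R : realType) (d : nat) (Omega : set 'rV[R]_d) (oO : open Omega).
Local Notation mu := (lebesgue_rV R d).
Local Notation mO := (open_rV_measurable oO).
Local Notation W := (sqfun mu mO).
Local Notation IP := (sq_inner mu mO).
Local Notation E := 'rV[R]_d.
Local Notation C := R[i].
Let measurable_Omega : measurable Omega := mO.

(** Complex functions are pairs of real functions. The inner product of pairs is the
    real part of the hermitian product; multiplication by i is the map Jmul below,
    so that the imaginary part is recovered as a product with Jmul. *)
Definition complex_L2 : lmodType R := (W * W)%type.
Local Notation VV := complex_L2.
Definition complex_inner : semi_inner VV := pair_inner IP IP.
Local Notation IP2 := complex_inner.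

Lemma complex_complete : complete_for IP2.
Proof. by apply: pair_complete; exact: sq_complete. Qed.

Definition cplx (u : VV) : E -> C := fun x => (u.1 x) +i* (u.2 x).

Lemma L2P (u : E -> C) : L2 Omega u <->
  sqint mu Omega (fun x => complex.Re (u x)) /\ sqint mu Omega (fun x => complex.Im (u x)).
Proof.
split => [[[mr mi] u2]|[[mr ir] [mi ii]]].
  have iu : mu.-integrable Omega (EFin \o (fun x => Normc.normc (u x) ^+ 2)).
    apply/integrableP; split.
      apply/measurable_EFinP; under eq_fun do rewrite normc_sqr.
      by apply: measurable_funD; exact: measurable_funX.
    by under eq_integral do rewrite /= ger0_norm ?sqr_ge0//.
  split; apply: (sqint_le mO _ _ iu) => // x _; rewrite normc_sqr.
    by rewrite lerDl sqr_ge0.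
  by rewrite lerDr sqr_ge0.
split => //; under eq_integral do rewrite normc_sqr EFinD.
have := integrable_lty mO (integrableD mO ir ii).
by [].
Qed.

Lemma L2_cplx u : L2 Omega u -> exists v : VV, u = cplx v.
Proof.
move=> /L2P[s1 s2]; exists (mk_sqfun mO s1, mk_sqfun mO s2).
by apply/funext => x; rewrite /cplx/=; case: (u x).
Qed.

Lemma cplx_L2 (v : VV) : L2 Omega (cplx v).
Proof. by apply/L2P; split; exact: sqfunP. Qed.

Lemma L2norm_cplx (v : VV) : L2norm Omega (cplx v) = Num.sqrt (IP2 v v).
Proof.
rewrite /L2norm; congr Num.sqrt.
rewrite (eq_Rintegral _ (g := fun x => v.1 x * v.1 x + v.2 x * v.2 x)); last first.
  by move=> x _; rewrite normc_sqr -!expr2.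
rewrite RintegralD//; [exact: sq_ip_integrable|exact: sq_ip_integrable].
Qed.

Lemma L2norm_sqr (v : VV) : L2norm Omega (cplx v) ^+ 2 = IP2 v v.
Proof. by rewrite L2norm_cplx sqr_sqrtr// sip_ge0. Qed.

Lemma eq_L2norm (D : set E) (u v : E -> C) : {in D, u =1 v} -> L2norm D u = L2norm D v.
Proof. by move=> uv; congr Num.sqrt; apply: eq_Rintegral => x xD; rewrite uv. Qed.

Lemma cplxD (u v : VV) : cplx (u + v) = fun x => cplx u x + cplx v x.
Proof. by []. Qed.
Lemma cplxN (u : VV) : cplx (- u) = fun x => - cplx u x.
Proof. by []. Qed.
Lemma cplxZ (a : R) (u : VV) : cplx (a *: u) = fun x => a%:C * cplx u x.
Proof.
apply/funext => x; rewrite /cplx.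
have -> : (a *: u).1 = a *: u.1 by [].
have -> : (a *: u).2 = a *: u.2 by [].
by rewrite !sqfunZE; move: (u.1 x) (u.2 x) => p q; simpc.
Qed.

Definition Jmul (u : VV) : VV := (- u.2, u.1).

Lemma cplxJ (u : VV) : cplx (Jmul u) = fun x => 'i * cplx u x.
Proof.
apply/funext => x; transitivity ((- u.2 x) +i* u.1 x); first by [].
by rewrite /cplx; move: (u.1 x) (u.2 x) => p q; simpc.
Qed.

Lemma sip_J (x y : VV) : IP2 (Jmul x) y = - IP2 x (Jmul y).
Proof.
have E1 : IP2 (Jmul x) y = IP (- x.2) y.1 + IP x.1 y.2 by [].
have E2 : IP2 x (Jmul y) = IP x.1 (- y.2) + IP x.2 y.1 by [].
by rewrite E1 E2 sipNl sipNr; ring.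
Qed.

Definition zmul (z : C) (u : VV) : VV := complex.Re z *: u + complex.Im z *: Jmul u.

Lemma cplx_zmul z (u : VV) : cplx (zmul z u) = fun x => z * cplx u x.
Proof.
rewrite /zmul cplxD !cplxZ cplxJ; apply/funext => x.
by case: z => a b; move: (cplx u x) => [p q] /=; simpc; congr (_ +i* _); ring.
Qed.

Lemma test_function_of_rtests f g : rtest Omega f -> rtest Omega g ->
  test_function Omega (fun x => f x +i* g x).
Proof.
move=> [sf cf fO] [sg cg gO].
have sub : closure [set x | f x +i* g x != 0] `<=`
    closure [set x | f x != 0] `|` closure [set x | g x != 0].
  rewrite -closureU; apply: closure_subset => x /=; rewrite eq_complex /= negb_and.
  by move=> /orP.
split => //.
  by apply: subclosed_compact (compactU cf cg) sub; exact: closed_closure.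
by move=> x /sub[/fO|/gO].
Qed.

Lemma rtest_part (part : C -> R) psi : part 0 = 0 -> smooth (fun x => part (psi x)) ->
  test_function Omega psi -> rtest Omega (fun x => part (psi x)).
Proof.
move=> part0 sp [_ _ cp pO].
have sub : [set x | part (psi x) != 0] `<=` [set x | psi x != 0].
  by move=> x /=; apply: contraNN => /eqP ->; rewrite part0.
split => //; first exact: compact_support_sub cp sub.
by apply: subset_trans pO; exact: closure_subset.
Qed.

Lemma rtest_Re psi : test_function Omega psi -> rtest Omega (fun x => complex.Re (psi x)).
Proof. by move=> tp; apply: (rtest_part _ _ tp) => //; case: tp. Qed.

Lemma rtest_Im psi : test_function Omega psi -> rtest Omega (fun x => complex.Im (psi x)).
Proof. by move=> tp; apply: (rtest_part _ _ tp) => //; case: tp. Qed.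

End complex_L2.

Section complex_h10.
Variables (R : realType) (d : nat) (Omega : set 'rV[R]_d).
Hypotheses (oO : open Omega) (bO : bounded_set Omega).
Local Notation mu := (lebesgue_rV R d).
Local Notation mO := (open_rV_measurable oO).
Local Notation W := (sqfun mu mO).
Local Notation IP := (sq_inner mu mO).
Local Notation K := (W * {ffun 'I_d -> W})%type.
Local Notation VV := (complex_L2 oO).
Local Notation IP2 := (complex_inner oO).
Local Notation Std := (h1_inner oO).
Let measurable_Omega : measurable Omega := mO.

Lemma grad_pairs_test (m : K) : grad_pairs m ->
  exists f (tf : rtest Omega f), m = test_pair oO bO tf.
Proof.
move=> [f [tf mf df]]; exists f, tf; case: m mf df => m1 m2 /= mf df.
congr (_, _); first by apply: val_inj.
by apply/ffunP => i; rewrite ffunE; apply: val_inj; exact: df.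
Qed.

Definition re_part (u : VV) (G : 'I_d -> VV) : K := (u.1, [ffun i => (G i).1]).
Definition im_part (u : VV) (G : 'I_d -> VV) : K := (u.2, [ffun i => (G i).2]).

Lemma h1_dist (u : VV) (G : 'I_d -> VV) (m1 m2 : K) :
  L2norm Omega (cplx (u - (m1.1, m2.1))) ^+ 2 +
    \sum_(i < d) L2norm Omega (cplx (G i - (m1.2 i, m2.2 i))) ^+ 2 =
  Std (re_part u G - m1) (re_part u G - m1) + Std (im_part u G - m2) (im_part u G - m2).
Proof.
rewrite L2norm_sqr; under eq_bigr do rewrite L2norm_sqr.
have E (a b : VV) : IP2 (a - b) (a - b) = IP (a.1 - b.1) (a.1 - b.1) + IP (a.2 - b.2) (a.2 - b.2) by [].
have F (a b : K) : Std (a - b) (a - b) = IP (a.1 - b.1) (a.1 - b.1) +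
    \sum_i IP ((a.2 - b.2) i) ((a.2 - b.2) i) by [].
rewrite E !F; under eq_bigr do rewrite E.
rewrite big_split /= addrACA; congr (_ + _ + (_ + _)); apply: eq_bigr => i _; by rewrite !ffunE.
Qed.

Lemma complex_test (f g : 'rV[R]_d -> R) (tf : rtest Omega f) (tg : rtest Omega g) i x :
  cpderiv i (fun x => f x +i* g x) x =
  cplx ((test_pair oO bO tf).2 i, (test_pair oO bO tg).2 i) x.
Proof. by rewrite /cplx /= !ffunE. Qed.

(** Tested against f + i g, the complex weak gradient identity is a combination of
    real identities for both parts of u against f and against g. The distance to test
    functions is the sum of the distances of both parts, by h1_dist. *)
Lemma H10_parts (u : VV) (G : 'I_d -> VV) :
  H10 Omega (cplx u) (fun i => cplx (G i)) <->
  h10 (re_part u G) /\ h10 (im_part u G).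
Proof.
have quarter (z : R) : 0 < z -> z / 4 + z / 4 < z by lra.
split=> [[_ happ]|[h1 h2]].
  suff key e : 0 < e -> exists m1 m2 : K, [/\ grad_pairs m1, grad_pairs m2 &
      Std (re_part u G - m1) (re_part u G - m1) +
      Std (im_part u G - m2) (im_part u G - m2) <= e].
    split=> e /key[m1 [m2 [M1 M2 h]]].
      by exists m1 => //; apply: le_trans h; rewrite lerDl sip_ge0.
    by exists m2 => //; apply: le_trans h; rewrite lerDr sip_ge0.
  move=> e0; have s0 : 0 < Num.sqrt e by rewrite sqrtr_gt0.
  have [psi tpsi h] := happ _ s0.
  have E : Num.sqrt e ^+ 2 = e by rewrite sqr_sqrtr// ltW.
  exists (test_pair oO bO (rtest_Re tpsi)), (test_pair oO bO (rtest_Im tpsi)); split.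
  - exact: test_pairP.
  - exact: test_pairP.
  rewrite -h1_dist -[X in _ <= X]E; apply: le_trans (ltW h); rewrite le_eqVlt; apply/orP; left; apply/eqP.
  congr (_ ^+ 2 + _).
    by congr (L2norm _ _); apply/funext => x; rewrite cplxD cplxN /cplx /=; case: (psi x).
  apply: eq_bigr => i _; congr (_ ^+ 2); congr (L2norm _ _); apply/funext => x.
  rewrite cplxD cplxN; congr (_ - _).
  by rewrite -complex_test.
split.
  split; [exact: cplx_L2|by move=> i; exact: cplx_L2|].
  move=> i psi tpsi.
  have t1 := rtest_Re tpsi; have t2 := rtest_Im tpsi.
  pose m1 := test_pair oO bO t1; pose m2 := test_pair oO bO t2.
  have bp (p : K) f (tf : rtest Omega f) : h10 p ->
      sq_ip p.1 ((test_pair oO bO tf).2 i) = - sq_ip (p.2 i) (test_pair oO bO tf).1.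
    by move=> hp; have := h10_by_parts bO i hp tf; rewrite /sq_ip /= ffunE.
  have E1 : (re_part u G).2 i = (G i).1 by rewrite ffunE.
  have E2 : (im_part u G).2 i = (G i).2 by rewrite ffunE.
  have b11 : sq_ip u.1 (m1.2 i) = - sq_ip (G i).1 m1.1 by rewrite -E1; exact: (bp _ _ t1 h1).
  have b12 : sq_ip u.1 (m2.2 i) = - sq_ip (G i).1 m2.1 by rewrite -E1; exact: (bp _ _ t2 h1).
  have b21 : sq_ip u.2 (m1.2 i) = - sq_ip (G i).2 m1.1 by rewrite -E2; exact: (bp _ _ t1 h2).
  have b22 : sq_ip u.2 (m2.2 i) = - sq_ip (G i).2 m2.1 by rewrite -E2; exact: (bp _ _ t2 h2).
  have R1 (a : VV) (b c : W) : cintegral Omega (fun x => cplx a x * cplx (b, c) x) =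
     (sq_ip a.1 b - sq_ip a.2 c) +i* (sq_ip a.1 c + sq_ip a.2 b).
    rewrite /cintegral -RintegralB//; [|exact: sq_ip_integrable|exact: sq_ip_integrable].
    by rewrite -RintegralD//; [exact: sq_ip_integrable|exact: sq_ip_integrable].
  have -> : (fun x => cplx u x * cpderiv i psi x) = (fun x => cplx u x * cplx (m1.2 i, m2.2 i) x).
    by apply/funext => x; rewrite -complex_test.
  have -> : (fun x => cplx (G i) x * psi x) = (fun x => cplx (G i) x * cplx (m1.1, m2.1) x).
    by apply/funext => x; congr (_ * _); rewrite /cplx /=; case: (psi x).
  rewrite !R1 b11 b12 b21 b22.
  apply/eqP; rewrite eq_complex; apply/andP; split; apply/eqP; rewrite [LHS]/= [RHS]/=; ring.
move=> eps eps0; have e0 : 0 < eps ^+ 2 / 4 by rewrite divr_gt0// exprn_gt0.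
have [m1 /grad_pairs_test[f [tf ->]] hm1] := h1 _ e0.
have [m2 /grad_pairs_test[g [tg ->]] hm2] := h2 _ e0.
exists (fun x => f x +i* g x); first exact: test_function_of_rtests.
have := lerD hm1 hm2; rewrite -h1_dist => h.
apply: (@le_lt_trans _ _ (eps ^+ 2 / 4 + eps ^+ 2 / 4)); last first.
  by apply: quarter; rewrite exprn_gt0.
apply: le_trans h; rewrite le_eqVlt; apply/orP; left; apply/eqP.
congr (_ + _); apply: eq_bigr => i _; congr (_ ^+ 2); congr (L2norm _ _).
by apply/funext => x; rewrite complex_test.
Qed.

End complex_h10.

(** * The elliptic operator and its resolvent *)

Section elliptic_operator.
Variables (R : realType) (d : nat) (Omega : set 'rV[R]_d).
Hypotheses (oO : open Omega) (bO : bounded_set Omega).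
Local Notation mu := (lebesgue_rV R d).
Local Notation mO := (open_rV_measurable oO).
Local Notation W := (sqfun mu mO).
Local Notation IP := (sq_inner mu mO).
Local Notation K := (W * {ffun 'I_d -> W})%type.
Local Notation VV := (complex_L2 oO).
Local Notation IP2 := (complex_inner oO).
Local Notation Std := (h1_inner oO).
Let measurable_Omega : measurable Omega := mO.
Variables (V : 'rV[R]_d -> R) (V_inf : ess_bounded mu Omega V).
Hypothesis V_ge0 : {ae mu, forall x, Omega x -> 0 <= V x}.
Variable A : 'rV[R]_d -> 'M[R]_d.
Hypothesis A_sym : forall x, Omega x -> (A x)^T = A x.
Variables (c C : R).
Hypotheses (c_gt0 : 0 < c) (C_gt0 : 0 < C).
Hypothesis A_ell : {ae mu, forall x, Omega x -> forall v : 'cV[R]_d,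
     c * (v^T *m v) ord0 ord0 <= (v^T *m A x *m v) ord0 ord0 /\
     (v^T *m A x *m v) ord0 ord0 <= C * (v^T *m v) ord0 ord0}.
Hypothesis A_inf : forall i j, ess_bounded mu Omega (fun x => A x i j).
Local Notation form := (form V_inf A_inf).
Local Notation B := (form_inner oO V_inf V_ge0 A_sym c_gt0 A_ell A_inf).
Local Notation weak_solution := (weak_solution V_inf V_ge0 A_sym c_gt0 A_ell A_inf).
Local Notation sol := (sol V_inf V_ge0 A_sym c_gt0 C_gt0 A_ell A_inf).
Local Notation T := (resolvent V_inf V_ge0 A_sym c_gt0 C_gt0 A_ell A_inf).
Local Notation L := (elliptic_op Omega A V).

Lemma weak_solution_eq p p' f : weak_solution p f ->
  Std (p - p') (p - p') = 0 -> weak_solution p' f.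
Proof.
move=> [hp pf] pp; split.
  move=> e e0; have [m Mm hm] := hp _ e0; exists m; first exact: Mm.
  by rewrite sip_opp -(eq_null_norm m pp) sip_opp.
have [C' _ hC'] := form_upper oO V_inf V_ge0 A_sym c_gt0 C_gt0 A_ell A_inf.
have B0 : B (p - p') (p - p') = 0.
  apply/eqP; rewrite eq_le sip_ge0 andbT; apply: le_trans (hC' _) _.
  by rewrite pp mulr0.
by move=> m Mm; rewrite -pf//; apply/esym; exact: eq_null_sip.
Qed.

Definition energy_density (p m : K) x : R :=
  \sum_i \sum_j A x i j * p.2 j x * m.2 i x + V x * p.1 x * m.1 x.

Lemma integral_energy_density (p m : K) :
  mu.-integrable Omega (EFin \o energy_density p m) /\
  \int[mu]_(x in Omega) energy_density p m x = form p m - sq_ip p.1 m.1.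
Proof.
pose F i j x := mul_sqfun (A_inf i j) (p.2 j) x * m.2 i x.
have iF i j : mu.-integrable Omega (EFin \o F i j) by exact: sq_ip_integrable.
have sF i := Rintegral_sum (index_enum 'I_d) mO (iF i).
have [i1 e1] := Rintegral_sum (index_enum 'I_d) mO (fun i => (sF i).1).
have i2 : mu.-integrable Omega (EFin \o (fun x => mul_sqfun V_inf p.1 x * m.1 x)).
  exact: sq_ip_integrable.
have gE : grad_form A_inf p.2 m.2 =
    \int[mu]_(x in Omega) (\sum_(i <- index_enum 'I_d) \sum_(j <- index_enum 'I_d) F i j x).
  by rewrite e1; apply: eq_bigr => i _; rewrite (sF i).2.
split; first by have := integrableD mO i1 i2; apply: eq_integrable.
rewrite /form addrA addrK gE -[sq_ip _ _]/(\int[mu]_(x in Omega) (mul_sqfun V_inf p.1 x * m.1 x)).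
by rewrite -RintegralD.
Qed.

(** The weak form is bilinear, without conjugation, and its coefficients are real;
    hence it expands like a product of complex numbers. *)
Lemma complex_density (u : VV) (G : 'I_d -> VV) (f g : 'rV[R]_d -> R)
    (tf : rtest Omega f) (tg : rtest Omega g) x :
  let p := re_part u G in let q := im_part u G in
  let m := test_pair oO bO tf in let n := test_pair oO bO tg in
  (\sum_(i < d) \sum_(j < d) (A x i j)%:C * cplx (G j) x * cpderiv i (fun x => f x +i* g x) x)
    + (V x)%:C * cplx u x * (f x +i* g x) =
  (energy_density p m x - energy_density q n x) +i*
  (energy_density p n x + energy_density q m x).
Proof.
move=> p q m n.
have EE i j : (A x i j)%:C * cplx (G j) x * cpderiv i (fun x => f x +i* g x) x =
   (A x i j * p.2 j x * m.2 i x - A x i j * q.2 j x * n.2 i x) +i*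
   (A x i j * p.2 j x * n.2 i x + A x i j * q.2 j x * m.2 i x).
  rewrite (complex_test oO bO tf tg) -/m -/n /cplx.
  have -> : p.2 j = (G j).1 by rewrite ffunE.
  have -> : q.2 j = (G j).2 by rewrite ffunE.
  move: (A x i j) ((G j).1 x) ((G j).2 x) => a b c'.
  rewrite [(m.2 i, n.2 i).1]/(m.2 i) [(m.2 i, n.2 i).2]/(n.2 i).
  by move: (m.2 i x) (n.2 i x) => e e'; simpc; congr (_ +i* _); ring.
have E2 : (V x)%:C * cplx u x * (f x +i* g x) =
   (V x * p.1 x * m.1 x - V x * q.1 x * n.1 x) +i*
   (V x * p.1 x * n.1 x + V x * q.1 x * m.1 x).
  rewrite /cplx /= /m /n /=; move: (V x) (u.1 x) (u.2 x) (f x) (g x) => a b c' e e'.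
  by simpc; congr (_ +i* _); ring.
rewrite E2; under eq_bigr do under eq_bigr do rewrite EE.
have -> : \sum_(i < d) \sum_(j < d)
   ((A x i j * p.2 j x * m.2 i x - A x i j * q.2 j x * n.2 i x) +i*
   (A x i j * p.2 j x * n.2 i x + A x i j * q.2 j x * m.2 i x)) =
   (\sum_i \sum_j (A x i j * p.2 j x * m.2 i x) - \sum_i \sum_j (A x i j * q.2 j x * n.2 i x)) +i*
   (\sum_i \sum_j (A x i j * p.2 j x * n.2 i x) + \sum_i \sum_j (A x i j * q.2 j x * m.2 i x)).
  under eq_bigr do rewrite complex_sum sumrB big_split.
  by rewrite complex_sum sumrB big_split.
have addc (a b a' b' : R) : (a +i* b) + (a' +i* b') = (a + a') +i* (b + b') by [].
rewrite addc /energy_density; congr (_ +i* _); ring.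
Qed.

Lemma cintegral_complex (f g : 'rV[R]_d -> R) :
  cintegral Omega (fun x => f x +i* g x) =
  (\int[mu]_(x in Omega) f x) +i* (\int[mu]_(x in Omega) g x).
Proof. by []. Qed.

Lemma cintegral_density (u : VV) (G : 'I_d -> VV) (f g : 'rV[R]_d -> R)
    (tf : rtest Omega f) (tg : rtest Omega g) :
  let p := re_part u G in let q := im_part u G in
  let m := test_pair oO bO tf in let n := test_pair oO bO tg in
  let a (p m : K) := form p m - sq_ip p.1 m.1 in
  cintegral Omega (fun x =>
  (\sum_(i < d) \sum_(j < d) (A x i j)%:C * cplx (G j) x * cpderiv i (fun x => f x +i* g x) x)
    + (V x)%:C * cplx u x * (f x +i* g x)) =
  (a p m - a q n) +i* (a p n + a q m).
Proof.
move=> p q m n a.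
under [X in cintegral _ X]funext do rewrite complex_density -/p -/q -/m -/n.
rewrite cintegral_complex.
have iE p' m' := integral_energy_density p' m'.
rewrite RintegralB//; [|exact: (iE _ _).1|exact: (iE _ _).1].
rewrite RintegralD//; [|exact: (iE _ _).1|exact: (iE _ _).1].
by rewrite !(iE _ _).2.
Qed.

Lemma cintegral_source (g : VV) (f h : 'rV[R]_d -> R)
    (tf : rtest Omega f) (th : rtest Omega h) :
  let m := test_pair oO bO tf in let n := test_pair oO bO th in
  cintegral Omega (fun x => cplx g x * (f x +i* h x)) =
  (sq_ip g.1 m.1 - sq_ip g.2 n.1) +i* (sq_ip g.1 n.1 + sq_ip g.2 m.1).
Proof.
move=> m n; rewrite -RintegralB//; [|exact: sq_ip_integrable|exact: sq_ip_integrable].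
by rewrite -RintegralD//; [exact: sq_ip_integrable|exact: sq_ip_integrable].
Qed.

(** As A and V are real, the tests f + i f with f real already separate the equation
    into its real and imaginary parts. Adding u to the source compensates the shift
    by one in form. *)
Lemma elliptic_parts (u g : VV) : L (cplx u) (cplx g) <->
  exists G : 'I_d -> VV, weak_solution (re_part u G) (g.1 + u.1) /\
                         weak_solution (im_part u G) (g.2 + u.2).
Proof.
split=> [[G0 [HG _ eqn]]|[G [[hp wp] [hq wq]]]].
  have GL i := cid (L2_cplx oO (let: conj (And3 _ h _) _ := HG in h i)).
  pose G i := projT1 (GL i).
  have GE : G0 = fun i => cplx (G i).
    by apply/funext => i; exact: (projT2 (GL i)).
  rewrite {}GE in HG eqn; have [hp hq] := (H10_parts bO u G).1 HG.
  suff key f (tf : rtest Omega f) (m := test_pair oO bO tf) :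
      form (re_part u G) m = IP (g.1 + u.1) m.1 /\
      form (im_part u G) m = IP (g.2 + u.2) m.1.
    exists G; split; split=> // m /(grad_pairs_test bO)[f [tf ->]].
      exact: (key f tf).1.
    exact: (key f tf).2.
  have := eqn _ (test_function_of_rtests tf tf).
  rewrite (cintegral_density u G tf tf) (cintegral_source g tf tf) -/m => /eqP.
  rewrite eq_complex => /andP[/eqP h1 /eqP h2].
  have {}h1 : form (re_part u G) m - sq_ip u.1 m.1 - (form (im_part u G) m - sq_ip u.2 m.1) =
     sq_ip g.1 m.1 - sq_ip g.2 m.1 := h1.
  have {}h2 : form (re_part u G) m - sq_ip u.1 m.1 + (form (im_part u G) m - sq_ip u.2 m.1) =
     sq_ip g.1 m.1 + sq_ip g.2 m.1 := h2.
  have s1 : IP (g.1 + u.1) m.1 = sq_ip g.1 m.1 + sq_ip u.1 m.1 by exact: sipDl.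
  have s2 : IP (g.2 + u.2) m.1 = sq_ip g.2 m.1 + sq_ip u.2 m.1 by exact: sipDl.
  rewrite s1 s2; split; lra.
exists (fun i => cplx (G i)); split; [by apply/H10_parts|exact: cplx_L2|].
move=> psi tpsi.
have -> : psi = fun x => complex.Re (psi x) +i* complex.Im (psi x).
  by apply/funext => y; case: (psi y).
have t1 := rtest_Re tpsi; have t2 := rtest_Im tpsi.
rewrite (cintegral_density u G t1 t2) (cintegral_source g t1 t2).
have P1 := wp _ (test_pairP oO bO t1); have P2 := wp _ (test_pairP oO bO t2).
have Q1 := wq _ (test_pairP oO bO t1); have Q2 := wq _ (test_pairP oO bO t2).
move: (test_pair oO bO t1) (test_pair oO bO t2) P1 P2 Q1 Q2 => m n P1 P2 Q1 Q2.
have eP1 : form (re_part u G) m = sq_ip g.1 m.1 + sq_ip u.1 m.1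
  := etrans P1 (sipDl _ _ _ _).
have eP2 : form (re_part u G) n = sq_ip g.1 n.1 + sq_ip u.1 n.1
  := etrans P2 (sipDl _ _ _ _).
have eQ1 : form (im_part u G) m = sq_ip g.2 m.1 + sq_ip u.2 m.1
  := etrans Q1 (sipDl _ _ _ _).
have eQ2 : form (im_part u G) n = sq_ip g.2 n.1 + sq_ip u.2 n.1
  := etrans Q2 (sipDl _ _ _ _).
by rewrite eP1 eP2 eQ1 eQ2 !addrK.
Qed.

Definition complex_resolvent (x : VV) : VV := (T x.1, T x.2).
Local Notation T2 := complex_resolvent.

(** L u = g means u = (L + 1)^-1 (g + u), up to null vectors, because weak solutions
    are unique. From here on the unbounded operator is replaced by its resolvent. *)
Lemma ellipticP (u g : VV) : L (cplx u) (cplx g) <->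
  IP2 (u - T2 (g + u)) (u - T2 (g + u)) = 0.
Proof.
have E : IP2 (u - T2 (g + u)) (u - T2 (g + u)) =
   IP (u.1 - T (g.1 + u.1)) (u.1 - T (g.1 + u.1)) +
   IP (u.2 - T (g.2 + u.2)) (u.2 - T (g.2 + u.2)) by [].
rewrite E; split=> [/elliptic_parts[G [w1 w2]]|/eqP].
  have n1 (p p' : K) : Std (p - p') (p - p') = 0 -> IP (p.1 - p'.1) (p.1 - p'.1) = 0.
    move=> h; apply/eqP; rewrite eq_le sip_ge0 andbT -h.
    have -> : Std (p - p') (p - p') = IP (p.1 - p'.1) (p.1 - p'.1) +
       \sum_i IP ((p - p').2 i) ((p - p').2 i) by [].
    by rewrite lerDl; apply: sumr_ge0 => i _; exact: sip_ge0.
  have h1 := n1 _ _ (weak_solution_uniq C_gt0 w1 (weak_solP V_inf V_ge0 A_sym c_gt0 C_gt0 A_ell A_inf _)).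
  have h2 := n1 _ _ (weak_solution_uniq C_gt0 w2 (weak_solP V_inf V_ge0 A_sym c_gt0 C_gt0 A_ell A_inf _)).
  by rewrite -[T (g.1 + u.1)]/(sol (g.1 + u.1)).1 -[T (g.2 + u.2)]/(sol (g.2 + u.2)).1 [X in X + _]h1 [X in _ + X]h2 addr0.
rewrite paddr_eq0 ?sip_ge0// => /andP[/eqP h1 /eqP h2]; apply/elliptic_parts.
(* The weak gradient of u is that of the exact solutions of both parts. *)
exists (fun i => ((sol (g.1 + u.1)).2 i, (sol (g.2 + u.2)).2 i)).
have n2 f (v : W) : IP (v - T f) (v - T f) = 0 ->
    weak_solution (v, [ffun i => (sol f).2 i]) f.
  move=> h; apply: weak_solution_eq (weak_solP V_inf V_ge0 A_sym c_gt0 C_gt0 A_ell A_inf f) _.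
  have -> : Std (sol f - (v, [ffun i => (sol f).2 i])) (sol f - (v, [ffun i => (sol f).2 i])) =
     IP (T f - v) (T f - v) + \sum_i IP ((sol f).2 i - (sol f).2 i) ((sol f).2 i - (sol f).2 i).
    have -> : [ffun i => (sol f).2 i] = (sol f).2 by apply/ffunP => i; rewrite ffunE.
    have -> : Std (sol f - (v, (sol f).2)) (sol f - (v, (sol f).2)) =
     IP (T f - v) (T f - v) + \sum_i IP (((sol f).2 - (sol f).2) i) (((sol f).2 - (sol f).2) i) by [].
    by congr (_ + _); apply: eq_bigr => i _; rewrite !ffunE.
  rewrite -opprB sipNl sipNr opprK h add0r big1// => i _.
  by rewrite subrr sip0l.
split; rewrite /re_part /im_part.
  have -> : [ffun i => ((sol (g.1 + u.1)).2 i, (sol (g.2 + u.2)).2 i).1] = [ffun i => (sol (g.1 + u.1)).2 i].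
    by apply/ffunP => i; rewrite !ffunE.
  exact: (n2 (g.1 + u.1) u.1 h1).
have -> : [ffun i => ((sol (g.1 + u.1)).2 i, (sol (g.2 + u.2)).2 i).2] = [ffun i => (sol (g.2 + u.2)).2 i].
  by apply/ffunP => i; rewrite !ffunE.
exact: (n2 (g.2 + u.2) u.2 h2).
Qed.

Lemma complex_resolvent_sym : symmetric_map IP2 T2.
Proof.
move=> x y; have e1 : IP2 (T2 x) y = IP (T x.1) y.1 + IP (T x.2) y.2 by [].
have e2 : IP2 x (T2 y) = IP x.1 (T y.1) + IP x.2 (T y.2) by [].
by rewrite e1 e2; congr (_ + _); apply: resolvent_sym.
Qed.

Lemma complex_resolvent_compact : compact_map IP2 T2.
Proof.
move=> e e0; have [k [f hf]] := resolvent_compact oO bO V_inf V_ge0 A_sym c_gt0 C_gt0 A_ell A_inf e0.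
exists (k + k)%N, (fun i => match fintype.split i with inl j => (f j, 0) | inr j => (0, f j) end : VV).
move=> x; rewrite big_split_ord.
have e1 : IP2 (T2 x) (T2 x) = IP (T x.1) (T x.1) + IP (T x.2) (T x.2) by [].
have e2 : IP2 x x = IP x.1 x.1 + IP x.2 x.2 by [].
have e3 (a : W) : IP2 ((a, 0) : VV) x = IP a x.1.
  by rewrite -[LHS]/(IP a x.1 + IP 0 x.2) sip0l addr0.
have e4 (a : W) : IP2 ((0, a) : VV) x = IP a x.2.
  by rewrite -[LHS]/(IP 0 x.1 + IP a x.2) sip0l add0r.
rewrite e1 e2; under eq_bigr => i _.
  rewrite (unsplitK (inl i)) e3.
over.
under [X in _ <= _ + (_ + X)]eq_bigr => i _.
  rewrite (unsplitK (inr i)) e4.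
over.
have := lerD (hf x.1) (hf x.2).
by rewrite mulrDr addrACA.
Qed.

Lemma complex_resolventJ x y : IP2 (T2 (Jmul x)) y = IP2 (Jmul (T2 x)) y.
Proof.
have e1 : IP2 (T2 (Jmul x)) y = IP (T (- x.2)) y.1 + IP (T x.1) y.2 by [].
have e2 : IP2 (Jmul (T2 x)) y = IP (- T x.2) y.1 + IP (T x.1) y.2 by [].
have sT := resolvent_sym V_inf V_ge0 A_sym c_gt0 C_gt0 A_ell A_inf.
by rewrite e1 e2; congr (_ + _); rewrite sT !sipNl sT.
Qed.

Lemma elliptic_repr v g : L v g -> exists u h : VV, v = cplx u /\ g = cplx h.
Proof.
case=> G [[[Lv _ _] _] Lg _].
by have [u ->] := L2_cplx oO Lv; have [h ->] := L2_cplx oO Lg; exists u, h.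
Qed.

Lemma elliptic_weakP (u g : VV) : L (cplx u) (cplx g) <->
  forall y, IP2 u y = IP2 (g + u) (T2 y).
Proof.
split=> [/ellipticP h y|h].
  by rewrite -complex_resolvent_sym; exact: eq_null_sip.
apply/ellipticP/sip_nullP => y.
by rewrite sipDl sipNl complex_resolvent_sym h subrr.
Qed.

End elliptic_operator.

(** * Multiplication by complex scalars *)

Section complex_structure.
Variables (R : realType) (d : nat) (Omega : set 'rV[R]_d) (oO : open Omega).
Local Notation VV := (complex_L2 oO).
Local Notation B := (complex_inner oO).
Implicit Types (u w x y : VV) (z : R[i]).

Lemma JmulK u : Jmul (Jmul u) = - u.
Proof. by case: u => a b. Qed.

Lemma JmulB x y : Jmul (x - y) = Jmul x - Jmul y.
Proof. by case: x y => [x1 x2] [y1 y2]; congr (_, _); exact: opprD. Qed.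

Lemma JmulZ (c : R) x : Jmul (c *: x) = c *: Jmul x.
Proof. by case: x => [x1 x2]; congr (_, _); exact: esym (scalerN _ _). Qed.

Lemma sip_JJ x y : B (Jmul x) (Jmul y) = B x y.
Proof. by rewrite sip_J JmulK sipNr opprK. Qed.

Lemma sip_xJ x : B x (Jmul x) = 0.
Proof. have := sip_J x x; rewrite sipC; lra. Qed.

Lemma sip_zmul z u w : B (zmul z u) w = complex.Re z * B u w + complex.Im z * B (Jmul u) w.
Proof. by rewrite sipDl !sipZl. Qed.

Lemma zmul_norm z u : B (zmul z u) (zmul z u) = (complex.Re z ^+ 2 + complex.Im z ^+ 2) * B u u.
Proof.
rewrite sip_zmul !(sipC B _ (zmul z u)) !sip_zmul sip_JJ (sipC B _ u) sip_xJ; ring.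
Qed.

Lemma zmul1D z u : zmul (1 + z) u = u + zmul z u.
Proof. by rewrite /zmul !raddfD /= add0r scalerDl scale1r addrA. Qed.

End complex_structure.

(** * The part of the norm carried by a subset *)

Section masses.
Variables (R : realType) (d : nat) (Omega : set 'rV[R]_d) (oO : open Omega).
Local Notation leb := (lebesgue_rV R d).
Local Notation mO := (open_rV_measurable oO).
Local Notation VV := (complex_L2 oO).
Local Notation B := (complex_inner oO).
Variables (D : set 'rV[R]_d) (mD : measurable D) (DO : D `<=` Omega).
Let measurable_Omega : measurable Omega := mO.

Lemma indic_ess_bounded : ess_bounded leb Omega \1_D.
Proof.
split; first exact: measurable_indic.
by exists 1; apply: aeW => x _; rewrite indicE; case: (_ \in _); rewrite ?normr1 ?normr0.
Qed.

Definition restr (u : VV) : VV :=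
  (mul_sqfun indic_ess_bounded u.1, mul_sqfun indic_ess_bounded u.2).

Lemma cplx_restr u x : cplx (restr u) x = (\1_D x)%:C * cplx u x.
Proof.
by rewrite /cplx /=; move: (u.1 x) (u.2 x) (\1_D x : R) => a b c; simpc.
Qed.

Lemma restr_idem u : B (restr u) (restr u) = B u (restr u).
Proof.
have e1 : B (restr u) (restr u) = sq_ip (restr u).1 (restr u).1 + sq_ip (restr u).2 (restr u).2 by [].
have e2 : B u (restr u) = sq_ip u.1 (restr u).1 + sq_ip u.2 (restr u).2 by [].
have e (x : 'rV[R]_d) : \1_D x * \1_D x = \1_D x :> R.
  by rewrite indicE; case: (_ \in _); rewrite ?mulr1 ?mulr0.
rewrite e1 e2; congr (_ + _); apply: eq_Rintegral => x _ /=; rewrite mulrACA e; ring.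
Qed.

Lemma masses u : L2norm D (cplx u) ^+ 2 = B u (restr u) /\
  L2norm (Omega `\` D) (cplx u) ^+ 2 = B u u - B u (restr u).
Proof.
pose F x := Normc.normc (cplx u x) ^+ 2.
have FE x : F x = u.1 x * u.1 x + u.2 x * u.2 x by rewrite /F normc_sqr -!expr2.
have iF : leb.-integrable Omega (EFin \o F).
  have := integrableD mO (sq_ip_integrable u.1 u.1) (sq_ip_integrable u.2 u.2).
  by apply: eq_integrable => // x _; rewrite /= FE.
have sq S : L2norm S (cplx u) ^+ 2 = \int[leb]_(x in S) F x.
  by rewrite sqr_sqrtr// Rintegral_ge0// => x _; exact: sqr_ge0.
have mOD : measurable (Omega `\` D) by exact: measurableD.
have split_int (G : 'rV[R]_d -> R) : leb.-integrable Omega (EFin \o G) ->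
    \int[leb]_(x in Omega) G x = \int[leb]_(x in D) G x + \int[leb]_(x in Omega `\` D) G x.
  move=> iG; have OE : Omega = D `|` (Omega `\` D) by rewrite setDUK.
  rewrite {1}OE Rintegral_setU//; first by rewrite -OE.
  by apply/disj_setPS => x [Dx [_ nDx]].
pose G x := \1_D x * F x.
have GE : B u (restr u) = \int[leb]_(x in Omega) G x.
  have -> : B u (restr u) = sq_ip u.1 (restr u).1 + sq_ip u.2 (restr u).2 by [].
  rewrite -RintegralD//; [|exact: sq_ip_integrable|exact: sq_ip_integrable].
  by apply: eq_Rintegral => x _; rewrite /G FE /=; ring.
have iG : leb.-integrable Omega (EFin \o G).
  have := integrableD mO (sq_ip_integrable u.1 (restr u).1) (sq_ip_integrable u.2 (restr u).2).
  by apply: eq_integrable => // x _; rewrite /= /G FE -EFinD; congr EFin; ring.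
have pE : B u (restr u) = \int[leb]_(x in D) F x.
  rewrite GE split_int// [X in _ + X](_ : _ = 0) ?addr0; last first.
    rewrite (eq_Rintegral _ (g := fun=> 0)) ?Rintegral_cst ?mul0r// => x /set_mem[_ nDx].
    by rewrite /G indicE memNset ?mul0r.
  by apply: eq_Rintegral => x Dx; rewrite /G indicE Dx mul1r.
split; first by rewrite sq pE.
have nE : B u u = \int[leb]_(x in Omega) F x by rewrite -L2norm_sqr sq.
by rewrite sq pE nE (split_int F iF) addrC addKr.
Qed.

Lemma L2_nonzero u : ~ ae_eq leb Omega (cplx u) (cst 0) -> 0 < B u u.
Proof.
move=> u0; apply: sip_gt0 => n0; apply: u0.
have := n0; rewrite -[B u u]/(sq_ip u.1 u.1 + sq_ip u.2 u.2) => /eqP.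
rewrite paddr_eq0 ?sq_ip_ge0// => /andP[/eqP/sq_null_ae h1 /eqP/sq_null_ae h2].
by apply: filterS2 h1 h2 => x h1 h2 Ox; rewrite /cplx h1// h2.
Qed.

End masses.

(** * Spectrum of an operator with compact resolvent *)

(** The spectrum of L is studied through T = (L + 1)^-1 alone, a compact symmetric map
    commuting with multiplication by i. The equation L u = g is u = T (g + u) up to
    null vectors; this is expressed by products with all y, with T moved to y. *)
Section compact_resolvent_operator.
Variables (R : realType) (d : nat) (Omega : set 'rV[R]_d) (oO : open Omega).
Local Notation E := 'rV[R]_d.
Local Notation VV := (complex_L2 oO).
Local Notation B := (complex_inner oO).
Local Notation eigenspace := Defs.eigenspace.
Variables (L : operator R d) (T : VV -> VV).
Hypotheses (Tsym : symmetric_map B T) (Tcpt : compact_map B T).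
Hypothesis TJ : forall x y, B (T (Jmul x)) y = B (Jmul (T x)) y.
Hypothesis L_repr : forall v g, L v g -> exists u h : VV, v = cplx u /\ g = cplx h.
Hypothesis LP : forall u g, L (cplx u) (cplx g) <-> forall y, B u y = B (g + u) (T y).
Implicit Types (u w x y : VV) (z : R[i]).

(** For u = T x the hermitian product of x and u is real, as T is symmetric and
    commutes with i. *)
Lemma sip_xJ0 u x : (forall y, B u y = B x (T y)) -> B x (Jmul u) = 0.
Proof.
move=> ux; have h1 : B u (Jmul x) = B (T x) (Jmul x) by rewrite ux Tsym.
have h2 : B u (Jmul x) = - B (T x) (Jmul x).
  by rewrite ux sipC TJ sip_J.
have h3 := sip_J x u; rewrite (sipC B (Jmul x)) in h3; lra.
Qed.

(** In the product of x - z u with i u the contribution of x vanishes and only the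
    imaginary part of z remains; conclude by Cauchy-Schwarz. At 1 + z, with
    x = (L + 1) u, this reads |Im z| |u| <= |(L - z) u|. *)
Lemma imaginary_bound u x z : (forall y, B u y = B x (T y)) ->
  complex.Im z ^+ 2 * B u u <= B (x - zmul z u) (x - zmul z u).
Proof.
move=> ux; set f := x - _.
have e : B f (Jmul u) = - (complex.Im z * B u u).
  by rewrite sipDl sipNl sip_zmul (sip_xJ0 ux) sip_xJ sip_JJ; ring.
have cs := sip_CS B f (Jmul u); rewrite e sip_JJ sqrrN exprMn in cs.
have [u0|/eqP u0] := eqVneq (B u u) 0; first by rewrite u0 mulr0 sip_ge0.
by rewrite -(ler_pM2r (sip_gt0 u0)); apply: le_trans cs; rewrite expr2 mulrA.
Qed.

(** 1 - z T is bounded below by imaginary_bound, and its adjoint, adj, is injective by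
    the same argument. *)
Lemma nonreal_range z : complex.Im z != 0 -> forall f, exists x,
  B (f - (x - zmul z (T x))) (f - (x - zmul z (T x))) = 0.
Proof.
move=> b0; set a := complex.Re z; set b := complex.Im z in b0 *.
have b2 : 0 < b ^+ 2 by rewrite lt_neqAle sqr_ge0 eq_sym sqrf_eq0 b0.
pose adj w := w - T (a *: w - b *: Jmul w).
have SE x w : B (x - zmul z (T x)) w = B x (adj w).
  rewrite sipDl sipNl sip_zmul -/a -/b /adj sipDr sipNr -Tsym sipDr sipNr !sipZr sip_J; ring.
have [K K0 hK] := compact_map_bounded Tcpt.
pose k := 2 + 2 * (a ^+ 2 + b ^+ 2) / b ^+ 2.
have k0 : 0 < k.
  by rewrite ltr_wpDr// divr_ge0 ?sqr_ge0// mulr_ge0// addr_ge0 ?sqr_ge0.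
apply: (@complete_range _ _ B (fun x => x - zmul z (T x)) k^-1 (2 + 2 * (a ^+ 2 + b ^+ 2) * K)).
- exact: complex_complete.
- by move=> x y w; rewrite !SE sipDl.
- by move=> r x w; rewrite !SE sipZl.
- by rewrite invr_gt0.
- move=> x; rewrite mulrC ler_pdivrMr//.
  have h1 := imaginary_bound z (fun y => Tsym x y).
  have h2 := sip_normD B (x - zmul z (T x)) (zmul z (T x)).
  rewrite subrK zmul_norm -/a -/b in h2; rewrite -/b in h1.
  apply: le_trans h2 _; set F := B (x - _) _ in h1 *.
  have h3 : B (T x) (T x) <= F / b ^+ 2 by rewrite ler_pdivlMr// mulrC.
  have h4 := ler_wpM2l (addr_ge0 (sqr_ge0 a) (sqr_ge0 b)) h3.
  have -> : F * k = 2 * F + 2 * ((a ^+ 2 + b ^+ 2) * (F / b ^+ 2)) by rewrite /k; ring.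
  by rewrite lerD2l ler_pM2l.
- move=> x; apply: le_trans (sip_normB _ _ _) _; rewrite zmul_norm -/a -/b [leRHS]mulrDl lerD2l -!mulrA.
  by rewrite ler_pM2l// ler_wpM2l ?addr_ge0 ?sqr_ge0.
- move=> w hw; have wT y : B w y = B (a *: w - b *: Jmul w) (T y).
    have n0 : B (adj w) (adj w) = 0 by rewrite -SE hw.
    by rewrite -Tsym; exact: eq_null_sip.
  have := sip_xJ0 wT; rewrite sipDl sipNl !sipZl sip_xJ sip_JJ mulr0 sub0r => /eqP.
  by rewrite oppr_eq0 mulf_eq0 (negbTE b0)/= => /eqP.
Qed.

Lemma null_on (u w : VV) : (forall t, Omega t -> cplx u t = cplx w t) -> B (u - w) (u - w) = 0.
Proof.
move=> h; rewrite -L2norm_sqr (@eq_L2norm _ _ _ _ (cst 0)).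
  rewrite -[cst 0]/(cplx (0 : VV)) L2norm_sqr sip0l//.
by move=> t /set_mem Ot; rewrite cplxD cplxN h// subrr.
Qed.

(** If x - (1 + z) T x = f then v = T x solves L v - z v = f; the bound on the inverse
    is imaginary_bound. *)
Lemma nonreal_resolvent z : complex.Im z != 0 -> resolvent_set Omega L z.
Proof.
move=> b0; have b1 : complex.Im (1 + z) != 0 by rewrite raddfD /= add0r.
split=> [_ /(L2_cplx oO)[f ->]|].
  have [x hx] := nonreal_range b1 f; pose u := T x; pose g := f + zmul z u.
  exists (cplx u), (cplx g); last first.
    by move=> y _; rewrite /g cplxD cplx_zmul /= mulNr addrK.
  apply/LP => y; rewrite /u Tsym; apply/esym/eq_null_sip.
  have -> : g + u - x = f - (x - zmul (1 + z) u).
    by rewrite zmul1D opprB /g (addrAC f) [RHS]addrA [f + (u + _)]addrA.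
  by rewrite hx.
exists `|complex.Im z|^-1 => v f [g Lvg fg].
have [u [h [vE gE]]] := L_repr Lvg; subst v g.
have /LP/(imaginary_bound (1 + z)) := Lvg.
have -> : h + u - zmul (1 + z) u = h - zmul z u by rewrite zmul1D opprD addrA addrK.
rewrite raddfD /= add0r => hb.
have -> : L2norm Omega f = L2norm Omega (cplx (h - zmul z u)).
  by apply: eq_L2norm => t /set_mem Ot; rewrite fg// cplxD cplxN cplx_zmul mulNr.
rewrite !L2norm_cplx mulrC ler_pdivlMr ?normr_gt0// -sqrtr_sqr mulrC -sqrtrM ?sqr_ge0//.
by rewrite ler_wsqrtr.
Qed.

Lemma spectrum_real z : spectrum Omega L z -> z = (complex.Re z)%:C.
Proof.
move=> sz; apply/eqP; rewrite eq_complex eqxx /=.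
by apply: contra_notT sz; exact: nonreal_resolvent.
Qed.

Lemma eigenspaceP (r : R) u : eigenspace Omega L r%:C (cplx u) <->
  forall y, B u y = (r + 1) * B u (T y).
Proof.
have e : eigenspace Omega L r%:C (cplx u) = L (cplx u) (cplx (r *: u)) by rewrite cplxZ.
have e2 y : B (r *: u + u) (T y) = (r + 1) * B u (T y).
  by rewrite sipDl sipZl mulrDl mul1r.
rewrite e; split=> [/LP h y|h]; first by rewrite -e2; exact: h.
by apply/LP => y; rewrite e2; exact: h.
Qed.

Lemma eigen_spectrum (r : R) u : 0 < B u u -> eigenspace Omega L r%:C (cplx u) ->
  spectrum Omega L r%:C.
Proof.
move=> u0 eu; rewrite /spectrum /setC /= => -[_ [M hM]].
have Tz : add_mul Omega L (cst (- r%:C)) (cplx u) (cst 0).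
  by exists (fun t => r%:C * cplx u t) => // t _; rewrite /= mulNr subrr.
have := hM _ _ Tz; rewrite -[cst 0]/(cplx (0 : VV)) !L2norm_cplx sip0l sqrtr0 mulr0.
by rewrite leNgt sqrtr_gt0 u0.
Qed.

Lemma eigen_of_inverse h rho : 0 < B h h -> B (h - rho *: T h) (h - rho *: T h) = 0 ->
  0 < B (T h) (T h) /\ eigenspace Omega L (rho - 1)%:C (cplx (T h)).
Proof.
move=> h0 hT; have hE y : B h y = rho * B (T h) y by rewrite -sipZl; exact: eq_null_sip.
split; last by apply/eigenspaceP => y; rewrite subrK Tsym hE.
by apply: sip_gt0 => Th0; move: h0; rewrite hE (sip_null _ Th0) mulr0 ltxx.
Qed.

Lemma spectrum_shift (S : operator R d) (z w : R[i]) :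
  spectrum Omega (add_mul Omega S (cst z)) w <-> spectrum Omega S (w - z).
Proof.
have E v f : add_mul Omega (add_mul Omega S (cst z)) (cst (- w)) v f <->
    add_mul Omega S (cst (- (w - z))) v f.
  split=> [[g' [g Sg g'E] fE]|[g Sg fE]].
    by exists g => // t Ot; rewrite fE// g'E//= opprB mulrDl addrA.
  exists (fun t => g t + z * v t); first by exists g.
  by move=> t Ot; rewrite fE//= opprB mulrDl addrA.
suff e : resolvent_set Omega (add_mul Omega S (cst z)) w <-> resolvent_set Omega S (w - z).
  by rewrite /spectrum /setC /=; split=> n h; apply: n; apply/e.
split=> -[h1 [M h2]]; split.
- by move=> f /h1[v /E]; exists v.
- by exists M => v f /E; exact: h2.
- by move=> f /h1[v /E]; exists v.
- by exists M => v f /E; exact: h2.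
Qed.

Lemma residual_eq u x al : (forall y, B u y = B x (T y)) ->
  B (T x) (T x) = B u u /\ B (x - al *: T x) (x - al *: T x) = B (x - al *: u) (x - al *: u).
Proof.
move=> ux; have h y : B (T x) y = B u y by rewrite Tsym ux.
by rewrite !(sipDl, sipDr, sipNl, sipNr, sipZl, sipZr) !(sipC B x) !h !(sipC B u (T x)) !h.
Qed.

(** compact_eigen on the whole space. With x = (L + 1) u the last norm is that of
    (L - a) u, so this is the lower bound of |(L - a) u| by dist(a, Spec L) |u|. *)
Lemma nearest_spectrum a u x : 0 < B u u -> (forall y, B u y = B x (T y)) ->
  exists2 t, spectrum Omega L t%:C &
    (t - a) ^+ 2 * B u u <= B (x - (1 + a) *: u) (x - (1 + a) *: u).
Proof.
move=> u0 ux; have [e1 e2] := residual_eq (1 + a) ux.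
have sT : subspace [set: VV] by split.
have Tx0 : 0 < B (T x) (T x) by rewrite e1.
have [h [rho [_ h0 hT]]] := compact_eigen Tsym Tcpt (@complex_complete _ _ _ oO)
  (1 + a) sT (fun y _ => I) (fun y _ => I) I Tx0.
rewrite e1 e2 => le; exists (rho - 1); last by rewrite -addrA -opprD.
have [Th0 eT] := eigen_of_inverse h0 hT; exact: eigen_spectrum eT.
Qed.

Section invariant_subspace.
Variable Lambda : set R[i].
Hypothesis LambdaS : Lambda `<=` spectrum Omega L.

Definition eigen_list (s : seq (R[i] * VV)) := forall q, q \in s ->
  Lambda q.1 /\ eigenspace Omega L q.1 (cplx q.2).

(** With lists of pairs, where eigenvalues may be repeated, stability under addition
    is concatenation; eigen_span_eigenspaces regroups the vectors by eigenvalue. *)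
Definition eigen_span : set VV := [set u | exists2 s, eigen_list s & u = \sum_(q <- s) q.2].

Lemma eigen_spanZ1 (c : R) z u : Lambda z -> eigenspace Omega L z (cplx u) ->
  eigenspace Omega L z (cplx (c *: u)).
Proof.
move=> /LambdaS/spectrum_real ->; move: (complex.Re z) => r /eigenspaceP eu.
by apply/eigenspaceP => y; rewrite !sipZl eu mulrCA.
Qed.

Lemma eigen_span_subspace : subspace eigen_span.
Proof.
split=> [|u w [s hs ->] [s' hs' ->]|c u [s hs ->]].
- by exists [::] => //; rewrite big_nil.
- exists (s ++ s'); last by rewrite big_cat.
  by move=> q; rewrite mem_cat => /orP[/hs|/hs'].
- exists [seq (q.1, c *: q.2) | q <- s]; last by rewrite big_map scaler_sumr.
  move=> _ /mapP[q /hs[q1 q2] ->]; split => //; exact: eigen_spanZ1.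
Qed.

Lemma eigen_span1 z u : Lambda z -> eigenspace Omega L z (cplx u) -> eigen_span u.
Proof.
move=> Lz eu; exists [:: (z, u)]; last by rewrite big_seq1.
by move=> q; rewrite inE => /eqP ->.
Qed.

(** On an eigenvector for r the map T acts as (r + 1)^-1 up to null vectors. If
    r = - 1 the eigenvector is null, and the convention 0^-1 = 0 gives the right value. *)
Lemma eigen_span_invariant u : eigen_span u ->
  exists2 w, eigen_span w & B (T u - w) (T u - w) = 0.
Proof.
have [M0 MD MZ] := eigen_span_subspace; move=> Mu.
suff key : exists2 w, eigen_span w & forall y, B u (T y) = B w y.
  have [w Mw hw] := key.
  by exists w => //; apply/sip_nullP => y; rewrite sipDl sipNl Tsym hw subrr.
move: Mu => [s + ->]; elim: s => [_|q s IH hs].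
  by exists 0 => // y; rewrite big_nil !sip0l.
have [w Mw wE] : exists2 w, eigen_span w & forall y, B (\sum_(q <- s) q.2) (T y) = B w y.
  by apply: IH => p ps; apply: hs; rewrite inE ps orbT.
have [Lq eq] := hs q (mem_head _ _); exists ((complex.Re q.1 + 1)^-1 *: q.2 + w).
  by apply: MD => //; apply: MZ; exact: eigen_span1 eq.
move=> y; rewrite big_cons !sipDl wE sipZl; congr (_ + _).
have := eq; rewrite (spectrum_real (LambdaS Lq)) => /eigenspaceP; set r := complex.Re _ + 1 => er.
have [r0|r0] := eqVneq r 0; last by rewrite [in RHS]er mulKf.
have n0 : B q.2 q.2 = 0 by rewrite er r0 mul0r.
by rewrite !(sip_null _ n0) mulr0.
Qed.

Lemma eigen_span_eigenspaces u : eigen_span u -> eigenspaces Omega L Lambda (cplx u).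
Proof.
have [M0 MD MZ] := eigen_span_subspace.
move=> [s hs ->]; pose s' := undup [seq q.1 | q <- s].
pose w z := \sum_(q <- s | q.1 == z) q.2.
have cplx_sum (I : Type) (r : seq I) (P : pred I) (F : I -> VV) :
    cplx (\sum_(i <- r | P i) F i) = fun t => \sum_(i <- r | P i) cplx (F i) t.
  elim: r => [|i r IH]; first by apply/funext => t; rewrite !big_nil.
  apply/funext => t; rewrite !big_cons; case: ifP => // _; last by rewrite IH.
  by rewrite cplxD IH.
exists s', (fun z => cplx (w z)); split; last first.
  rewrite -cplx_sum; congr cplx.
  rewrite /w (exchange_big_dep xpredT)//=; apply: eq_big_seq => q qs.
  rewrite big_mkcond (bigD1_seq q.1) ?undup_uniq//=; last first.
    by rewrite mem_undup; apply/mapP; exists q.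
  by rewrite eqxx big1 ?addr0// => z zq; rewrite eq_sym (negbTE zq).
move=> z; rewrite mem_undup => /mapP[q qs zE].
have Lz : Lambda z by rewrite zE; have [] := hs q qs.
split => //; rewrite /w.
have zr := spectrum_real (LambdaS Lz); rewrite zr; apply/eigenspaceP => y.
rewrite big_seq_cond; elim/big_rec: _ => [|p v /andP[ps /eqP pz] IH].
  by rewrite !sip0l mulr0.
rewrite (sipDl B p.2 v y) (sipDl B p.2 v (T y)) IH [RHS]mulrDr; congr (_ + _).
by have [_] := hs p ps; rewrite pz zr => /eigenspaceP ->.
Qed.

(** spectral_gap for the span of the eigenvectors for Lambda: a nonnull eigenvector
    orthogonal to it has its eigenvalue outside Lambda, as otherwise it would be
    orthogonal to itself. In words, |(L - a) u| is at least r times the distance from u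
    to the span as soon as the rest of the spectrum is at distance r from a. *)
Lemma invariant_subspace_gap r a u x : 0 < B u u -> (forall y, B u y = B x (T y)) ->
  (forall t, spectrum Omega L t%:C -> ~ Lambda t%:C -> r ^+ 2 <= (t - a) ^+ 2) ->
  forall e, 0 < e -> exists2 m, eigenspaces Omega L Lambda (cplx m) &
    r ^+ 2 * B (u - m) (u - m) <= B (x - (1 + a) *: u) (x - (1 + a) *: u) + e.
Proof.
move=> u0 ux hr e e0; have [e1 e2] := residual_eq (1 + a) ux.
have H h rho : orth B eigen_span h -> 0 < B h h ->
    B (h - rho *: T h) (h - rho *: T h) = 0 -> r ^+ 2 <= (rho - (1 + a)) ^+ 2.
  move=> hM h0 hT; have [Th0 eT] := eigen_of_inverse h0 hT.
  have := hr (rho - 1) (eigen_spectrum Th0 eT); rewrite opprD addrA; apply => Lt.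
  have := eq_null_sip h hT; rewrite sipZl (sipC B (T h)) (hM _ (eigen_span1 Lt eT)) mulr0.
  by move=> hh; rewrite hh ltxx in h0.
have [m Mm] := spectral_gap Tsym Tcpt (@complex_complete _ _ _ oO)
  eigen_span_subspace eigen_span_invariant H (sqr_ge0 r) x e0.
rewrite e2 => le; exists m; first exact: eigen_span_eigenspaces.
have uT : B (u - T x) (u - T x) = 0.
  by apply/sip_nullP => y; rewrite sipDl sipNl Tsym ux subrr.
by rewrite sip_opp (eq_null_norm m uT) sip_opp.
Qed.

End invariant_subspace.

(** * Distances to the spectrum *)

Section eigenpair_estimates.
Variables (D : set 'rV[R]_d) (mD : measurable D) (DO : D `<=` Omega).
Variables (s : R) (s_gt0 : 0 < s) (mu : R[i]) (phi : E -> R[i]).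
Let a := complex.Re mu.

(** Let x = (L + 1) u and let P u be the restriction of u to D. The eigenvalue equation
    says that (L - a) u = i (Im mu - s P) u. The product of the left-hand side with i u
    vanishes by sip_xJ0, so Im mu |u|^2 = s |P u|^2, that is Im mu = s tau^2. The norm of
    the right-hand side is then s delta tau |u|. *)
Lemma eigenpair_data :
  eigenpair Omega (add_mul Omega L (fun t : E => 0 +i* (s * \1_D t))) mu phi ->
  exists u x : VV, let n := B u u in let dl := delta Omega phi D in let tu := tau Omega phi D in
  [/\ phi = cplx u, 0 < n, forall y, B u y = B x (T y) &
   [/\ 0 <= dl, 0 <= tu, tu ^+ 2 + dl ^+ 2 = 1, complex.Im mu = s * tu ^+ 2 &
   B (x - (1 + a) *: u) (x - (1 + a) *: u) = (s * dl * tu) ^+ 2 * n]].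
Proof.
move=> [[g Lg gE] nz]; have [u [h [uE hE]]] := L_repr Lg.
rewrite uE {}hE in Lg gE nz; have /LP ux := Lg.
exists u, (h + u); set n := B u u; set x := h + u in ux *.
have n0 : 0 < n by exact: L2_nonzero.
pose Pu := restr mD u; pose q := zmul mu u - s *: Jmul Pu.
have hq : B (h - q) (h - q) = 0.
  apply: null_on => t Ot; have -> : cplx h t = mu * cplx u t - 0 +i* (s * \1_D t) * cplx u t.
    by rewrite gE// addrK.
  rewrite /q cplxD cplxN cplxZ cplxJ cplx_zmul /Pu cplx_restr; congr (_ - _).
  by move: (cplx u t) (\1_D t : R) => [b c] e; simpc; congr (_ +i* _); ring.
have [pE qE] := masses mD DO u; rewrite -/Pu in pE qE.
set p := B u Pu in pE qE.
have bE : complex.Im mu * n = s * p.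
  have := sip_xJ0 ux; rewrite /x sipDl sip_xJ addr0 (eq_null_sip _ hq) /q.
  by rewrite sipDl sipNl sip_zmul sipZl sip_xJ !sip_JJ mulr0 add0r (sipC B Pu) => /eqP; rewrite subr_eq0 => /eqP.
have fE : B (x - (1 + a) *: u) (x - (1 + a) *: u) * n = s ^+ 2 * p * (n - p).
  (* Jmul f' is (L - a) u up to null vectors. *)
  pose f' := complex.Im mu *: u - s *: Pu.
  have -> : B (x - (1 + a) *: u) (x - (1 + a) *: u) = B (Jmul f') (Jmul f').
    have JE : Jmul f' = complex.Im mu *: Jmul u - s *: Jmul Pu.
      by rewrite JmulB !JmulZ.
    have e : x - (1 + a) *: u - Jmul f' = h - q.
      rewrite JE /x /q /zmul -/a scalerDl scale1r [- (u + _)]opprD addrA addrK.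
      by rewrite -[in RHS]addrA [in RHS]opprD [RHS]addrA.
    have := eq_null_norm 0 (etrans (congr1 (fun w => B w w) e) hq).
    by rewrite !sub0r !sipNl !sipNr !opprK.
  rewrite sip_JJ sipDl !sipDr !sipNl !sipNr !sipZl !sipZr restr_idem -/Pu (sipC B Pu u) -/p -/n.
  have -> : (complex.Im mu * (complex.Im mu * n) - complex.Im mu * (s * p) +
     (- (s * (complex.Im mu * p)) - - (s * (s * p)))) * n =
     (complex.Im mu * n) ^+ 2 - 2 * (complex.Im mu * n) * s * p + s ^+ 2 * p * n by ring.
  by rewrite bE; ring.
have N0 : 0 < L2norm Omega phi by rewrite uE L2norm_cplx sqrtr_gt0.
have nE : L2norm Omega phi ^+ 2 = n by rewrite uE L2norm_sqr.
have tE : tau Omega phi D ^+ 2 = p / n by rewrite expr_div_n nE uE pE.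
have dE : delta Omega phi D ^+ 2 = (n - p) / n by rewrite expr_div_n nE uE qE.
have n1 : n != 0 by rewrite gt_eqF.
rewrite -uE; split=> //; split.
- by rewrite divr_ge0 ?sqrtr_ge0.
- by rewrite divr_ge0 ?sqrtr_ge0.
- by rewrite tE dE -mulrDl addrC subrK divff.
- by rewrite tE mulrA -bE mulfK.
- by apply: (mulIf n1); rewrite fE 2!exprMn tE dE; field.
Qed.

Lemma normc_ge0 (z : R[i]) : 0 <= Normc.normc z.
Proof. by case: z => b c; exact: sqrtr_ge0. Qed.

Lemma le_normc (y : R) (z : R[i]) : 0 <= y ->
  y ^+ 2 <= complex.Re z ^+ 2 + complex.Im z ^+ 2 -> y <= Normc.normc z.
Proof.
by move=> y0; rewrite -normc_sqr => h; rewrite -(@ler_pXn2r _ 2)// ?nnegrE ?normc_ge0.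
Qed.

Lemma normc_le (y : R) (z : R[i]) : 0 <= y ->
  complex.Re z ^+ 2 + complex.Im z ^+ 2 <= y ^+ 2 -> Normc.normc z <= y.
Proof.
by move=> y0; rewrite -normc_sqr => h; rewrite -(@ler_pXn2r _ 2)// ?nnegrE ?normc_ge0.
Qed.

Hypothesis hmu : eigenpair Omega (add_mul Omega L (fun t : E => 0 +i* (s * \1_D t))) mu phi.
Local Notation dl := (delta Omega phi D).
Local Notation tu := (tau Omega phi D).

Local Notation Lis := (add_mul Omega L (cst (0 +i* s))).

Lemma near_real_part : exists2 t : R, spectrum Omega L t%:C & (t - a) ^+ 2 <= (s * dl * tu) ^+ 2.
Proof.
have [u [x [_ n0 ux [_ _ _ _ fE]]]] := eigenpair_data hmu.
have [t st] := nearest_spectrum a n0 ux.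
by rewrite fE ler_pM2r//; exists t.
Qed.

(** The spectrum of L + i s lies on the line of imaginary part s, and
    s - Im mu = s (1 - tau^2) = s delta^2. *)
Lemma dist_shifted_lower :
  ((s * dl ^+ 2)%:E <= cdist mu (spectrum Omega Lis))%E.
Proof.
have [u [x [_ n0 ux [_ _ sq1 bE _]]]] := eigenpair_data hmu.
apply/ereal_infP => _ [w /spectrum_shift sw <-]; rewrite lee_fin.
have := spectrum_real sw; move: w {sw} => [w1 w2] /eqP.
rewrite eq_complex => /andP[_ /eqP h].
have {}h : w2 - s = 0 := h.
apply: le_normc; first by rewrite mulr_ge0 ?sqr_ge0 ?(ltW s_gt0).
have -> : complex.Im (mu - (w1 +i* w2)) = complex.Im mu - w2 by rewrite raddfB.
have -> : complex.Im mu - w2 = - (s * dl ^+ 2).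
  have -> : w2 = s by apply/eqP; rewrite -subr_eq0 h.
  by rewrite bE -[X in _ - X]mulr1 -sq1; ring.
by rewrite sqrrN lerDr sqr_ge0.
Qed.

(** For t in the spectrum of L near Re mu, the point t + i s is at horizontal distance
    at most s delta tau from mu and at vertical distance s delta^2; as
    tau^2 + delta^2 = 1, Pythagoras gives s delta. *)
Lemma dist_shifted_upper :
  (cdist mu (spectrum Omega Lis) <= (s * dl)%:E)%E.
Proof.
have [u [x [_ n0 ux [d0 t0 sq1 bE _]]]] := eigenpair_data hmu.
have [t st ht] := near_real_part.
apply: ge_ereal_inf; exists (Normc.normc (mu - (t +i* s)))%:E.
  exists (t +i* s) => //; apply/spectrum_shift.
  have -> : t +i* s - 0 +i* s = t%:C by apply/eqP; rewrite eq_complex /= subr0 subrr !eqxx.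
  exact: st.
rewrite lee_fin; apply: normc_le; first by rewrite mulr_ge0 ?(ltW s_gt0).
rewrite !raddfB /= bE -/a; have -> : (a - t) ^+ 2 = (t - a) ^+ 2 by ring.
have -> : (s * dl) ^+ 2 = (s * dl * tu) ^+ 2 + (s * tu ^+ 2 - s) ^+ 2.
  have -> : s * tu ^+ 2 - s = - (s * dl ^+ 2) by rewrite -[X in _ - X]mulr1 -sq1; ring.
  by rewrite -[LHS]mulr1 -sq1; ring.
by rewrite lerD2r.
Qed.

Lemma dist_real_part : (cdist a%:C (spectrum Omega L) <= (s * dl * tu)%:E)%E.
Proof.
have [u [x [_ n0 ux [d0 t0 sq1 bE _]]]] := eigenpair_data hmu.
have [t st ht] := near_real_part.
apply: ge_ereal_inf; exists (Normc.normc (a%:C - t%:C))%:E; first by exists t%:C.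
rewrite lee_fin; apply: normc_le; first exact: mulr_ge0 (mulr_ge0 (ltW s_gt0) d0) t0.
rewrite !raddfB /= subrr expr0n addr0.
by have -> : (a - t) ^+ 2 = (t - a) ^+ 2 by ring.
Qed.

(** A point of the spectrum outside Lambda differs from Re mu: otherwise Re mu would be
    its own nearest point lambda, which is in Lambda. Hence it is at distance at least K
    from Re mu, and invariant_subspace_gap applies with every real r <= K. If K is zero
    the right-hand side is infinite unless the numerator vanishes; then
    (L - Re mu) phi = 0 and phi itself belongs to the eigenspaces. *)
Lemma eigenspace_approximation (lambda : R[i]) (Lambda : set R[i]) :
  spectrum Omega L lambda ->
  (forall sigma, spectrum Omega L sigma ->
     Normc.normc (lambda - a%:C) <= Normc.normc (sigma - a%:C)) ->
  Lambda `<=` spectrum Omega L -> Lambda lambda ->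
  (ereal_inf [set (L2norm Omega (fun t : E => phi t - v t) / L2norm Omega phi)%:E
             | v in eigenspaces Omega L Lambda]
   <= (s * dl * tu)%:E / cdist a%:C (spectrum Omega L `\` (Lambda `|` [set a%:C])))%E.
Proof.
move=> sl lmin LS Ll; set q := ereal_inf _; set K := cdist _ _; set num := s * dl * tu.
have [u [x [uE n0 ux [d0 t0 sq1 bE fE]]]] := eigenpair_data hmu.
set n := B u u in n0 fE; rewrite -/num in fE.
have num0 : 0 <= num by exact: mulr_ge0 (mulr_ge0 (ltW s_gt0) d0) t0.
have nE : L2norm Omega phi = Num.sqrt n by rewrite uE L2norm_cplx.
have N0 : 0 < Num.sqrt n by rewrite sqrtr_gt0.
have aL : spectrum Omega L a%:C -> Lambda a%:C.
  move=> sa; have := lmin _ sa; rewrite subrr Normc.normc0 => h.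
  have /Normc.eq0_normc/eqP : Normc.normc (lambda - a%:C) = 0.
    by apply/eqP; rewrite eq_le h normc_ge0.
  by rewrite subr_eq0 => /eqP <-.
have q0 : (0 <= q)%E.
  by apply/ereal_infP => _ [v _ <-]; rewrite lee_fin divr_ge0// sqrtr_ge0.
have qle m : eigenspaces Omega L Lambda (cplx m) ->
    (q <= (Num.sqrt (B (u - m) (u - m)) / Num.sqrt n)%:E)%E.
  move=> em; apply: ge_ereal_inf; eexists; first by exists (cplx m).
  by rewrite nE uE -[fun _ => _](cplxD u (- m)) L2norm_cplx.
have [y qE] : exists y : R, q = y%:E.
  have [M0 _ _] := eigen_span_subspace LS.
  have := qle 0 (eigen_span_eigenspaces LS M0).
  by move: q0; case: (q) => // y; exists y.
rewrite qE lee_fin in q0; have {}qle m : eigenspaces Omega L Lambda (cplx m) ->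
    y ^+ 2 * n <= B (u - m) (u - m).
  move=> /qle; rewrite qE lee_fin ler_pdivlMr// => h.
  rewrite -[n]sqr_sqrtr ?(ltW n0)// -exprMn -[leRHS]sqr_sqrtr ?sip_ge0//.
  by rewrite ler_pXn2r ?nnegrE ?sqrtr_ge0 ?mulr_ge0 ?sqrtr_ge0.
have gap r : 0 <= r -> (r%:E <= K)%E -> r * y <= num.
  move=> r0 rK; have H t : spectrum Omega L t%:C -> ~ Lambda t%:C -> r ^+ 2 <= (t - a) ^+ 2.
    move=> st nt; have : (K <= (Normc.normc (a%:C - t%:C))%:E)%E.
      apply: ge_ereal_inf; eexists; last exact: lexx.
      exists t%:C => //; split => // -[//|ta]; apply: nt; rewrite ta; apply: aL.
      by rewrite -ta.
    move=> /(le_trans rK); rewrite lee_fin => h.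
    have -> : (t - a) ^+ 2 = Normc.normc (a%:C - t%:C) ^+ 2.
      by rewrite normc_sqr !raddfB /= subrr expr0n addr0; ring.
    by rewrite ler_pXn2r ?nnegrE// normc_ge0.
  rewrite -(@ler_pXn2r _ 2)// ?nnegrE ?mulr_ge0// -(ler_pM2r n0).
  apply/ler_addgt0Pr => e e0.
  have [m em] := invariant_subspace_gap LS n0 ux H e0.
  rewrite fE; apply: le_trans; rewrite exprMn -mulrA ler_wpM2l ?sqr_ge0//.
  exact: qle.
have K0 : (0 <= K)%E.
  by apply/ereal_infP => _ [w _ <-]; rewrite lee_fin normc_ge0.
rewrite qE; case: K K0 gap => [k||//] K0 gap; last first.
  rewrite invey mule0 lee_fin leNgt; apply/negP => y0.
  (* No point of the spectrum is left: every r is admissible, so y vanishes. *)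
  have r0 : 0 <= (num + 1) / y := divr_ge0 (addr_ge0 num0 ler01) (ltW y0).
  by have := gap _ r0 (leey _); rewrite divfK ?gt_eqF// gerDl ler10.
rewrite lee_fin in K0; rewrite inver; have [k0|k0] := eqVneq k 0; last first.
  have kp : 0 < k by rewrite lt_neqAle eq_sym k0.
  by rewrite -EFinM lee_fin ler_pdivlMr// mulrC gap.
have [nz|nz] := eqVneq num 0; last by rewrite gt0_muley ?leey// lte_fin lt_neqAle eq_sym nz.
have f0 : B (x - (1 + a) *: u) (x - (1 + a) *: u) = 0 by rewrite fE nz expr0n mul0r.
have eu : Defs.eigenspace Omega L a%:C (cplx u).
  apply/eigenspaceP => z; rewrite ux (eq_null_sip _ f0) sipZl.
  by rewrite addrC.
have sa := eigen_spectrum n0 eu.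
have := qle u (eigen_span_eigenspaces LS (eigen_span1 (aL sa) eu)).
rewrite subrr sip0l pmulr_lle0// => y2; have /eqP : y ^+ 2 = 0.
  by apply/eqP; rewrite eq_le y2 sqr_ge0.
by rewrite sqrf_eq0 nz mul0e => /eqP ->.
Qed.

End eigenpair_estimates.

End compact_resolvent_operator.

Theorem theorem2p4 (R : realType) (d : nat) (Omega : set 'rV[R]_d)
  (Omega_open : open Omega) (Omega_bounded : bounded_set Omega)
  (Omega_connected : connected Omega)
  (V : 'rV[R]_d -> R) (V_Linfty : Linfty Omega V)
  (V_ge0 : {ae lebesgue_rV R d, forall x, Omega x -> 0 <= V x})
  (A : 'rV[R]_d -> 'M[R]_d)
  (A_sym : forall x, Omega x -> (A x)^T = A x)
  (c C : R) (c_gt0 : 0 < c) (C_gt0 : 0 < C)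
  (A_elliptic : {ae lebesgue_rV R d, forall x, Omega x -> forall v : 'cV[R]_d,
     c * (v^T *m v) ord0 ord0 <= (v^T *m A x *m v) ord0 ord0 /\
     (v^T *m A x *m v) ord0 ord0 <= C * (v^T *m v) ord0 ord0})
  (A_Linfty : (d <= 2)%N -> forall i j, Linfty Omega (fun x => A x i j))
  (A_lipschitz : (2 < d)%N ->
     forall i j, [lipschitz (A x i j : R^o) | x in Omega])
  (D : set 'rV[R]_d) (D_open : open D) (D_neq0 : D !=set0)
  (D_proper : D `<` Omega)
  (s : R) (s_gt0 : 0 < s)
  (mu : R[i]) (phi : 'rV[R]_d -> R[i]) :
  let L := elliptic_op Omega A V in
  let Ls := add_mul Omega L (fun x => 0 +i* (s * \1_D x)) in
  let L_is := add_mul Omega L (cst (0 +i* s)) in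
  let Re_mu := (complex.Re mu)%:C in
  eigenpair Omega Ls mu phi ->
  [/\ ((s * delta Omega phi D ^+ 2)%:E <= cdist mu (spectrum Omega L_is))%E,
      (cdist mu (spectrum Omega L_is) <= (s * delta Omega phi D)%:E)%E,
      (cdist Re_mu (spectrum Omega L)
         <= (s * delta Omega phi D * tau Omega phi D)%:E)%E &
      forall (lambda : R[i]) (Lambda : set R[i]),
        spectrum Omega L lambda ->
        (forall sigma, spectrum Omega L sigma ->
           Normc.normc (lambda - Re_mu) <= Normc.normc (sigma - Re_mu)) ->
        Lambda `<=` spectrum Omega L -> Lambda lambda ->
        (ereal_inf [set (L2norm Omega (fun x => phi x - v x)
                         / L2norm Omega phi)%:E
                   | v in eigenspaces Omega L Lambda]
         <= (s * delta Omega phi D * tau Omega phi D)%:E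
            / cdist Re_mu (spectrum Omega L `\` (Lambda `|` [set Re_mu])))%E].
Proof.
move=> L Ls L_is Re_mu hphi.
have V_inf : ess_bounded (lebesgue_rV R d) Omega V := V_Linfty.
have A_inf i j : ess_bounded (lebesgue_rV R d) Omega (fun x => A x i j).
  have [d2|d2] := leqP d 2; first exact: A_Linfty.
  exact: (lipschitz_ess_bounded Omega_open (lebesgue_rV R d) Omega_bounded (A_lipschitz d2 i j)).
have [T [Tsym Tcpt TJ LP]] : exists T : complex_L2 Omega_open -> complex_L2 Omega_open,
    [/\ symmetric_map (complex_inner Omega_open) T, compact_map (complex_inner Omega_open) T,
    forall x y, complex_inner Omega_open (T (Jmul x)) y = complex_inner Omega_open (Jmul (T x)) y &
    forall u g, L (cplx u) (cplx g) <->
      forall y, complex_inner Omega_open u y = complex_inner Omega_open (g + u) (T y)].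
  exists (complex_resolvent (oO := Omega_open) V_inf V_ge0 A_sym c_gt0 C_gt0 A_elliptic A_inf); split.
  - exact: complex_resolvent_sym.
  - exact: (complex_resolvent_compact Omega_open Omega_bounded).
  - exact: complex_resolventJ.
  - exact: (elliptic_weakP (oO := Omega_open) Omega_bounded).
have L_repr v g : L v g -> exists u h : complex_L2 Omega_open, v = cplx u /\ g = cplx h.
  exact: elliptic_repr.
have mD := open_rV_measurable D_open.
have DO : D `<=` Omega by case: D_proper.
split.
- exact: (dist_shifted_lower Tsym Tcpt TJ L_repr LP mD DO s_gt0 hphi).
- exact: (dist_shifted_upper Tsym Tcpt TJ L_repr LP mD DO s_gt0 hphi).
- exact: (dist_real_part Tsym Tcpt TJ L_repr LP mD DO s_gt0 hphi).
- move=> lambda Lambda.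
  exact: (eigenspace_approximation Tsym Tcpt TJ L_repr LP mD DO s_gt0 hphi).
Qed.
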